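(* Let $X$ and $Y$ be attractors of the dust-like strongly connected graph-directed iterated function systems $\Phi$ and $\Psi$ respectively, and assume that $\dim_{\mathrm H}X=\dim_{\mathrm H}Y=s>0$. Furthermore, assume that at least one of the sets of cycle ratios $R(\Phi)$, $R(\Psi)$ is commensurable. Then the following are equivalent: (1) There exists a Lipschitz surjection $X\to Y$. (2) The set $R(\Phi)\cup R(\Psi)$ is commensurable.
   Context: A graph-directed iterated function system (GD-IFS) is a triple $\Phi=(V,E,S)$ consisting of a finite directed graph $(V,E)$ (loops and multiple edges allowed) together with a contracting similarity $S_e:\mathbb R^d\to\mathbb R^d$ of ratio $r_e\in(0,1)$ for each edge $e\in E$. $E_{i,j}$ is the set of edges from $i$ to $j$. The attractors of $\Phi$ are the unique nonempty compact sets $(X_i)_{i\in V}$ with $X_i=\bigcup_{j\in V}\bigcup_{e\in E_{i,j}}S_e(X_j)$ for every $i\in V$; an attractor of $\Phi$ is one of the $X_i$. $\Phi$ is dust-like if for every $i\in V$ the sets $S_e(X_j)$ ($j\in V$, $e\in E_{i,j}$) in this union are pairwise disjoint. $\Phi$ is strongly connected if there is a directed path between any two vertices of $(V,E)$ (and the graph has at least one edge). A cycle is a cyclic (closed) walk without repeated vertices (loops are cycles); its cycle ratio is $r_C=\prod_{e\in C}r_e$. $R(\Phi)$ is the set of cycle ratios of $\Phi$. A set $R\subseteq\mathbb R^+$ is commensurable if $\log r_1/\log r_2\in\mathbb Q$ for every $r_1,r_2\in R$. *)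

(* Defs.v *)
From HB Require Import structures.
From mathcomp Require Import all_boot all_order all_algebra.
From mathcomp Require Import all_classical all_reals all_analysis.

Set Implicit Arguments.
Unset Strict Implicit.
Unset Printing Implicit Defensive.

Import Order.TTheory GRing.Theory Num.Theory.
Import numFieldNormedType.Exports.

Local Open Scope classical_set_scope.
Local Open Scope ring_scope.

(* The library norm on ['rV[R]_d] is the sup norm, and similarity ratios depend
   on the norm: all metric notions below use the Euclidean distance. The
   library topology on ['rV[R]_d] is the Euclidean one. *)
Definition edist (R : realType) (d : nat) (x y : 'rV[R]_d) : R :=
  Num.sqrt (\sum_(i < d) (x ord0 i - y ord0 i) ^+ 2).

Definition similarity (R : realType) (d : nat) (r : R)
    (f : 'rV[R]_d -> 'rV[R]_d) : Prop :=
  forall x y, edist (f x) (f y) = r * edist x y.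

Definition lipschitz_in (R : realType) (d1 d2 : nat) (A : set 'rV[R]_d1)
    (f : 'rV[R]_d1 -> 'rV[R]_d2) : Prop :=
  exists2 L : R, 0 <= L &
    forall x y, A x -> A y -> edist (f x) (f y) <= L * edist x y.

Section HausdorffDimension.
Local Open Scope ereal_scope.
Variables (R : realType) (d : nat).
Implicit Types (A U : set 'rV[R]_d) (s delta : R).

(* The added [0] only matters for the empty set, whose diameter is then 0. *)
Definition diam U : \bar R :=
  ereal_sup (0 |` [set (edist p.1 p.2)%:E | p in U `*` U]).

(* [diam U ^ s]; the case split makes [set0] weightless also when [s = 0]
   (where [0 `^ 0 = 1]). *)
Definition diam_pow s U : \bar R :=
  if U == set0 then 0 else diam U `^ s.

Definition hausdorff_content s delta A : \bar R :=
  ereal_inf [set \sum_(0 <= k <oo) diam_pow s (U k) |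
    U in [set U : (set 'rV[R]_d)^nat |
            (forall k, diam (U k) <= delta%:E) /\ A `<=` \bigcup_k U k]].

Definition hausdorff_measure s A : \bar R :=
  ereal_sup [set hausdorff_content s delta A | delta in [set x : R | (0 < x)%R]].

Definition hausdorff_dim A : \bar R :=
  ereal_inf [set s%:E | s in [set s : R | (0 <= s)%R /\ hausdorff_measure s A = 0]].

End HausdorffDimension.

Record gdifs (R : realType) (d : nat) := Gdifs {
  vertex : finType;
  edge : finType;
  src : edge -> vertex;
  tgt : edge -> vertex;
  smap : edge -> 'rV[R]_d -> 'rV[R]_d;
  ratio : edge -> R;
  ratio_itv : forall e, 0 < ratio e < 1;
  smap_similarity : forall e, similarity (ratio e) (smap e)
}.

Section GraphDirectedIFS.
Variables (R : realType) (d : nat) (Phi : gdifs R d).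

Definition attractors (K : vertex Phi -> set 'rV[R]_d) : Prop :=
  forall i : vertex Phi,
    [/\ K i !=set0, compact (K i) &
        K i = \bigcup_(e in [set e : edge Phi | src e = i])
                (smap e @` K (tgt e))].

Definition attractor_of (X : set 'rV[R]_d) : Prop :=
  exists (K : vertex Phi -> set 'rV[R]_d) (i : vertex Phi),
    attractors K /\ X = K i.

(* The family [K] of attractors is unique; it exists as soon as every vertex has
   an outgoing edge. *)
Definition dust_like : Prop :=
  forall K : vertex Phi -> set 'rV[R]_d, attractors K ->
  forall i : vertex Phi,
    trivIset [set e : edge Phi | src e = i] (fun e => smap e @` K (tgt e)).

Definition adjacent : rel (vertex Phi) :=
  fun i j => [exists e : edge Phi, (src e == i) && (tgt e == j)].

(* [connect] is reflexive, but once there is an edge every vertex also lies on a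
   closed path of positive length. *)
Definition strongly_connected : Prop :=
  (exists e : edge Phi, True) /\ (forall i j : vertex Phi, connect adjacent i j).

(* A cycle is given by its edges in cyclic order, from some starting edge. *)
Definition is_cycle (c : seq (edge Phi)) : bool :=
  [&& c != [::], cycle (fun e e' => tgt e == src e') c
    & uniq [seq src e | e <- c]].

Definition cycle_ratio (c : seq (edge Phi)) : R := \prod_(e <- c) ratio e.

Definition cycle_ratios : set R :=
  [set cycle_ratio c | c in [set c | is_cycle c]].

End GraphDirectedIFS.

Definition commensurable (R : realType) (A : set R) : Prop :=
  forall r1 r2 : R, A r1 -> A r2 -> exists q : rat, ln r1 / ln r2 = ratr q.

(* Main.v *)
From Pilot Require Import Defs.
From HB Require Import structures.
From mathcomp Require Import all_boot all_order all_algebra.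
From mathcomp Require Import all_classical all_reals all_analysis.
From mathcomp Require Import zify ring lra.
Import Order.TTheory GRing.Theory Num.Theory.
Import numFieldNormedType.Exports.
(* makes [edist] the Euclidean distance again *)
Import Pilot.Defs.
Set Implicit Arguments.
Unset Strict Implicit.
Unset Printing Implicit Defensive.
Local Open Scope classical_set_scope.
Local Open Scope ring_scope.

(** The proof replaces measures by finite sums over words. Write [wr w] for the
    ratio of a path [w]. Distances in a dust-like attractor are governed by the
    longest common word ([diam_bound], [sep_bound]). By Perron-Frobenius there are
    a positive vector [h] and [lam] with
    [\sum_(src e = i) ratio e `^ s * h (tgt e) = lam * h i], and the Hausdorff
    dimension of an attractor is [s] only if [lam = 1] ([eigenvalue_eq1]). Then
    [wr w `^ s * h (end of w)] is an additive mass on cylinders, comparable to the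
    [s]-th power of their diameters, in both systems. If the cycle ratios of a
    system are commensurable, then all ratios are powers of one number [theta] up
    to a potential on the vertices ([homogeneous_form]).

    From commensurability to a Lipschitz surjection. Over a common [theta] both
    systems become subdivision schemes in which each generation scales by [theta]
    and which are described by integer matrices [A] (source) and [B] (target) on
    finitely many types. Equality of the dimensions says that they have the same
    Perron-Frobenius eigenvalue, so the product of a right eigenvector of [B] and a
    left eigenvector of [A] is a solution [N >= 0] of [N A = B N]. As this linear
    system is rational it has a solution in natural numbers ([bags]). Its rows
    attach to each type of piece of the target a bag of types of pieces of the
    source, such that the children of a bag are exactly the bags of the children.
    A piece of the target matched with such a bag can therefore be subdivided
    forever ([matched_step]), and the resulting matching of nested partitions is
    a Lipschitz surjection ([tree_map]).

    From a Lipschitz surjection [f] to commensurability. The preimage of a cylinder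
    [v] of the target is a union of boundedly many cylinders of comparable scale.
    Minimise the quotient of the mass of such a union [A] by the mass of [v], among
    all [A] whose image meets all small cylinders in [v]. Since both masses are
    additive, the quotient is nearly constant on many generations below a nearly
    minimal pair ([nearly_constant]). No cylinder of [A] can be spared, so some
    cylinder of the target a bounded number of generations below [v] has its
    preimage inside any prescribed cylinder [w] of [A]. Hence [wr w `^ s] is, up to
    a small error, [wr v `^ s] times one of finitely many constants ([balanced]).
    Going around a fixed cycle of one system many times, while the other system
    only has ratios of the form [theta ^+ n] up to finitely many constants, the
    pigeonhole principle yields a rational relation between the logarithms of the
    cycle ratio and of [theta] ([approx_rational]). *)

(** * Perron-Frobenius eigenvectors of weighted graphs *)

Lemma continuous_sumR (R : realType) (T : topologicalType) (I : Type)
    (r : seq I) (P : pred I) (f : I -> T -> R) :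
  (forall i, P i -> continuous (f i)) ->
  continuous (fun x => \sum_(i <- r | P i) f i x).
Proof. by move=> fc; apply: continuous_big => //; exact: add_continuous. Qed.

Section PerronFrobenius.
Variables (R : realType) (V E : finType) (src tgt : E -> V) (a : E -> R).
Hypothesis a_gt0 : forall e, 0 < a e.

Definition trans (x : V -> R) (i : V) : R := \sum_(e | src e == i) a e * x (tgt e).

(** Adding the identity keeps what is already positive, so that powers become
    positive along paths of all lengths at once. *)
Definition lazy_trans (x : V -> R) (i : V) : R := x i + trans x i.

Lemma trans_ge0 x : (forall i, 0 <= x i) -> forall i, 0 <= trans x i.
Proof. by move=> x0 i; apply: sumr_ge0 => e _; rewrite mulr_ge0// ltW. Qed.

Lemma iter_lazy_ge0 N x : (forall i, 0 <= x i) ->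
  forall i, 0 <= iter N lazy_trans x i.
Proof.
move=> x0; elim: N => [|N IH] i //=.
by rewrite /lazy_trans addr_ge0// trans_ge0.
Qed.

Lemma iter_lazy_mono N M x i : (forall i, 0 <= x i) -> (N <= M)%N ->
  iter N lazy_trans x i <= iter M lazy_trans x i.
Proof.
move=> x0 /subnK <-; elim: (M - N)%N => [|k IH] //=.
by apply: le_trans IH _; rewrite /= {2}/lazy_trans lerDl trans_ge0//; exact: iter_lazy_ge0.
Qed.

Lemma iter_lazy_defect N x t i :
  trans (iter N lazy_trans x) i - t * iter N lazy_trans x i =
  iter N lazy_trans (fun i => trans x i - t * x i) i.
Proof.
elim: N i => [|N IH] i //=.
have transB y : trans (fun i => trans y i - t * y i) i =
    trans (trans y) i - t * trans y i.
  rewrite /trans mulr_sumr -sumrB; apply: eq_bigr => e _.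
  by rewrite mulrBr mulrCA.
have transD y z : trans (fun i => y i + z i) i = trans y i + trans z i.
  by rewrite /trans -big_split; apply: eq_bigr => e _; rewrite mulrDr.
rewrite -(funext IH); set y := iter N lazy_trans x.
have -> : trans (lazy_trans y) i = trans y i + trans (trans y) i by exact: transD.
by rewrite /lazy_trans transB; ring.
Qed.

Hypothesis conn : forall i j,
  connect (fun i j => [exists e, (src e == i) && (tgt e == j)]) i j.

(** Each iteration spreads positivity one edge backwards, while the summand [x i]
    keeps what is already positive. *)
Lemma iter_lazy_gt0 x j : (forall i, 0 <= x i) -> 0 < x j ->
  exists N, forall i, 0 < iter N lazy_trans x i.
Proof.
move=> x0 xj.
have ex i : exists N, 0 < iter N lazy_trans x i.
  have /connectP[p p0 jE] := conn i j; exists (size p).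
  elim: p i p0 jE => [|k p IH] i /=; first by move=> _ <-.
  move=> /andP[/existsP[e /andP[/eqP ei /eqP ek]] pp] jE.
  rewrite /lazy_trans ltr_wpDl ?iter_lazy_ge0// /trans (bigD1 e) ?ei//=.
  rewrite ltr_pwDl// ?mulr_gt0// ?ek ?IH//.
  by apply: sumr_ge0 => f _; rewrite mulr_ge0 ?iter_lazy_ge0// ltW.
have [N NP] := choice ex.
exists (\max_i N i)%N => i; apply: lt_le_trans (NP i) _.
exact/iter_lazy_mono/leq_bigmax.
Qed.

(** The largest [t] admitting a nonnegative [x] with [t x <= trans x] is attained,
    as a maximum over the product of the simplex with a bounded interval. *)
Lemma collatz_wielandt : inhabited V -> exists (x : V -> R) (t : R),
  [/\ forall i, 0 <= x i, \sum_i x i = 1, forall i, t * x i <= trans x i &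
      forall y u, (forall i, 0 <= y i) -> 0 < \sum_i y i ->
        (forall i, u * y i <= trans y i) -> u <= t].
Proof.
move=> [v0].
pose n := #|V|; pose M : R := \sum_e a e.
have M0 : 0 <= M by apply: sumr_ge0 => e _; exact: ltW.
pose vf (v : 'rV[R]_n) : V -> R := fun i => v ord0 (enum_rank i).
have vfc i : continuous (fun p : 'rV[R]_n * R => vf p.1 i).
  move=> p; rewrite /vf.
  exact: (continuous_comp (@cvg_fst _ _ _ _ _) (@coord_continuous _ _ _ _ _ _)).
pose B := [set v : 'rV[R]_n | forall i, `[0, 1]%classic (v ord0 i)] `*` `[0, M]%classic.
have Bc : compact B.
  apply: compact_setX; last exact: segment_compact.
  have cI : forall _ : 'I_n, compact (`[0, 1]%classic : set R).
    by move=> _; exact: segment_compact.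
  exact: (rV_compact cI).
pose C1 := [set p : 'rV[R]_n * R | \sum_i vf p.1 i = 1].
pose C2 i := [set p : 'rV[R]_n * R | p.2 * vf p.1 i <= trans (vf p.1) i].
have C1c : closed C1.
  have : continuous (fun p : 'rV[R]_n * R => \sum_i vf p.1 i).
    by apply: continuous_sumR => i _; exact: vfc.
  by move=> /continuous_closedP /(_ [set 1]); apply; exact: closed_eq.
have C2c i : closed (C2 i).
  have cf : continuous (fun p : 'rV[R]_n * R => trans (vf p.1) i - p.2 * vf p.1 i).
    move=> p; apply: cvgB.
      by apply: continuous_sumR => e _ q; apply: cvgM; [exact: cvg_cst|exact: vfc].
    by apply: cvgM; [exact: cvg_snd|exact: vfc].
  rewrite (_ : C2 i = (fun p : 'rV[R]_n * R => trans (vf p.1) i - p.2 * vf p.1 i) @^-1`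
    [set x | 0 <= x]); last by apply/seteqP; split => p /=; rewrite /C2/= subr_ge0.
  by apply: (continuous_closedP _).1 => //; exact: closed_ge.
pose C := B `&` (C1 `&` \bigcap_i C2 i).
have Cc : compact C.
  by apply: compact_closedI => //; apply: closedI => //; apply: closed_bigI => i _.
have mem (y : V -> R) u : (forall i, 0 <= y i) -> 0 < \sum_i y i -> 0 <= u ->
    (forall i, u * y i <= trans y i) ->
    C ((\row_k (y (enum_val k) / \sum_i y i)), u).
  move=> y0 S0 u0 uy; set S := \sum_i y i.
  have vE i : vf (\row_k (y (enum_val k) / S)) i = y i / S.
    by rewrite /vf mxE enum_rankK.
  have yS i : y i <= S by rewrite /S (bigD1 i)//= lerDl; exact: sumr_ge0.
  split; [split => /=|split => /=].
  - move=> k; rewrite mxE /= in_itv/= divr_ge0 ?(ltW S0)//=.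
    by rewrite ler_pdivrMr// mul1r.
  - rewrite in_itv/= u0 /=.
    rewrite -(ler_pM2r S0) mulr_sumr.
    apply: le_trans (ler_sum _ (fun i _ => uy i)) _.
    rewrite /trans /M mulr_suml.
    rewrite [leLHS](_ : _ = \sum_e a e * y (tgt e)).
      by apply: ler_sum => e _; rewrite ler_wpM2l// ltW.
    rewrite (exchange_big_dep xpredT)//=; apply: eq_bigr => e _.
    by rewrite (big_pred1 (src e)) => [//|i]; rewrite eq_sym.
  - rewrite /C1/= (eq_bigr _ (fun i _ => vE i)) -mulr_suml divff//.
    by rewrite gt_eqF.
  - move=> i _; rewrite /C2/= vE /trans mulrA.
    under eq_bigr do rewrite vE mulrA.
    by rewrite -mulr_suml ler_wpM2r ?uy// invr_ge0 ltW.
have C0 : C !=set0.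
  eexists; apply: (mem (fun=> 1) 0) => //; first by rewrite (bigD1 v0)//= ltr_pwDl// sumr_ge0.
  by move=> i; rewrite mul0r; exact: trans_ge0.
have [p pC pmax] : exists2 p, p \in C & forall q, q \in C -> q.2 <= p.2.
  apply: compact_EVT_max => //.
  by apply: continuous_subspaceT => q; exact: cvg_snd.
move: pC; rewrite inE => -[[/= p01 _] [p1 p2]].
exists (vf p.1), p.2; split => //.
- by move=> i; have := p01 (enum_rank i); rewrite /= in_itv/= => /andP[].
- by move=> i; exact: p2.
- move=> y u y0 S0 uy; have [u0|u0] := leP 0 u; last first.
    have := pmax _ (mem_set (mem y 0 y0 S0 (lexx _) _)).
    move=> /= pm; apply: le_trans (ltW u0) (pm _) => i.
    by rewrite mul0r trans_ge0.
  by have /= := pmax _ (mem_set (mem y u y0 S0 u0 uy)).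
Qed.

(** If the maximal [x] were not an eigenvector, applying a positive power of
    [1 + trans] to the defect [trans x - t x] would make it positive everywhere,
    which leaves room for a larger [t]. *)
Lemma perron_frobenius : inhabited E -> exists (h : V -> R) (lam : R),
  [/\ forall i, 0 < h i, 0 < lam & forall i, trans h i = lam * h i].
Proof.
move=> [e0]; have [|x [t [x0 x1 tx tmax]]] := collatz_wielandt.
  exact: inhabits (src e0).
have [j xj] : exists j, 0 < x j.
  have : 0 < \sum_i x i by rewrite x1.
  case: (pselect (exists j, 0 < x j)) => // /forallNP nx.
    by rewrite big1 ?ltxx// => j _; apply/eqP; rewrite eq_le x0 andbT leNgt; exact/negP.
have eigen i : trans x i = t * x i.
  apply/eqP; rewrite -subr_eq0; apply/negP => /negP ni.
  pose z i := trans x i - t * x i.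
  have z0 k : 0 <= z k by rewrite subr_ge0.
  have zi : 0 < z i by rewrite lt_def ni z0.
  have [N Ngt] := iter_lazy_gt0 z0 zi.
  pose y := iter N lazy_trans x.
  have y0 k : 0 <= y k by exact: iter_lazy_ge0.
  pose S := \sum_k y k.
  have S0 : 0 < S.
    apply: lt_le_trans (_ : 0 < \sum_k x k) _; first by rewrite x1.
    by apply: ler_sum => k _; exact: (@iter_lazy_mono 0 N).
  have yS k : y k <= S by rewrite /S (bigD1 k)//= lerDl; exact: sumr_ge0.
  have [d [d0 dz]] : exists d, 0 < d /\ forall k, d <= iter N lazy_trans z k.
    have [k _ kmin] : exists2 k : V, true & forall k', iter N lazy_trans z k <= iter N lazy_trans z k'.
      pose k := [arg min_(k < i) iter N lazy_trans z k]%O.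
      by exists k => // k'; rewrite /k; case: arg_minP => // m _; apply.
    by exists (iter N lazy_trans z k).
  have : t + d / S <= t.
    apply: (tmax y) => // k; rewrite mulrDl.
    have := iter_lazy_defect N x t k; rewrite -/z -/y => /eqP.
    rewrite subr_eq => /eqP ->; rewrite addrC lerD2r.
    apply: le_trans (dz k); rewrite mulrAC ler_pdivrMr// ler_wpM2l// ltW//.
  by rewrite gerDl leNgt divr_gt0.
have [N Ngt] := iter_lazy_gt0 x0 xj.
have iterE n i : iter n lazy_trans x i = (1 + t) ^+ n * x i.
  elim: n i => [|n IH] i /=; first by rewrite expr0 mul1r.
  rewrite (funext IH) /lazy_trans exprS.
  rewrite [trans _ i](_ : _ = (1 + t) ^+ n * trans x i).
    by rewrite eigen; ring.
  by rewrite /trans mulr_sumr; apply: eq_bigr => e _; rewrite mulrCA.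
have xgt i : 0 < x i.
  rewrite lt_def x0 andbT; apply/negP => /eqP xi.
  by have := Ngt i; rewrite iterE xi mulr0 ltxx.
exists x, t; split => //.
rewrite -(pmulr_lgt0 _ (xgt (src e0))) -eigen /trans (bigD1 e0)//=.
rewrite ltr_pwDl ?mulr_gt0//; apply: sumr_ge0 => e _.
by rewrite mulr_ge0// ltW.
Qed.

End PerronFrobenius.

(** * Rational points of real solution spaces *)

Lemma fin_pos_lower (R : realType) (I : finType) (f : I -> R) :
  (forall i, 0 < f i) -> exists2 m, 0 < m & forall i, m <= f i.
Proof.
move=> f0; exists (\big[Order.min/1]_i f i); first by apply: lt_bigmin.
by move=> i; exact: bigmin_le.
Qed.

Lemma fin_pos_upper (R : realType) (I : finType) (f : I -> R) :
  exists2 M, 0 < M & forall i, f i <= M.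
Proof.
exists (\big[Order.max/1]_i f i).
  by apply: (@lt_le_trans _ _ 1) => //; exact: bigmax_ge_id.
by move=> i; exact: le_bigmax.
Qed.

Section RationalSolutions.
Variables (R : realType) (I J : finType) (G : I -> J -> rat) (x : I -> R).
Hypothesis xG : forall j, \sum_i x i * ratr (G i j) = 0.

(** The kernel of a rational matrix is spanned by rational vectors, so approximating
    the coordinates of [x] along them stays inside the kernel. *)
Lemma rat_solution_near (d : R) : 0 < d -> exists y : I -> rat,
  (forall j, \sum_i y i * G i j = 0) /\ forall i, `|ratr (y i) - x i| < d.
Proof.
move=> d0.
pose Gm : 'M[rat]_(#|I|, #|J|) := \matrix_(i, j) G (enum_val i) (enum_val j).
pose xr : 'rV[R]_#|I| := \row_i x (enum_val i).
have sumE (A : zmodType) (F : 'I_#|I| -> A) : \sum_k F k = \sum_i F (enum_rank i).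
  by rewrite (reindex _ (onW_bij _ (@enum_rank_bij I))).
pose K := kermx Gm.
have /submxP[c cE] : (xr <= map_mx ratr K)%MS.
  rewrite /K map_kermx; apply/sub_kermxP/rowP => j; rewrite !mxE.
  by rewrite -[RHS](xG (enum_val j)) sumE; apply: eq_bigr => i _; rewrite !mxE !enum_rankK.
have KG : K *m Gm = 0 by exact: mulmx_ker.
clearbody K.
pose B : R := 1 + \sum_k \sum_i `|ratr (K k i)|.
have S0 : 0 <= \sum_k \sum_i `|ratr (K k i) : R| by do 2!(apply: sumr_ge0 => ? _).
have B0 : 0 < B by rewrite ltr_pwDl.
have /choice[c' c'P] : forall k, exists q : rat, ratr q \in `](c ord0 k), (c ord0 k + d / B)[.
  by move=> k; apply: rat_in_itvoo; rewrite ltrDl divr_gt0.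
pose y : 'rV[rat]_#|I| := (\row_k c' k) *m K.
exists (fun i => y ord0 (enum_rank i)); split.
  move=> j; have : (y *m Gm) ord0 (enum_rank j) = 0.
    by rewrite -mulmxA KG mulmx0 mxE.
  rewrite mxE sumE => yG; rewrite -[RHS]yG; apply: eq_bigr => i _.
  by rewrite [Gm _ _]mxE !enum_rankK.
move=> i.
have -> : x i = xr ord0 (enum_rank i) by rewrite mxE enum_rankK.
rewrite cE !mxE rmorph_sum -sumrB /=.
apply: le_lt_trans (ler_norm_sum _ _ _) _.
apply: (@le_lt_trans _ _ (d / B * \sum_k \sum_i `|ratr (K k i)|)).
  rewrite mulr_sumr; apply: ler_sum => k _.
  rewrite !mxE rmorphM /= -mulrBl normrM ler_pM//.
    have := c'P k; rewrite in_itv/= => /andP[c1 c2].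
    by rewrite ger0_norm ?subr_ge0 ?ltW// ltrBlDl.
  by rewrite (bigD1 (enum_rank i))//= lerDl sumr_ge0.
by rewrite -mulrA gtr_pMr// mulrC ltr_pdivrMr// mul1r /B ltrDr.
Qed.

End RationalSolutions.

(** A rational solution close to [x] has the signs of [x]; clearing denominators
    makes it integral. *)
Lemma nat_solution (R : realType) (I J : finType) (G : I -> J -> rat) (x : I -> R) :
  (forall i, 0 <= x i) -> (forall j, \sum_i x i * ratr (G i j) = 0) ->
  exists y : I -> nat, (forall i, (0 < y i)%N = (0 < x i)) /\
    forall j, \sum_i (y i)%:R * G i j = 0.
Proof.
move=> x0 xG.
have [|m m0 mx] := @fin_pos_lower R I (fun i => if 0 < x i then x i else 1).
  by move=> i; case: ifP.
(* extra equations force the zero entries of x to stay zero *)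
pose G' i (j : J + I) := match j with inl j => G i j
   | inr k => ((i == k) && (x i == 0))%:R end.
have sum1 (A : nzRingType) (u : I -> A) k (b : I -> bool) :
    \sum_i u i * ((i == k) && b i)%:R = u k * (b k)%:R.
  rewrite (bigD1 k)//= eqxx big1 ?addr0// => i /negPf ->.
  by rewrite mulr0.
have xG' j : \sum_i x i * ratr (G' i j) = 0.
  case: j => [j|k] /=; first exact: xG.
  under eq_bigr do rewrite ratr_nat.
  by rewrite sum1; case: eqP => [->|]; rewrite ?mul0r ?mulr0.
have [y [yG yx]] := rat_solution_near xG' m0.
have ypos i : (0 < y i) = (0 < x i).
  have [xi|/negPf xi] := boolP (0 < x i).
    have := mx i; rewrite xi => mxi; have := yx i.
    rewrite ltr_distl => /andP[+ _] => h.
    rewrite -(@ltr_rat R) rmorph0; apply: le_lt_trans h.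
    by rewrite subr_ge0.
  have xi0 : x i = 0 by apply/eqP; move: xi; rewrite lt_def x0 andbT; move/negbFE.
  have := yG (inr i); rewrite /= sum1 xi0 eqxx mulr1 => ->.
  by rewrite ltxx.
have y0 i : 0 <= y i.
  have := ypos i; case: (ltgtP (y i) 0) => // yi; rewrite ?lexx//.
  move=> /esym/negbT; rewrite -leNgt => xi.
  have xi0 : x i = 0 by apply/eqP; rewrite eq_le xi x0.
  by have := yG (inr i); rewrite /= sum1 xi0 eqxx mulr1 => yi0; rewrite yi0 ltxx in yi.
pose D := \prod_i denq (y i).
have D0 : 0 < D by apply: prodr_gt0.
have /choice[z zP] : forall i, exists z : nat, z%:R = y i * D%:~R.
  move=> i; rewrite /D (bigD1 i)//= rmorphM /= mulrA -numqE -rmorphM /=.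
  set t := _ * _; have t0 : 0 <= t.
    by rewrite mulr_ge0 ?numq_ge0// prodr_ge0// => k _; exact: denq_ge0.
  by exists `|t|%N; rewrite -[in RHS](gez0_abs t0) -pmulrn.
exists z; split.
  move=> i; rewrite -ypos -(ltr0n rat) zP pmulr_lgt0//.
  by rewrite ltr0z.
move=> j; under eq_bigr do rewrite zP mulrAC.
by rewrite -mulr_suml (yG (inl j)) mul0r.
Qed.

(** * Two finite combinatorial principles *)

(** By the pigeonhole principle two indices [n] share the same [k], so their
    difference [d] gives an integer combination of [a] and [b] of size at most
    [eps]. The differences [d] lie in a fixed finite set, hence one of them
    works for all [eps]; as the multiples of [a] are discrete, the combination
    it gives is eventually constant, hence zero. *)
Lemma approx_rational (R : realType) (a b : R) (ks : seq R) : a != 0 ->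
  (forall (N : nat) (eps : R), 0 < eps -> exists c : R, forall n, (n <= N)%N ->
     exists (k : R) (m : int), k \in ks /\ `|c + n%:R * b + m%:~R * a + k| <= eps) ->
  exists q : rat, b / a = ratr q.
Proof.
move=> a0 H; pose N := size ks.
have a_gt0 : 0 < `|a| by rewrite normr_gt0.
have H1 eps : 0 < eps -> exists (d : 'I_N) (m : int),
    `|d.+1%:R * b + m%:~R * a| <= eps.
  move=> e0; have [|c cP] := H N (eps / 2); first by rewrite divr_gt0.
  have /choice[km kmP] : forall n : 'I_N.+1, exists km : R * int, km.1 \in ks /\
      `|c + n%:R * b + km.2%:~R * a + km.1| <= eps / 2.
    by move=> n; have [k [m]] := cP n (ltn_ord n); exists (k, m).
  have idx (n : 'I_N.+1) : (index (km n).1 ks < N)%N by rewrite index_mem; case: (kmP n).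
  pose g n := Ordinal (idx n).
  have /injectivePn[i [j ij gij]] : ~~ injectiveb g.
    by apply/injectiveP => /leq_card; rewrite !card_ord ltnn.
  have kij : (km i).1 = (km j).1.
    have [[ki _] [kj _]] := (kmP i, kmP j).
    by rewrite -(nth_index 0 ki) -(nth_index 0 kj); congr (nth 0 ks _); exact: (congr1 (@nat_of_ord _) gij).
  wlog lt_ij : i j ij gij kij / (i < j)%N.
    move=> W; case: (ltngtP i j) => [|ji|/val_inj /eqP]; first exact: W.
      by apply: (W j i) => //; rewrite eq_sym.
    by rewrite (negPf ij).
  have dN : ((j - i).-1 < N)%N.
    by have := ltn_ord j; lia.
  exists (Ordinal dN), ((km j).2 - (km i).2) => /=.
  have -> : (j - i).-1.+1 = (j - i)%N by lia.
  rewrite natrB ?(ltnW lt_ij)// rmorphB /=.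
  have [[_ hi] [_ hj]] := (kmP i, kmP j).
  rewrite [X in `|X|](_ : _ = (c + j%:R * b + (km j).2%:~R * a + (km j).1)
     - (c + i%:R * b + (km i).2%:~R * a + (km i).1)); last by rewrite kij; ring.
  by apply: le_trans (ler_normB _ _) _; rewrite (splitr eps); exact: lerD.
have H2 : exists d : 'I_N, forall eps, 0 < eps -> exists m : int,
    `|d.+1%:R * b + m%:~R * a| <= eps.
  apply: contrapT => /forallNP nH.
  have /choice[e eP] : forall d : 'I_N, exists e, 0 < e /\
      forall m : int, e < `|d.+1%:R * b + m%:~R * a|.
    move=> d; have /existsNP[e /not_implyP[e0 /forallNP em]] := nH d.
    by exists e; split=> // m; rewrite ltNge; apply/negP/em.
  have [e' e'0 e'P] := fin_pos_lower (fun d => (eP d).1).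
  have [d [m dm]] := H1 _ e'0.
  by have := lt_le_trans ((eP d).2 m) dm; rewrite ltNge e'P.
have [d dP] := H2.
have [|m0 m0P] := dP (`|a| / 3); first by rewrite divr_gt0.
have z0 : d.+1%:R * b + m0%:~R * a = 0.
  apply/eqP; rewrite -normr_le0; apply/ler_addgt0Pr => e e0; rewrite add0r.
  have [|m mP] := dP (Num.min e (`|a| / 3)); first by rewrite lt_min e0 divr_gt0.
  move: mP; rewrite le_min => /andP[mP1 mP2].
  suff -> : m0 = m by [].
  apply/eqP; rewrite -subr_eq0; apply/negP => /negP m0m.
  have : `|(m0 - m)%:~R * a| <= `|a| / 3 + `|a| / 3.
    rewrite rmorphB /= mulrBl.
    rewrite [X in `|X|](_ : _ = (d.+1%:R * b + m0%:~R * a) - (d.+1%:R * b + m%:~R * a)); last by ring.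
    by apply: le_trans (ler_normB _ _) _; exact: lerD.
  have : 1 <= `|(m0 - m)%:~R : R|.
    by rewrite -intr_norm ler1z -gtz0_ge1 normr_gt0.
  rewrite normrM => h1 h2.
  have : `|a| <= `|(m0 - m)%:~R : R| * `|a| by rewrite ler_peMl.
  by move: h2 a_gt0; lra.
exists (- m0%:~R / d.+1%:R).
rewrite fmorph_div /= rmorphN /= ratr_int ratr_nat.
have d0 : d.+1%:R != 0 :> R by rewrite pnatr_eq0.
have : d.+1%:R * b = - (m0%:~R * a) by apply/eqP; rewrite -addr_eq0 z0.
by move=> e; apply/eqP; rewrite eqr_div// mulrC e mulNr.
Qed.

Section Splitting.
Variables (A T : eqType) (ty : A -> T).

Lemma perm_map_lift (C : seq A) (L : seq T) : perm_eq (map ty C) L ->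
  exists2 C', perm_eq C' C & map ty C' = L.
Proof.
elim: L C => [|t L IH] C.
  by move=> /perm_nilP/eqP; rewrite -size_eq0 size_map size_eq0 => /eqP ->; exists [::].
move=> pC; have /mapP[c cC tE] : t \in map ty C by rewrite (perm_mem pC) mem_head.
have [|C' pC' mC'] := IH (rem c C).
  rewrite -(perm_cons t) {1}tE -map_cons; apply: perm_trans pC.
  by apply: perm_map; rewrite perm_sym perm_to_rem.
exists (c :: C'); last by rewrite /= mC' tE.
by rewrite (permPr (perm_to_rem cC)) perm_cons.
Qed.

(** Regroups the elements of [C] according to any partition of their multiset of
    types; this distributes the children of a bag among smaller bags. *)
Lemma split_perm (C : seq A) (Ls : seq (seq T)) :
  perm_eq (map ty C) (flatten Ls) ->
  exists2 Cs, perm_eq (flatten Cs) C & map (map ty) Cs = Ls.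
Proof.
move=> /perm_map_lift[C' pC' mC'].
exists (reshape (shape Ls) C').
  by rewrite reshapeKr// -(size_map ty) mC' size_flatten.
by rewrite map_reshape mC' flattenK.
Qed.

End Splitting.

(** * Cylinders of a dust-like system *)

Section Euclid.
Variables (R : realType) (d : nat).
Implicit Types x y : 'rV[R]_d.

Lemma edist_ge0 x y : 0 <= edist x y.
Proof. exact: sqrtr_ge0. Qed.

Lemma edistxx x : edist x x = 0.
Proof. by rewrite /edist big1 ?sqrtr0// => i _; rewrite subrr expr0n. Qed.

Lemma edist_eq0 x y : edist x y = 0 -> x = y.
Proof.
move=> /eqP; rewrite sqrtr_eq0 => s0; apply/rowP => i.
have : \sum_(i < d) (x ord0 i - y ord0 i) ^+ 2 = 0.
  by apply/eqP; rewrite eq_le s0/= sumr_ge0// => k _; exact: sqr_ge0.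
move=> /psumr_eq0P => /(_ (fun k _ => sqr_ge0 _)) /(_ i isT) /eqP.
by rewrite sqrf_eq0 subr_eq0 => /eqP.
Qed.

Lemma edist_continuous : continuous (fun p : 'rV[R]_d * 'rV[R]_d => edist p.1 p.2).
Proof.
move=> p; apply: (@continuous_comp _ _ _ (fun p : 'rV[R]_d * 'rV[R]_d =>
  \sum_(i < d) (p.1 ord0 i - p.2 ord0 i) ^+ 2)); last exact: sqrt_continuous.
apply: continuous_sumR => i _ q.
have c : (fun p : 'rV[R]_d * 'rV[R]_d => p.1 ord0 i - p.2 ord0 i) @ q -->
    q.1 ord0 i - q.2 ord0 i.
  apply: cvgB.
    exact: (continuous_comp (@cvg_fst _ _ _ _ _) (@coord_continuous _ _ _ _ _ _)).
  exact: (continuous_comp (@cvg_snd _ _ _ _ _) (@coord_continuous _ _ _ _ _ _)).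
exact: cvgM.
Qed.

Lemma coord_le_edist x y i : `|x ord0 i - y ord0 i| <= edist x y.
Proof.
rewrite -sqrtr_sqr /edist ler_wsqrtr// (bigD1 i)//= lerDl.
by apply: sumr_ge0 => k _; exact: sqr_ge0.
Qed.

End Euclid.

Lemma similarity_continuous (R : realType) (d : nat) (r : R)
  (f : 'rV[R]_d -> 'rV[R]_d) : 0 < r -> similarity r f -> continuous f.
Proof.
move=> r0 fs x; apply/(@cvgrPdist_lt _ _ _ (nbhs x)) => e e0.
have ec : {for x, continuous (fun y => edist x y)}.
  exact: (continuous_comp (cvg_pair (cvg_cst x) cvg_id) (@edist_continuous R d (x, x))).
have near_x : \forall y \near x, edist x y < e / r.
  by apply: (@cvgr_lt _ _ (nbhs x) _ _ _ ec); rewrite edistxx divr_gt0.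
near=> y; have xy : edist x y < e / r by near: y; exact: near_x.
have le_e : edist (f x) (f y) < e by rewrite fs mulrC -ltr_pdivlMr.
rewrite [X in X < _]/Num.norm /= mx_normrE; apply: bigmax_lt => //= -[i j] _ /=.
by rewrite ord1 !mxE; apply: le_lt_trans le_e; exact: coord_le_edist.
Unshelve. all: by end_near. Qed.

(** The sets containing some [C n] form a filter; it clusters in every [C n]. *)
Lemma nested_compact (T : topologicalType) (C : nat -> set T) :
  hausdorff_space T ->
  (forall n, compact (C n)) -> (forall n, C n !=set0) ->
  (forall n, C n.+1 `<=` C n) -> exists x, forall n, C n x.
Proof.
move=> hT Cc C0 Cs.
have mono n m : (n <= m)%N -> C m `<=` C n.
  by move=> /subnK <-; elim: (m - n)%N => // k IH; apply: subset_trans (Cs _) IH.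
pose F := [set A | exists n, C n `<=` A].
have FF : ProperFilter F.
  split; first by case=> n Cn; have [x] := C0 n; move/Cn.
  split; first by exists 0%N.
    move=> A B [n nA] [m mB]; exists (maxn n m) => x Cx; split.
      by apply: nA; apply: mono Cx; exact: leq_maxl.
    by apply: mB; apply: mono Cx; exact: leq_maxr.
  by move=> A B AB [n nA]; exists n; exact: subset_trans AB.
have [x [_ xF]] := Cc 0%N F FF (ex_intro _ 0%N (@subset_refl _ _)).
exists x => n; apply: (compact_closed hT (Cc n)) => B xB.
by have := xF (C n) B (ex_intro _ n (@subset_refl _ _)) xB.
Qed.

Section Words.
Variables (R : realType) (d : nat) (Phi : gdifs R d).
Local Notation V := (vertex Phi).
Local Notation E := (edge Phi).
Implicit Types (i j : V) (e : E) (w u v : seq E).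

Fixpoint walk i w := if w is e :: w' then (src e == i) && walk (tgt e) w' else true.
Fixpoint endv i w := if w is e :: w' then endv (tgt e) w' else i.
Definition wr w : R := cycle_ratio w.
Fixpoint wmap w (x : 'rV[R]_d) := if w is e :: w' then smap e (wmap w' x) else x.

Lemma walk_cat i w u : walk i (w ++ u) = walk i w && walk (endv i w) u.
Proof. by elim: w i => [|e w IH] i //=; rewrite IH andbA. Qed.

Lemma endv_cat i w u : endv i (w ++ u) = endv (endv i w) u.
Proof. by elim: w i => [|e w IH] i //=. Qed.

Lemma walk_rcons i w e : walk i (rcons w e) = walk i w && (src e == endv i w).
Proof. by rewrite -cats1 walk_cat /= andbT. Qed.

Lemma endv_rcons i w e : endv i (rcons w e) = tgt e.
Proof. by rewrite -cats1 endv_cat. Qed.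

Lemma wr_nil : wr [::] = 1. Proof. exact: big_nil. Qed.
Lemma wr_cons e w : wr (e :: w) = ratio e * wr w. Proof. exact: big_cons. Qed.
Lemma wr_cat w u : wr (w ++ u) = wr w * wr u. Proof. exact: big_cat. Qed.
Lemma wr_rcons w e : wr (rcons w e) = wr w * ratio e.
Proof. by rewrite -cats1 wr_cat wr_cons wr_nil mulr1. Qed.

Lemma ratio_gt0 e : 0 < ratio e. Proof. by have /andP[] := ratio_itv e. Qed.
Lemma ratio_lt1 e : ratio e < 1. Proof. by have /andP[] := ratio_itv e. Qed.

Lemma wr_gt0 w : 0 < wr w.
Proof. by apply: prodr_gt0 => e _; exact: ratio_gt0. Qed.

Lemma wr_le1 w : wr w <= 1.
Proof.
elim: w => [|e w IH]; first by rewrite wr_nil.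
by rewrite wr_cons mulr_ile1// ltW ?ratio_gt0 ?ratio_lt1 ?wr_gt0.
Qed.

Lemma wmap_cat w u x : wmap (w ++ u) x = wmap w (wmap u x).
Proof. by elim: w => //= e w ->. Qed.

Lemma wmap_similarity w : similarity (wr w) (wmap w).
Proof.
elim: w => [|e w IH] x y /=; first by rewrite wr_nil mul1r.
by rewrite smap_similarity IH wr_cons mulrA.
Qed.

Lemma ratio_bounds : exists rmin rmax : R, [/\ 0 < rmin, rmax < 1, 0 < rmax &
  forall e, rmin <= ratio e <= rmax].
Proof.
have [m m0 mP] := fin_pos_lower (fun e : E => ratio_gt0 e).
have [|m' m'0 m'P] := @fin_pos_lower R E (fun e => 1 - ratio e).
  by move=> e; rewrite subr_gt0 ratio_lt1.
exists m, (1 - Num.min m' (1/2)); split => //.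
- by rewrite gtrBl lt_min m'0/= divr_gt0.
- rewrite subr_gt0 gt_min; apply/orP; right; lra.
- by move=> e; rewrite mP/= lerBrDr -lerBrDl ge_min m'P.
Qed.

Lemma strongly_connected_walk : strongly_connected Phi ->
  forall i j, exists w, walk i w /\ endv i w = j.
Proof.
move=> [_ conn] i j; have /connectP[p pp ->] := conn i j.
elim: p i pp => [|k p IH] i /=; first by exists [::].
move=> /andP[/existsP[e /andP[/eqP ei /eqP ek]] pp].
have [w [ww wl]] := IH _ pp.
by exists (e :: w); rewrite /= ei eqxx ek.
Qed.

Variable K : V -> set 'rV[R]_d.
Hypothesis attr : attractors K.

Definition cyl i w : set 'rV[R]_d := wmap w @` K (endv i w).

Lemma K_neq0 i : K i !=set0. Proof. by have [] := attr i. Qed.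
Lemma K_compact i : compact (K i). Proof. by have [] := attr i. Qed.

Lemma cyl_nil i : cyl i [::] = K i. Proof. by rewrite /cyl /= image_id. Qed.

Lemma cyl_cat i w u : cyl i (w ++ u) = wmap w @` cyl (endv i w) u.
Proof.
rewrite /cyl endv_cat image_comp; congr (_ @` _).
by apply/funext => x; rewrite wmap_cat.
Qed.

Lemma cyl_neq0 i w : cyl i w !=set0.
Proof. by have [x] := K_neq0 (endv i w); exists (wmap w x), x. Qed.

Lemma wmap_continuous w : continuous (wmap w).
Proof. exact: similarity_continuous (wr_gt0 w) (@wmap_similarity w). Qed.

Lemma cyl_compact i w : compact (cyl i w).
Proof.
apply: continuous_compact; last exact: K_compact.
by apply: continuous_subspaceT; exact: wmap_continuous.
Qed.

Lemma K_unfold i x : K i x <-> exists2 e, src e = i & cyl i [:: e] x.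
Proof.
have [_ _ Ki] := attr i; rewrite {1}Ki; split.
  by move=> [e ei [y Ky <-]]; exists e => //; exists y.
by move=> [e ei [y Ky <-]]; exists e => //; exists y.
Qed.

Lemma cyl_sub i w u : walk (endv i w) u -> cyl i (w ++ u) `<=` cyl i w.
Proof.
move=> wu; rewrite cyl_cat; apply: image_subset => x.
elim: u (endv i w) wu x => [|e u IH] j /=; first by rewrite cyl_nil.
move=> /andP[/eqP ej wu] x; rewrite -cat1s cyl_cat => -[y /(IH _ wu) Ky <-].
by apply/K_unfold; exists e => //; exists y.
Qed.

Lemma cyl_subK i w : walk i w -> cyl i w `<=` K i.
Proof. by move=> ww; rewrite -(cyl_nil i) -[w]cat0s; exact: cyl_sub. Qed.

Lemma cyl_rcons_sub i w e : src e = endv i w -> cyl i (rcons w e) `<=` cyl i w.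
Proof. by move=> ew; rewrite -cats1; apply: cyl_sub; rewrite /= ew eqxx. Qed.

Lemma cyl_child i w x : cyl i w x ->
  exists2 e, src e = endv i w & cyl i (rcons w e) x.
Proof.
move=> [y /K_unfold[e ew ye] <-]; exists e => //.
by rewrite -cats1 cyl_cat; exists y.
Qed.

Lemma cyl_ext i w x n : cyl i w x ->
  exists u, [/\ walk (endv i w) u, size u = n & cyl i (w ++ u) x].
Proof.
elim: n => [|n IH] wx; first by exists [::]; rewrite cats0.
have [u [wu su ux]] := IH wx; have [e eE ex] := cyl_child ux.
exists (rcons u e); rewrite walk_rcons wu eE endv_cat eqxx size_rcons su.
by rewrite -rcons_cat.
Qed.

(** Together with [sep_bound] this compares the distance of two points with the
    ratio of the longest word whose cylinder contains both. *)
Lemma diam_bound : exists2 D, 0 < D & forall i w x y, cyl i w x -> cyl i w y ->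
  edist x y <= D * wr w.
Proof.
have /choice[m mP] : forall i, exists m, forall x y, K i x -> K i y -> edist x y <= m.
  move=> i; have [x Kx] := K_neq0 i.
  have [||c _ cP] := @compact_EVT_max _ R (fun p : 'rV[R]_d * 'rV[R]_d => edist p.1 p.2)
      (K i `*` K i) _ (compact_setX (@K_compact i) (@K_compact i)).
  - by exists (x, x).
  - by apply: continuous_subspaceT; exact: edist_continuous.
  - by exists (edist c.1 c.2) => y z Ky Kz; apply: (cP (y, z)); rewrite inE.
have [M M0 mM] := fin_pos_upper m.
exists M => // i w _ _ [x Kx <-] [y Ky <-].
by rewrite wmap_similarity mulrC ler_pM2r ?wr_gt0//; exact: le_trans (mP _ _ _ Kx Ky) _.
Qed.

Hypothesis dust : dust_like Phi.

(** The first-level pieces are finitely many disjoint compact sets. *)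
Lemma gap_bound : exists2 g, 0 < g & forall i e e' x y, src e = i -> src e' = i ->
  e <> e' -> cyl i [:: e] x -> cyl i [:: e'] y -> g <= edist x y.
Proof.
have /choice[m mP] : forall p : E * E, exists m, 0 < m /\ (src p.1 = src p.2 -> p.1 <> p.2 ->
    forall x y, cyl (src p.1) [:: p.1] x -> cyl (src p.1) [:: p.2] y -> m <= edist x y).
  move=> [e e'] /=; have [se|se] := pselect (src e = src e'); last by exists 1.
  have [ee'|ee'] := pselect (e = e'); first by exists 1.
  have [x0 Kx0] := cyl_neq0 (src e) [:: e]; have [y0 Ky0] := cyl_neq0 (src e) [:: e'].
  have [||c + cP] := @compact_EVT_min _ R (fun p : 'rV[R]_d * 'rV[R]_d => edist p.1 p.2)
    (cyl (src e) [:: e] `*` cyl (src e) [:: e']) _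
    (compact_setX (@cyl_compact (src e) [:: e]) (@cyl_compact (src e) [:: e'])).
  - by exists (x0, y0).
  - by apply: continuous_subspaceT; exact: edist_continuous.
  - rewrite inE => -[/= c1 c2]; exists (edist c.1 c.2); split.
      rewrite lt_def edist_ge0 andbT; apply/negP => /eqP /edist_eq0 c12.
      have /trivIsetP tr := @dust K attr (src e).
      have /seteqP[tr0 _] : smap e @` K (tgt e) `&` smap e' @` K (tgt e') = set0.
        by apply: tr => //=; exact/eqP.
      by apply: (tr0 c.1); split; [exact: c1|rewrite c12; exact: c2].
    by move=> _ _ x y ex ey; apply: (cP (x, y)); rewrite inE.
have [g g0 gP] := fin_pos_lower (fun p => (mP p).1).
exists g => // i e e' x y ei e'i ee' ex ey.
apply: le_trans (gP (e, e')) _.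
by apply: (mP (e, e')).2 => //=; rewrite ?ei ?e'i.
Qed.

Lemma wmap_inj w : injective (wmap w).
Proof.
move=> x y e; apply: edist_eq0; apply/eqP.
have : wr w * edist x y == 0 by rewrite -wmap_similarity e edistxx.
by rewrite mulf_eq0 gt_eqF ?wr_gt0.
Qed.

Lemma cyl_cat_mem i w u x : cyl i (w ++ u) (wmap w x) <-> cyl (endv i w) u x.
Proof.
rewrite cyl_cat; split; last by exists x.
by move=> [y uy /wmap_inj <-].
Qed.

(** The gap between first-level pieces is scaled by the similarity of the common
    prefix, whose ratio is at least that of [w]. *)
Lemma sep_bound : exists2 g, 0 < g & forall i w x y, walk i w -> cyl i w x ->
  K i y -> ~ cyl i w y -> g * wr w <= edist x y.
Proof.
have [g g0 gP] := gap_bound; exists g => // i w.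
elim: w i => [|e w IH] i x y /=; first by rewrite cyl_nil.
move=> /andP[/eqP ei ww] ex Ky ey.
have /K_unfold[e' e'i ye'] := Ky.
move: ex; rewrite -cat1s => ex.
have ex1 : cyl i [:: e] x by apply: cyl_sub ex; rewrite /= ww.
have [ee'|ee'] := pselect (e = e'); last first.
  apply: le_trans (gP i e e' x y ei e'i ee' ex1 ye').
  by rewrite ger_pMr// wr_le1.
move: ye' ex ey; rewrite -ee' cyl_cat => -[y' Ky' <-] [x' wx' <-] ny.
rewrite wmap_similarity !wr_cons wr_nil mulr1 mulrCA ler_pM2l ?ratio_gt0//.
apply: (IH (tgt e)) => // wy'; apply: ny; exact/cyl_cat_mem.
Qed.

Lemma cyl_comparable i w u x : walk i w -> walk i u -> cyl i w x -> cyl i u x ->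
  (size w <= size u)%N -> exists2 u', u = w ++ u' & walk (endv i w) u'.
Proof.
have [g g0 gP] := gap_bound.
elim: w i u x => [|e w IH] i u x /=; first by exists u.
move=> /andP[/eqP ei ww]; case: u => [|e' u] //= /andP[/eqP e'i wu].
rewrite -(cat1s e w) -(cat1s e' u) => ex e'x.
have [ee'|ee'] := pselect (e = e'); last first.
  have : g <= edist x x.
    apply: (gP i e e') => //; apply: cyl_sub; eauto => /=.
  by rewrite edistxx leNgt g0.
move: ex e'x; rewrite -ee' cyl_cat => -[y wy <-] /cyl_cat_mem uy.
rewrite ltnS => wu'; rewrite -ee' in wu.
have [u' -> wu''] := IH _ _ _ ww wu wy uy wu'.
by exists u'.
Qed.

End Words.

(** * Masses of finite unions of cylinders *)

Section Enumeration.
Variables (R : realType) (d : nat) (Phi : gdifs R d).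
Local Notation V := (vertex Phi).
Local Notation E := (edge Phi).
Implicit Types (i j : V) (e : E) (w u v : seq E).

Fixpoint words i n : seq (seq E) :=
  if n is n'.+1 then
    [seq rcons w e | w <- words i n', e <- [seq e <- enum E | src e == endv i w]]
  else [:: [::]].

Lemma mem_words i n w : (w \in words i n) = walk i w && (size w == n).
Proof.
elim: n w => [|n IH] w.
  by rewrite inE /=; case: w => //= e w; rewrite andbF.
apply/allpairsPdep/idP => [[u [e [+ + ->]]]|].
  rewrite IH mem_filter => /andP[uw su] /andP[/eqP se _].
  by rewrite walk_rcons uw se eqxx size_rcons eqSS su.
case/lastP: w => [|u e]; first by rewrite andbF.
rewrite walk_rcons size_rcons eqSS => /andP[/andP[uw se] su].
by exists u, e; rewrite IH uw su mem_filter se mem_enum.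
Qed.

Lemma big_words_rcons i n (P : pred (seq E)) (F : seq E -> R) :
  \sum_(w <- words i n.+1 | P w) F w =
  \sum_(w <- words i n) \sum_(e | (src e == endv i w) && P (rcons w e)) F (rcons w e).
Proof.
rewrite big_mkcond /= big_allpairs_dep /=; apply: eq_bigr => w _.
by rewrite big_filter -big_mkcondr big_enum_cond.
Qed.

Lemma big_words_cat i w N (F : seq E -> R) : walk i w ->
  (forall v, v \in words i (size w + N) -> ~~ prefix w v -> F v = 0) ->
  \sum_(v <- words i (size w + N)) F v = \sum_(u <- words (endv i w) N) F (w ++ u).
Proof.
move=> ww; elim: N F => [|N IH] F F0.
  rewrite addn0 in F0 *; rewrite /= big_seq1 cats0.
  have uw : forall i n, uniq (words i n).
    move=> j n; elim: n => [//|n un].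
    apply: allpairs_uniq_dep => //; first by move=> v _; rewrite filter_uniq ?enum_uniq.
    by move=> [v e] [v' e'] _ _ /= /rcons_inj[-> ->].
  rewrite (bigD1_seq w) ?uw ?mem_words ?ww ?eqxx//=.
  rewrite big_seq_cond big1 ?addr0// => v /andP[vw vw'].
  apply: F0 => //; apply: contra vw' => /prefixP[u uE].
  move: vw; rewrite mem_words uE size_cat => /andP[_].
  by rewrite -[X in _ == X]addn0 eqn_add2l size_eq0 => /eqP ->; rewrite cats0.
rewrite addnS !big_words_rcons IH.
  apply: eq_bigr => u _; rewrite endv_cat.
  by apply: eq_bigr => e _; rewrite rcons_cat.
move=> v vw npv; apply: big1 => e /andP[/eqP se _]; apply: F0.
  move: vw; rewrite !mem_words walk_rcons size_rcons addnS eqSS se eqxx andbT.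
  by move=> /andP[-> ->].
apply: contra npv => /prefixP[u]; case/lastP: u => [|u e'].
  rewrite cats0 => /(congr1 size); rewrite size_rcons => sE.
  by move: vw; rewrite mem_words => /andP[_ /eqP sv]; move: sE; rewrite sv => /eqP; rewrite -addnS -[eqbRHS]addn0 eqn_add2l.
by rewrite -rcons_cat => /rcons_inj[-> _]; exact: prefix_prefix.
Qed.

End Enumeration.

Section Mass.
Variables (R : realType) (d : nat) (Phi : gdifs R d).
Local Notation V := (vertex Phi).
Local Notation E := (edge Phi).
Implicit Types (i j : V) (e : E) (w u v : seq E).
Variable K : V -> set 'rV[R]_d.
Hypothesis attr : attractors K.
Hypothesis dust : dust_like Phi.
Variables (s lam : R) (h : V -> R).
Hypothesis h_gt0 : forall i, 0 < h i.
Hypothesis lam_gt0 : 0 < lam.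
Hypothesis eig : forall i, trans (@src _ _ Phi) (@tgt _ _ Phi)
  (fun e => ratio e `^ s) h i = lam * h i.

Local Notation cyl := (cyl K).

Definition mu i w : R := lam ^- size w * wr w `^ s * h (endv i w).

Lemma mu_gt0 i w : 0 < mu i w.
Proof. by rewrite /mu !mulr_gt0 ?powR_gt0 ?wr_gt0// invr_gt0 exprn_gt0. Qed.

Lemma mu_rcons i w : \sum_(e | src e == endv i w) mu i (rcons w e) = mu i w.
Proof.
rewrite [RHS]/mu -[h _](mulKf (lt0r_neq0 lam_gt0)) -eig /trans !mulr_sumr.
apply: eq_bigr => e _; rewrite /mu size_rcons endv_rcons wr_rcons.
rewrite powRM ?ltW ?wr_gt0 ?ratio_gt0// exprSr invfM; ring.
Qed.

Definition meets i w (A : set 'rV[R]_d) := `[< exists2 x, A x & cyl i w x >].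

Definition mass i n A : R := \sum_(w <- words i n | meets i w A) mu i w.

(** From such a level on the level masses of [A] are constant, see [massS]. *)
Definition sat_level i n (A : set 'rV[R]_d) := forall w, walk i w -> size w = n ->
  meets i w A -> cyl i w `<=` A.

(** Only finite unions of cylinders are measured. Their level masses are eventually
    constant, so finite sums take the place of a measure. *)
Definition has_mass i A m := exists n0, forall n, (n0 <= n)%N -> mass i n A = m.

Lemma has_mass_unique i A m m' : has_mass i A m -> has_mass i A m' -> m = m'.
Proof.
move=> [n nP] [n' n'P]; rewrite -(nP (maxn n n')) ?leq_maxl//.
by rewrite n'P// leq_maxr.
Qed.

Lemma mass_mono i n A B : A `<=` B -> mass i n A <= mass i n B.
Proof.
move=> AB; rewrite /mass [leLHS]big_mkcond [leRHS]big_mkcond /=.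
apply: ler_sum => w _; case: ifP => [/asboolP[x Ax wx]|_].
  by rewrite ifT//; apply/asboolP; exists x => //; exact: AB.
by case: ifP => // _; rewrite ltW// mu_gt0.
Qed.

Lemma has_mass_mono i A B m m' : has_mass i A m -> has_mass i B m' ->
  A `<=` B -> m <= m'.
Proof.
move=> [n nP] [n' n'P] AB; rewrite -(nP (maxn n n')) ?leq_maxl//.
by rewrite -(n'P (maxn n n')) ?leq_maxr//; exact: mass_mono.
Qed.

Lemma sat_levelS i n A : sat_level i n A -> sat_level i n.+1 A.
Proof.
move=> sA w; case/lastP: w => [//|w e].
rewrite walk_rcons size_rcons => /andP[ww /eqP se] [sw] /asboolP[x Ax wx].
apply: subset_trans (cyl_rcons_sub attr se) _; apply: sA => //.
by apply/asboolP; exists x => //; exact: (cyl_rcons_sub attr se).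
Qed.

Lemma massS i n A : sat_level i n A -> mass i n.+1 A = mass i n A.
Proof.
move=> sA; rewrite /mass big_words_rcons [RHS]big_mkcond /=.
rewrite [LHS]big_seq [RHS]big_seq; apply: eq_bigr => w; rewrite mem_words => /andP[ww /eqP sw].
case: ifPn => [wA|nwA].
  rewrite -mu_rcons; apply: eq_bigl => e; case: eqP => //= se.
  have [x ex] := cyl_neq0 attr i (rcons w e).
  apply/asboolP; exists x => //; apply: (sA w ww sw wA).
  exact: (cyl_rcons_sub attr se).
apply: big1 => e /andP[/eqP se /asboolP[x Ax ex]].
exfalso; move/asboolP: nwA; apply; exists x => //.
exact: (cyl_rcons_sub attr se).
Qed.

Lemma sat_level_le i n m A : sat_level i n A -> (n <= m)%N -> sat_level i m A.
Proof. by move=> sA /subnK <-; elim: (m - n)%N => // k; exact: sat_levelS. Qed.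

Lemma has_mass_sat i n A : sat_level i n A -> has_mass i A (mass i n A).
Proof.
move=> sA; exists n => m /subnK <-; elim: (m - n)%N => // k IH.
by rewrite addSn massS//; apply: sat_level_le sA _; rewrite leq_addl.
Qed.

(** Computes the mass inside a cylinder from words relative to it: up to the factor
    [mu] of the cylinder, only finitely many values can occur for fixed [N]. *)
Lemma sub_cyl_mass i w N A : walk i w -> A `<=` cyl i w ->
  sat_level i (size w + N) A ->
  has_mass i A (\sum_(u <- words (endv i w) N | meets i (w ++ u) A) mu i (w ++ u)).
Proof.
move=> ww Aw sA; rewrite [X in has_mass i A X](_ : _ = mass i (size w + N) A).
  exact: has_mass_sat.
rewrite /mass [RHS]big_mkcond big_words_cat//=; first by rewrite -big_mkcond.
move=> v; rewrite mem_words => /andP[wv /eqP sv] npv; rewrite ifF//.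
apply/negP => /asboolP[x /Aw wx vx].
have sz : (size w <= size v)%N by rewrite sv leq_addr.
have [u uE _] := cyl_comparable attr dust ww wv wx vx sz.
by move: npv; rewrite uE prefix_prefix.
Qed.

Lemma sat_level_cyl i w : walk i w -> sat_level i (size w) (cyl i w).
Proof.
move=> ww v wv sv /asboolP[x wx vx].
have sz : (size v <= size w)%N by rewrite sv.
have [u uE _] := cyl_comparable attr dust wv ww vx wx sz.
suff u0 : u = [::] by rewrite uE u0 cats0.
by apply/nilP; move/(congr1 size)/eqP: uE; rewrite size_cat sv -[eqbLHS]addn0 eqn_add2l eq_sym.
Qed.

Lemma has_mass_cyl i w : walk i w -> has_mass i (cyl i w) (mu i w).
Proof.
move=> ww; have := @sub_cyl_mass i w 0 (cyl i w) ww (@subset_refl _ _).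
rewrite addn0 /= big_mkcond big_seq1 cats0 ifT; first by apply; exact: sat_level_cyl.
by have [x wx] := cyl_neq0 attr i w; apply/asboolP; exists x.
Qed.

Lemma mu_nil i : mu i [::] = h i.
Proof. by rewrite /mu/= expr0 invr1 wr_nil powR1 !mul1r. Qed.

Lemma sum_words_mu i n : \sum_(w <- words i n) mu i w = h i.
Proof.
elim: n => [|n IH]; first by rewrite big_seq1 mu_nil.
rewrite big_words_rcons -[RHS]IH; apply: eq_bigr => w _.
by rewrite -mu_rcons; apply: eq_bigl => e; rewrite andbT.
Qed.

Lemma mass_partition (I : finType) (P : pred I) i n (A : set 'rV[R]_d)
    (B : I -> set 'rV[R]_d) :
  (forall x, A x <-> exists2 k, P k & B k x) ->
  (forall k l x, P k -> P l -> B k x -> B l x -> k = l) ->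
  (forall k, P k -> sat_level i n (B k)) ->
  mass i n A = \sum_(k | P k) mass i n (B k).
Proof.
move=> AB disj sB; rewrite /mass.
under [RHS]eq_bigr do rewrite big_mkcond.
rewrite exchange_big /= [LHS]big_mkcond /=.
rewrite [LHS]big_seq [RHS]big_seq; apply: eq_bigr => w; rewrite mem_words => /andP[ww /eqP sw].
case: ifPn => [/asboolP[x /AB[k Pk Bx] wx]|nwA].
  have Bw : meets i w (B k) by apply/asboolP; exists x.
  rewrite (bigD1 k)//= Bw big1 ?addr0// => l /andP[Pl lk].
  rewrite ifF//; apply/negP => /asboolP[y By wy].
  have /(_ y wy) Bky := sB k Pk w ww sw Bw.
  by move: lk; rewrite (disj l k y Pl Pk By Bky) eqxx.
rewrite big1// => k Pk; rewrite ifF//; apply/negP => /asboolP[x Bx wx].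
by move/asboolP: nwA; apply; exists x => //; apply/AB; exists k.
Qed.

(** Every word of a sufficiently deep level lies below one of the words of the
    cover. *)
Lemma cover_mass i (ws : seq (seq E)) : all (walk i) ws ->
  (forall x, K i x -> exists2 w, w \in ws & cyl i w x) ->
  h i <= \sum_(w <- ws) mu i w.
Proof.
move=> wws cov.
have mE w : w \in ws -> exists n0, forall n, (n0 <= n)%N -> mass i n (cyl i w) = mu i w.
  by move=> wws'; apply: has_mass_cyl; exact: (allP wws).
have [N NP] : exists N, forall w, w \in ws -> mass i N (cyl i w) = mu i w.
  have : exists N, forall n w, (N <= n)%N -> w \in ws -> mass i n (cyl i w) = mu i w.
    elim: (ws) mE => [|w l IH] mE; first by exists 0%N.
    have [|N NP] := IH; first by move=> v vl; apply: mE; rewrite inE vl orbT.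
    have [N' N'P] := mE w (mem_head _ _).
    exists (maxn N N') => n v; rewrite geq_max => /andP[h1 h2].
    by rewrite inE => /orP[/eqP ->|]; [exact: N'P|exact: NP].
  by move=> [N NP]; exists N => w; exact: NP.
rewrite -(sum_words_mu i N) [leRHS]big_seq (eq_bigr _ (fun w ww => esym (NP w ww))) -big_seq.
rewrite /mass; under [leRHS]eq_bigr do rewrite big_mkcond.
rewrite exchange_big /= big_seq [leRHS]big_seq; apply: ler_sum => v.
rewrite mem_words => /andP[wv _]; have [x vx] := cyl_neq0 attr i v.
have [w wws' wx] := cov x (cyl_subK attr wv vx).
rewrite (big_rem w)//= ifT; last by apply/asboolP; exists x.
rewrite lerDl; apply: sumr_ge0 => u _; case: ifP => // _.
by rewrite ltW// mu_gt0.
Qed.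

End Mass.

(** * The dimension determines the Perron-Frobenius eigenvalue *)

Lemma powR_expE (R : realType) (x a : R) : 0 < x -> x `^ a = expR (a * ln x).
Proof. by move=> x0; rewrite /powR gt_eqF. Qed.

Lemma powR_anti (R : realType) (x a b : R) : 0 < x -> x <= 1 -> a <= b ->
  x `^ b <= x `^ a.
Proof. by move=> x0 x1 ab; rewrite !powR_expE// ler_expR ler_wnM2r// ln_le0. Qed.

Lemma powR_mono (R : realType) (x y a : R) : 0 <= a -> 0 <= x -> x <= y ->
  x `^ a <= y `^ a.
Proof.
by move=> a0 x0 xy; apply: ge0_ler_powR; rewrite // nnegrE (le_trans x0).
Qed.

Lemma expr_small (R : realType) (z e : R) : 0 <= z -> z < 1 -> 0 < e ->
  exists n0, forall n, (n0 <= n)%N -> z ^+ n <= e.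
Proof.
move=> z0 z1 e0; have := @cvg_expr R z; rewrite ger0_norm// => /(_ z1).
move=> /cvgrPdist_le /(_ e e0) [n0 _ nP]; exists n0 => n nn.
by have := nP n nn; rewrite /= sub0r normrN ger0_norm// exprn_ge0.
Qed.

Section Dimension.
Variables (R : realType) (d : nat) (Phi : gdifs R d).
Local Notation V := (vertex Phi).
Local Notation E := (edge Phi).
Implicit Types (i j : V) (e : E) (w u v : seq E).
Variable K : V -> set 'rV[R]_d.
Hypothesis attr : attractors K.
Hypothesis dust : dust_like Phi.
Variables (s lam : R) (h : V -> R).
Hypothesis h_gt0 : forall i, 0 < h i.
Hypothesis lam_gt0 : 0 < lam.
Hypothesis eig : forall i, trans (@src _ _ Phi) (@tgt _ _ Phi)
  (fun e => ratio e `^ s) h i = lam * h i.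

Local Notation cyl := (cyl K).
Local Notation mu := (mu s lam h).

Lemma wr_le_exp (rmax : R) w : (forall e, ratio e <= rmax) -> wr w <= rmax ^+ size w.
Proof.
move=> rP; elim: w => [|e w IH]; first by rewrite wr_nil.
by rewrite wr_cons /= exprS ler_pM// ltW// ?ratio_gt0 ?wr_gt0.
Qed.

Lemma wr_ge_exp (rmin : R) w : 0 < rmin -> (forall e, rmin <= ratio e) ->
  rmin ^+ size w <= wr w.
Proof.
move=> r0 rP; elim: w => [|e w IH]; first by rewrite wr_nil.
by rewrite wr_cons /= exprS ler_pM// ?exprn_ge0 ?(ltW r0).
Qed.

(** Covering by all cylinders of level [n] costs at most a constant times [q ^+ n],
    where [q = lam / rmin `^ (s - t) < 1]: the mass is spread over the words of
    length [n] and each factor [ratio e] lowered from exponent [s] to [t] costs at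
    most [1 / rmin `^ (s - t)]. *)
Lemma hausdorff_measure_eq0 i (t : R) (rmin : R) : 0 <= t -> t <= s -> 0 < rmin ->
  (forall e, rmin <= ratio e) -> lam < rmin `^ (s - t) ->
  hausdorff_measure t (K i) = 0%E.
Proof.
move=> t0 ts r0 rP lamr.
have [D D0 DP] := diam_bound attr.
have [rm' [rmax [_ rmax1 rmax0 rmaxP]]] := ratio_bounds Phi.
have [hm hm0 hmP] := fin_pos_lower h_gt0.
set q := lam / rmin `^ (s - t).
have q0 : 0 <= q by rewrite divr_ge0 ?powR_ge0 ?ltW.
have q1 : q < 1 by rewrite ltr_pdivrMr ?powR_gt0// mul1r.
have wrt w : wr w `^ t <= q ^+ size w * (hm^-1 * mu i w).
  have -> : t = s - (s - t) by ring.
  rewrite powRB; last by apply/implyP => _; rewrite gt_eqF ?wr_gt0.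
  have hh : 1 <= hm^-1 * h (endv i w) by rewrite mulrC ler_pdivlMr// mul1r.
  rewrite /mu /q expr_div_n.
  rewrite [leRHS](_ : _ = wr w `^ s * (rmin `^ (s - t) ^+ size w)^-1 *
      (hm^-1 * h (endv i w))).
    apply: le_trans (ler_peMr _ hh); last by rewrite mulr_ge0 ?powR_ge0 ?invr_ge0 ?exprn_ge0 ?powR_ge0.
    rewrite ler_wpM2l ?powR_ge0// lef_pV2 ?posrE ?exprn_gt0 ?powR_gt0 ?wr_gt0//.
    rewrite -powR_mulrn ?powR_ge0// -powRrM mulrC powRrM powR_mulrn ?(ltW r0)//.
    apply: powR_mono; rewrite ?subr_ge0 ?exprn_ge0 ?(ltW r0)//.
    exact: wr_ge_exp.
  by field; rewrite (gt_eqF hm0) !expf_neq0// gt_eqF// powR_gt0.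
apply/eqP; rewrite eq_le; apply/andP; split; last first.
  apply: (@le_trans _ _ (hausdorff_content t 1 (K i))); last first.
    by apply: ereal_sup_ubound; exists 1 => //=.
  apply: le_ereal_inf_tmp => _ [U _ <-].
  apply: nneseries_ge0 => k _ _; rewrite /diam_pow; case: ifP => // _.
  exact: poweR_ge0.
apply: ge_ereal_sup => _ [dl dl0 <-]; rewrite /= in dl0.
apply/lee_addgt0Pr => ep ep0; rewrite add0e.
have [n1 n1P] := expr_small (ltW rmax0) rmax1 (divr_gt0 dl0 D0).
pose C := D `^ t * (hm^-1 * h i).
have C0 : 0 < C by rewrite !mulr_gt0 ?invr_gt0 ?powR_gt0.
have [n2 n2P] := expr_small q0 q1 (divr_gt0 ep0 C0).
pose n := maxn n1 n2; pose ws := words i n.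
pose U k := if (k < size ws)%N then cyl i (nth [::] ws k) else set0.
have wsP k : (k < size ws)%N -> walk i (nth [::] ws k) /\ size (nth [::] ws k) = n.
  by move=> kn; have := mem_nth [::] kn; rewrite mem_words => /andP[-> /eqP ->].
have diamU w : (Defs.diam (cyl i w) <= (D * wr w)%:E)%E.
  apply: ge_ereal_sup => y [->|[p [p1 p2] <-]]; rewrite lee_fin.
    by rewrite mulr_ge0// ltW// wr_gt0.
  exact: DP p1 p2.
apply: (@le_trans _ _ (\sum_(0 <= k <oo) diam_pow t (U k))%E).
  apply: ereal_inf_lbound; exists U => //; split.
    move=> k; rewrite /U; case: ifPn => [kn|_].
      apply: le_trans (diamU _) _; rewrite lee_fin.
      rewrite mulrC -ler_pdivlMr//; apply: le_trans (n1P n (leq_maxl _ _)).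
      by rewrite -(wsP k kn).2; apply: wr_le_exp => e; have /andP[] := rmaxP e.
    by apply: ge_ereal_sup => y [->|[p [[]]]]; rewrite lee_fin ltW.
  move=> x Kx; have [u [wu su ux]] := @cyl_ext _ _ _ _ attr i [::] x n ltac:(by rewrite cyl_nil).
  have uw : u \in ws by rewrite mem_words su eqxx andbT.
  by exists (index u ws) => //; rewrite /U index_mem uw nth_index.
rewrite (@nneseries_split _ _ 0 (size ws)) ?add0n; last first.
  move=> k _; rewrite /diam_pow; case: ifP => // _; exact: poweR_ge0.
rewrite [X in (_ + X)%E]eseries0 ?adde0; last first.
  by move=> k kn _; rewrite /U ltnNge kn /= /diam_pow eqxx.
apply: (@le_trans _ _ (\sum_(0 <= k < size ws) (D `^ t * (q ^+ n * (hm^-1 * mu i (nth [::] ws k))))%:E)%E).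
  rewrite !big_nat; apply: lee_sum => k /andP[_ kn]; rewrite /U kn /diam_pow.
  have [x wx] := cyl_neq0 attr i (nth [::] ws k).
  rewrite ifF; last by apply/negP => /eqP c0; rewrite c0 in wx.
  apply: (@le_trans _ _ ((D * wr (nth [::] ws k))%:E `^ t)%E).
    apply: gt0_ler_poweR => //; rewrite ?in_itv/= ?andbT ?leey ?andbT.
    - by apply: ereal_sup_ubound; left.
    - by rewrite lee_fin mulr_ge0// ltW// wr_gt0.
  rewrite poweR_EFin lee_fin powRM ?(ltW D0) ?(ltW (wr_gt0 _))//.
  by rewrite ler_wpM2l ?powR_ge0// -{1}(wsP k kn).2.
rewrite sumEFin lee_fin -!mulr_sumr.
rewrite [\sum_(_ <= _ < _) _](_ : _ = h i); last first.
  by rewrite -(sum_words_mu lam_gt0 eig i n) [RHS](big_nth [::]).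
have := n2P n (leq_maxr _ _); rewrite ler_pdivlMr//; apply: le_trans.
by rewrite /C [leRHS]mulrCA.
Qed.

(** The parts of [K i] left uncovered by the first [n] cylinders are nested and
    compact, because by [sep_bound] cylinders are relatively open. *)
Lemma finite_subcover i (W : nat -> seq E) : (forall k, walk i (W k)) ->
  (forall x, K i x -> exists k, cyl i (W k) x) ->
  exists N, forall x, K i x -> exists2 k, (k < N)%N & cyl i (W k) x.
Proof.
move=> wW cov; have [g g0 gP] := sep_bound attr dust.
apply: contrapT => /forallNP nN.
pose C n := K i `&` \bigcap_(k in [set k | (k < n)%N]) \bigcap_(x in cyl i (W k))
   [set y | g * wr (W k) <= edist x y].
have memC n y : C n y <-> K i y /\ forall k, (k < n)%N -> ~ cyl i (W k) y.
  split => [[Ky Cy]|[Ky Cy]]; split => // k kn.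
    move=> /(Cy k kn y); rewrite /= edistxx leNgt mulr_gt0//; exact: wr_gt0.
  by move=> x wx /=; apply: (gP i) => //; exact: Cy.
have [|||x xC] := @nested_compact _ C (@norm_hausdorff _ _).
- move=> n; apply: compact_closedI; first exact: K_compact.
  apply: closed_bigI => k _; apply: closed_bigI => x _.
  apply: (@closed_comp _ _ (fun y => edist x y) [set r | g * wr (W k) <= r]); last exact: closed_ge.
  move=> y _; apply: (continuous_comp (cvg_pair (cvg_cst x) cvg_id) (@edist_continuous R d (x, y))).
- move=> n; have /existsNP[x /not_implyP[Kx nx]] := nN n.
  exists x; apply/memC; split => // k kn wx; apply: nx; by exists k.
- move=> n x /memC[Kx nx]; apply/memC; split => // k kn; apply: nx.
  exact: leq_trans kn _.
have [Kx _] := (memC 0%N x).1 (xC 0%N).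
have [k kx] := cov x Kx.
have [_] := (memC k.+1 x).1 (xC k.+1).
by move=> /(_ k (leqnn _)); apply.
Qed.

Lemma sum_half_le (e : R) N : 0 <= e -> \sum_(0 <= k < N) e / 2 ^+ k.+1 <= e.
Proof.
move=> e0; rewrite (_ : \sum_(_ <= _ < _) _ = e - e / 2 ^+ N).
  by rewrite gerBl divr_ge0// exprn_ge0.
elim: N => [|N IH]; first by rewrite big_geq// expr0 divr1 subrr.
rewrite big_nat_recr//= IH exprS.
have : 2 ^+ N != 0 :> R by rewrite expf_neq0.
by move=> ?; field.
Qed.

(** Mass distribution principle: a covering set meeting [K i] lies in a cylinder whose
    mass is at most a constant times its [t']-th power of diameter, up to an error
    that absorbs the sets too small to leave a deep cylinder. By [finite_subcover]
    finitely many of these cylinders cover [K i], so their mass is at least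
    [h i]. *)
Lemma hausdorff_measure_neq0 i (t' t : R) (rmin : R) : 0 <= t' -> t' <= t -> s <= t -> 0 < s ->
  0 < rmin -> (forall e, rmin <= ratio e) -> lam^-1 <= rmin `^ (t - s) ->
  hausdorff_measure t' (K i) != 0%E.
Proof.
move=> t'0 t't st s0 r0 rP lamr.
have [D D0 DP] := diam_bound attr.
have [g g0 gP] := sep_bound attr dust.
have [rm' [rmax [_ rmax1 rmax0 rmaxP]]] := ratio_bounds Phi.
have [hm hm0 hmP] := fin_pos_upper h.
have t0 : 0 < t by exact: lt_le_trans st.
have mut w : mu i w <= hm * wr w `^ t.
  rewrite /mu mulrC ler_pM ?mulr_ge0 ?powR_ge0 ?(ltW (h_gt0 _)) ?invr_ge0 ?exprn_ge0 ?(ltW lam_gt0)//.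
  have -> : t = (t - s) + s by ring.
  rewrite powRD; last by apply/implyP => _; rewrite gt_eqF ?wr_gt0.
  rewrite ler_wpM2r ?powR_ge0// -exprVn.
  apply: (@le_trans _ _ ((rmin `^ (t - s)) ^+ size w)).
    by rewrite lerXn2r ?nnegrE ?powR_ge0 ?invr_ge0 ?(ltW lam_gt0).
  rewrite -powR_mulrn ?powR_ge0// -powRrM mulrC powRrM powR_mulrn ?(ltW r0)//.
  apply: powR_mono; rewrite ?subr_ge0 ?exprn_ge0 ?(ltW r0)//.
  exact: wr_ge_exp.
pose C1 := hm * (rmin * g) `^ (- t').
have C10 : 0 < C1 by rewrite mulr_gt0 ?powR_gt0 ?mulr_gt0.
have muC w : mu i w <= hm * wr w `^ t'.
  by apply: le_trans (mut w) _; rewrite ler_wpM2l ?(ltW hm0)// powR_anti ?wr_gt0 ?wr_le1.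
have small x (eta : R) : 0 < eta -> K i x -> exists n, forall w, walk i w -> size w = n ->
    mu i w <= eta.
  move=> eta0 Kx; have z1 : rmax `^ t < 1.
    rewrite powR_expE// -expR0 ltr_expR pmulr_rlt0// ln_lt0// rmax0 rmax1//.
  have [n nP] := expr_small (powR_ge0 _ _) z1 (divr_gt0 eta0 hm0).
  exists n => w ww sw; apply: le_trans (mut w) _.
  rewrite mulrC -ler_pdivlMr//; apply: le_trans (nP n (leqnn _)).
  rewrite -sw -powR_mulrn ?powR_ge0// -powRrM mulrC powRrM powR_mulrn ?(ltW rmax0)//.
  apply: powR_mono; rewrite ?(ltW t0) ?(ltW (wr_gt0 _))//.
  by apply: wr_le_exp => e; have /andP[] := rmaxP e.
have [x0 Kx0] := K_neq0 attr i.
have approx (U : set 'rV[R]_d) (eta : R) : (Defs.diam U <= 1%:E)%E -> 0 < eta ->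
   exists w, [/\ walk i w, (forall x, U x -> K i x -> cyl i w x) &
     ((mu i w)%:E <= C1%:E * diam_pow t' U + eta%:E)%E].
  move=> dU eta0.
  have dp0 : (0 <= diam_pow t' U)%E.
    by rewrite /diam_pow; case: ifP => // _; exact: poweR_ge0.
  have [x [Kx Ux]] : exists x, K i x /\ ((exists y, U y /\ K i y) -> U x).
    case: (pselect (exists y, U y /\ K i y)) => [[y [Uy Ky]]|]; first by exists y.
    by exists x0.
  have [n nP] := small x eta eta0 Kx.
  have [u [wu su ux]] := @cyl_ext _ _ _ _ attr i [::] x n ltac:(by rewrite cyl_nil).
  rewrite /= in ux wu.
  (* Shrink the cylinder along [u] as long as it contains the points of [U];
     when this stops early, two of these points are separated by [sep_bound]. *)
  have key m : (m <= n)%N -> exists w, [/\ walk i w, (forall y, U y -> K i y -> cyl i w y) &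
     ((mu i w)%:E <= C1%:E * diam_pow t' U + eta%:E)%E \/ w = take m u].
    elim: m => [|m IH] mn.
      exists [::]; split => //; first by move=> y _; rewrite cyl_nil.
      by right; rewrite take0.
    have [w [ww wU [mw|wE]]] := IH (ltnW mn); first by exists w; split => //; left.
    have [/asboolP all_in|/asboolP nall] := boolP `[< forall y, U y -> K i y -> cyl i (take m.+1 u) y >].
      exists (take m.+1 u); split => //; last by right.
      by move: wu; rewrite -{1}(cat_take_drop m.+1 u) walk_cat => /andP[].
    exists w; split => //; left.
    have /existsNP[y /not_implyP[Uy /not_implyP[Ky ny]]] := nall.
    have Ux' : U x by apply: Ux; exists y.
    have wtk k : walk i (take k u).
      by move: wu; rewrite -{1}(cat_take_drop k u) walk_cat => /andP[].
    have gw : g * wr (take m.+1 u) <= edist x y.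
      apply: (gP i) => //; move: ux; rewrite -{1}(cat_take_drop m.+1 u).
      apply: cyl_sub => //; move: wu; rewrite -{1}(cat_take_drop m.+1 u) walk_cat.
      by move=> /andP[].
    have gw' : rmin * g * wr w <= edist x y.
      apply: le_trans gw; rewrite wE.
      have [e0 _] : exists e0 : E, True.
        by case: (u) su mn => [<- //|e0 ? _ _]; exists e0.
      rewrite (take_nth e0) ?su// wr_rcons -mulrA [leRHS]mulrA [leRHS]mulrC.
      by rewrite ler_pM2r ?mulr_gt0 ?wr_gt0.
    have [dm dmE] : exists dm, Defs.diam U = dm%:E.
      have d0 : (0 <= Defs.diam U)%E by apply: ereal_sup_ubound; left.
      by case: (Defs.diam U) dU d0 => [r| |] //; exists r.
    have xydm : edist x y <= dm.
      by rewrite -lee_fin -dmE; apply: ereal_sup_ubound; right; exists (x, y).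
    rewrite /diam_pow ifF; last by apply/negP => /eqP U0; rewrite U0 in Uy.
    rewrite dmE poweR_EFin -EFinM -EFinD lee_fin.
    apply: (@le_trans _ _ (C1 * dm `^ t')); last by rewrite lerDl ltW.
    apply: le_trans (muC w) _; rewrite /C1 -mulrA ler_wpM2l ?(ltW hm0)//.
    rewrite powRN mulrC ler_pdivlMr ?powR_gt0 ?mulr_gt0//.
    rewrite -powRM ?(ltW (wr_gt0 _)) ?mulr_ge0 ?(ltW r0) ?(ltW g0)//.
    apply: powR_mono => //; first by rewrite !mulr_ge0 ?(ltW r0) ?(ltW g0) ?(ltW (wr_gt0 _)).
    by rewrite mulrC; exact: le_trans xydm.
  have [w [ww wU [mw|wE]]] := key n (leqnn n); first by exists w.
  exists w; split => //; apply: (@le_trans _ _ eta%:E).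
    by rewrite lee_fin; apply: nP => //; rewrite wE size_take su ltnn.
  by rewrite leeDr// mule_ge0// lee_fin ltW.
pose c := h i / 2 / C1.
have c0 : 0 < c by rewrite !divr_gt0.
apply/negP => /eqP H0.
have : (c%:E <= hausdorff_measure t' (K i))%E; last by rewrite H0 lee_fin leNgt c0.
apply: (@le_trans _ _ (hausdorff_content t' 1 (K i))); last first.
  by apply: ereal_sup_ubound; exists 1 => //=.
apply: le_ereal_inf_tmp => _ [U [dU cU] <-].
have /choice[W WP] : forall k, exists w, [/\ walk i w, (forall x, U k x -> K i x -> cyl i w x) &
     ((mu i w)%:E <= C1%:E * diam_pow t' (U k) + (h i / 2 / 2 ^+ k.+1)%:E)%E].
  by move=> k; apply: approx (dU k) _; rewrite !divr_gt0// exprn_gt0.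
have [||N NP] := @finite_subcover i W.
- by move=> k; have [] := WP k.
- by move=> x Kx; have [k _ Ux] := cU x Kx; exists k; have [_ + _] := WP k; apply.
have hmu : h i <= \sum_(0 <= k < N) mu i (W k).
  rewrite -(big_map W xpredT) ; apply: (cover_mass attr dust h_gt0 lam_gt0 eig).
    by apply/allP => _ /mapP[k _ ->]; have [] := WP k.
  move=> x Kx; have [k kN kx] := NP x Kx; exists (W k) => //.
  by apply: map_f; rewrite mem_index_iota.
have dp0 k : (0 <= diam_pow t' (U k))%E.
  by rewrite /diam_pow; case: ifP => // _; exact: poweR_ge0.
have : ((h i)%:E <= C1%:E * (\sum_(0 <= k <oo) diam_pow t' (U k)) + (h i / 2)%:E)%E.
  apply: (@le_trans _ _ (\sum_(0 <= k < N) (C1%:E * diam_pow t' (U k) + (h i / 2 / 2 ^+ k.+1)%:E))%E).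
    apply: (@le_trans _ _ (\sum_(0 <= k < N) (mu i (W k))%:E)%E).
      by rewrite sumEFin lee_fin.
    by apply: lee_sum => k _; have [_ _] := WP k.
  rewrite big_split /=; apply: leeD.
    rewrite -ge0_sume_distrr//; apply: lee_wpmul2l; first by rewrite lee_fin ltW.
    exact: nneseries_lim_ge.
  by rewrite sumEFin lee_fin sum_half_le// divr_ge0// ltW.
rewrite -leeBlDr// -EFinB (_ : h i - h i / 2 = h i / 2); last by field.
by move=> cS; rewrite /c EFinM muleC lee_pdivrMl.
Qed.

(** When [lam] differs from 1 there is room to move the exponent away from [s]: down
    when [lam < 1], with vanishing measure, and up when [lam > 1], with positive
    measure. *)
Lemma eigenvalue_eq1 i : 0 < s -> hausdorff_dim (K i) = s%:E -> lam = 1.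
Proof.
move=> s0 dimK.
have [rmin [rmax [r0 rmax1 rmax0 rP]]] := ratio_bounds Phi.
have rP1 e : rmin <= ratio e by have /andP[] := rP e.
have [e0 _] : exists e0 : E, True.
  have [x /(K_unfold attr)[e _ _]] := K_neq0 attr i; by exists e.
have rmin1 : rmin < 1 by apply: le_lt_trans (rP1 e0) (ratio_lt1 e0).
have lnr : ln rmin < 0 by rewrite ln_lt0// r0 rmin1.
case: (ltgtP lam 1) => // lam1; exfalso.
  have lnl : ln lam < 0 by rewrite ln_lt0// lam_gt0 lam1.
  pose dl := Num.min s (ln lam / (2 * ln rmin)).
  have dl0 : 0 < dl.
    by rewrite lt_min s0/= -mulrNN -invrN divr_gt0// oppr_gt0// pmulr_rlt0.
  have dls : dl <= s by rewrite ge_min lexx.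
  have H : hausdorff_measure (s - dl) (K i) = 0%E.
    apply: (@hausdorff_measure_eq0 i (s - dl) rmin) => //.
    - by rewrite subr_ge0.
    - by rewrite gerBl ltW.
    have -> : s - (s - dl) = dl by ring.
    rewrite powR_expE// -[ltLHS](lnK lam_gt0) ltr_expR.
    have : ln lam / (2 * ln rmin) * ln rmin <= dl * ln rmin.
      by rewrite ler_nM2r// ge_min lexx orbT.
    apply: lt_le_trans.
    rewrite (_ : _ * ln rmin = ln lam / 2); last by field; rewrite lt_eqF.
    by rewrite ltr_pdivlMr// mulr_natr mulr2n gtrDl.
  have : (hausdorff_dim (K i) <= (s - dl)%:E)%E.
    by apply: ereal_inf_lbound; exists (s - dl) => //; split => //=; rewrite subr_ge0.
  by rewrite dimK lee_fin lerBrDr gerDl leNgt dl0.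
pose t := s - ln lam / ln rmin.
have lnl : 0 < ln lam by rewrite ln_gt0.
have st : s < t by rewrite ltrDl oppr_gt0 pmulr_rlt0// invr_lt0.
have : (t%:E <= hausdorff_dim (K i))%E.
  apply: le_ereal_inf_tmp => _ [t' [t'0 H] <-]; rewrite lee_fin leNgt; apply/negP => t't.
  move/eqP: H; apply/negP; apply: (@hausdorff_measure_neq0 i t' t rmin) => //; try exact: ltW.
  rewrite powR_expE// (_ : (t - s) * ln rmin = - ln lam).
    by rewrite expRN lnK.
  by rewrite /t; field; rewrite lt_eqF.
by rewrite dimK lee_fin leNgt st.
Qed.

End Dimension.

(** * Commensurable cycle ratios and potentials *)

Section Cycles.
Variables (R : realType) (d : nat) (Phi : gdifs R d).
Local Notation V := (vertex Phi).
Local Notation E := (edge Phi).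
Implicit Types (i j : V) (e : E) (w u v c : seq E).

Lemma endv_last i e w : endv i (e :: w) = tgt (last e w).
Proof. by elim: w i e => [|f w IH] i e //=; rewrite -(IH (tgt e) f). Qed.

Lemma walk_path e w : walk (tgt e) w = path (fun e e' => tgt e == src e') e w.
Proof. by elim: w e => [|f w IH] e //=; rewrite IH eq_sym. Qed.

Lemma is_cycleP c : is_cycle c <->
  exists i, [/\ c != [::], walk i c, endv i c = i & uniq [seq src e | e <- c]].
Proof.
case: c => [|e w]; first by split => [/and3P[]|[? []]].
rewrite /is_cycle; split => [/and3P[_ cc uc]|[i [_ ww we uw]]].
  exists (src e); split => //; move: cc; rewrite /= rcons_path => /andP[pw /eqP lw].
    by rewrite eqxx walk_path.
  by rewrite -lw -(endv_last (src e)).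
move: ww => /= /andP[/eqP ei ww]; apply/andP; split; [|exact: uw].
rewrite /=.
by rewrite rcons_path -walk_path ww ei -(endv_last i) we eqxx.
Qed.

Lemma size_cycle c : is_cycle c -> (size c <= #|V|)%N.
Proof.
move=> /is_cycleP[i [_ _ _ uc]].
by rewrite -(size_map (@src _ _ Phi)) -(card_uniqP uc) max_card.
Qed.

(** A closed walk visiting a vertex twice splits there into two shorter ones, so the
    logarithms of the ratios of closed walks stay in the group generated by those
    of cycles. *)
Lemma closed_walk_log (a : R) :
  (forall c, is_cycle c -> exists m : int, ln (wr c) = m%:~R * a) ->
  forall i w, walk i w -> endv i w = i -> exists m : int, ln (wr w) = m%:~R * a.
Proof.
move=> Ha i w; have [n] := ubnP (size w); elim: n i w => // n IH i w.
rewrite ltnS => sw ww we.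
have [w0|w0] := eqVneq w [::]; first by exists 0; rewrite w0 wr_nil ln1 mul0r.
have [uw|] := boolP (uniq [seq src e | e <- w]).
  by apply: Ha; apply/is_cycleP; exists i.
case: w w0 sw ww we => // e0 w1; set w := e0 :: w1 => w0 sw ww we.
move=> /(uniqPn (src e0))[a1 [a2 [a12]]]; rewrite size_map => a2w.
rewrite !(nth_map e0) ?(ltn_trans a12)// => src12.
have a1w : (a1 < size w)%N := ltn_trans a12 a2w.
have wE : w = take a1 w ++ take (a2 - a1) (drop a1 w) ++ drop a2 w.
  by rewrite -{1}(cat_take_drop a1 w) -{1}(cat_take_drop (a2 - a1) (drop a1 w)) drop_drop subnK// ltnW.
have srcnth k : (k < size w)%N -> endv i (take k w) = src (nth e0 w k).
  move=> kw; move: ww; rewrite -{1}(cat_take_drop k w) (drop_nth e0 kw) walk_cat /=.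
  by move=> /andP[_ /andP[/eqP ->]].
set u := take a1 w in wE *; set v := take (a2 - a1) (drop a1 w) in wE *.
set t := drop a2 w in wE *.
have uE : endv i u = src (nth e0 w a1) by exact: srcnth.
have vE : endv (endv i u) v = endv i u.
  rewrite -endv_cat uE src12 -srcnth//; congr (endv i _).
  by rewrite /u /v -[in RHS](subnKC (ltnW a12)) takeD.
move: (ww) (we); rewrite wE !walk_cat !endv_cat vE => /and3P[uw vw tw] te.
have su : size u = a1 by rewrite size_take a1w.
have sv : size v = (a2 - a1)%N.
  by rewrite size_take size_drop ltn_sub2r.
have sE : size w = (size u + (size v + size t))%N by rewrite {1}wE !size_cat.
have [|m1 m1E] := IH (endv i u) v _ vw vE.
  apply: leq_trans sw; apply: leq_ltn_trans a2w; rewrite sv.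
  exact: leq_subr.
have [|||m2 m2E] := IH i (u ++ t).
- apply: leq_trans sw; rewrite sE size_cat ltn_add2l -[X in (X < _)%N]add0n ltn_add2r sv.
  by rewrite subn_gt0.
- by rewrite walk_cat uw.
- by rewrite endv_cat.
move: m2E; rewrite wr_cat lnM ?posrE ?wr_gt0// => m2E.
exists (m1 + m2); rewrite !wr_cat !lnM ?posrE ?mulr_gt0 ?wr_gt0// m1E rmorphD /= mulrDl -m2E.
ring.
Qed.

(** The potential [p] cancels along closed walks. Positive exponents let every edge be
    cut into [k e] steps of ratio [theta]. *)
Definition homogeneous (theta : R) (p : V -> R) (k : E -> nat) :=
  (forall i, 0 < p i) /\
  forall e, (0 < k e)%N /\ ratio e * p (tgt e) = theta ^+ k e * p (src e).

(** The ratio [P i] of a path from [i] to a base vertex is a potential up to powers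
    of the common base [theta], because two such paths completed by the same
    return path are closed walks. Rounding the potential to values between theta and 1
    makes the exponents positive as soon as [theta] exceeds all ratios. *)
Lemma homogeneous_form (rho : R) : strongly_connected Phi -> 0 < rho < 1 ->
  (forall r, cycle_ratios Phi r -> exists q : rat, ln r / ln rho = ratr q) ->
  exists2 D, (0 < D)%N & forall m, (0 < m)%N -> (D %| m)%N ->
    exists p k, homogeneous (expR (ln rho / m%:R)) p k.
Proof.
move=> sc /andP[rho0 rho1] comm.
have lr : ln rho < 0 by rewrite ln_lt0// rho0.
have /choice[q qP] : forall c : (#|V|).-bseq E, exists q : rat,
    is_cycle c -> ln (wr c) = ratr q * ln rho.
  move=> c; have [cc|ncc] := boolP (is_cycle c); last by exists 0.
  have [|q qE] := comm (wr c); first by exists c.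
  by exists q => _; rewrite -qE divfK// lt_eqF.
pose D1 := (\prod_c `|denq (q c)|)%N.
have [|l l0 lP] := @fin_pos_lower R E (fun e => - ln (ratio e)).
  by move=> e; rewrite oppr_gt0 ln_lt0// ratio_itv.
pose m0 := (Num.bound (- ln rho / l)).+1.
have D10 : (0 < D1)%N by apply: prodn_gt0 => c; rewrite absz_gt0 denq_neq0.
exists (D1 * m0)%N; first by rewrite muln_gt0 D10.
move=> M M0 DM; set a := ln rho / M%:R.
have MR : 0 < M%:R :> R by rewrite ltr0n.
have a0 : a < 0 by rewrite pmulr_llt0// invr_gt0.
have am e : ln (ratio e) < a.
  rewrite -(opprK (ln _)) ltrNl; apply: lt_le_trans (lP e).
  rewrite /a -mulNr ltr_pdivrMr// mulrC -ltr_pdivrMr//.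
  apply: lt_le_trans (_ : m0%:R <= _).
    apply: lt_trans (_ : (Num.bound (- ln rho / l))%:R < _); last by rewrite ltr_nat.
    by apply: archi_boundP; rewrite divr_ge0 ?(ltW l0)// oppr_ge0 ltW.
  by rewrite ler_nat dvdn_leq// (dvdn_trans _ DM)// dvdn_mull.
have cyc c : is_cycle c -> exists z : int, ln (wr c) = z%:~R * a.
  move=> cc; pose cb := Bseq (size_cycle cc).
  have /dvdnP[k kE] : (`|denq (q cb)| %| M)%N.
    by apply: dvdn_trans DM; rewrite /D1 (bigD1 cb)//= -mulnA dvdn_mulr.
  exists (numq (q cb) * k%:Z); rewrite (qP cb cc) /a.
  have dE : (denq (q cb))%:~R = (`|denq (q cb)|%N)%:R :> R by rewrite -[in LHS]absz_denq.
  rewrite /ratr dE rmorphM /= kE natrM.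
  have dn0 : (`|denq (q cb)|%N)%:R != 0 :> R by rewrite pnatr_eq0 absz_eq0 denq_neq0.
  have kn0 : k%:R != 0 :> R.
    by rewrite pnatr_eq0; apply: contraTneq M0 => k0; rewrite kE k0.
  by field; rewrite dn0 kn0.
have [i0 _] : exists i0 : V, True by have [[e _] _] := sc; exists (src e).
have /choice[t tP] := fun i => strongly_connected_walk sc i i0.
pose P i := ln (wr (t i)).
(* Logarithm of the rounded potential. *)
pose f i := P i - (Num.floor (P i / a))%:~R * a.
have f0 i : a < f i <= 0.
  have /andP[fl1 fl2] := Num.Theory.floor_itv (P i / a).
  have PE : P i = P i / a * a by rewrite divfK// lt_eqF.
  move: fl1 fl2 PE; rewrite /f rmorphD /=; set fl := (Num.floor _)%:~R; set y := P i / a.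
  move=> fl1 fl2 ->; rewrite -mulrBl; apply/andP; split.
    by rewrite -[ltLHS]mul1r ltr_nM2r// ltrBlDl.
  by rewrite nmulr_lle0// subr_ge0.
have edgeE e : exists z : int, ln (ratio e) + f (tgt e) - f (src e) = z%:~R * a.
  have [z [zw ze]] := strongly_connected_walk sc i0 (src e).
  have [tw1 te1] := tP (tgt e); have [tw2 te2] := tP (src e).
  have [||z1 z1E] := closed_walk_log cyc (i := i0) (w := z ++ e :: t (tgt e)).
  - by rewrite walk_cat zw /= ze eqxx.
  - by rewrite endv_cat.
  have [||z2 z2E] := closed_walk_log cyc (i := i0) (w := z ++ t (src e)).
  - by rewrite walk_cat zw ze.
  - by rewrite endv_cat ze.
  exists (z1 - z2 - Num.floor (P (tgt e) / a) + Num.floor (P (src e) / a)).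
  rewrite rmorphD !rmorphB /= mulrDl !mulrBl -z1E -z2E /f /P.
  rewrite !wr_cat wr_cons !lnM ?posrE ?mulr_gt0 ?wr_gt0 ?ratio_gt0//.
  ring.
have /choice[z zP] := edgeE.
exists (fun i => expR (f i)), (fun e => `|z e|%N); split => [i|e].
  exact: expR_gt0.
have ze0 : 0 < z e.
  have : (z e)%:~R * a < 0.
    rewrite -zP; have /andP[_ +] := f0 (tgt e); have /andP[+ _] := f0 (src e).
    by have := am e; lra.
  by rewrite nmulr_llt0// ltr0z.
split; first by rewrite absz_gt0 gt_eqF.
rewrite -[X in X * _](lnK (ratio_gt0 e)) -expRM_natl -!expRD; congr expR.
have -> : (`|z e|%N)%:R = (z e)%:~R :> R by rewrite -[in RHS](gez0_abs (ltW ze0)).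
rewrite -zP; ring.
Qed.
End Cycles.

Arguments homogeneous {R d} Phi theta p k.

(** * Lipschitz images: commensurability is necessary *)

Fixpoint subsums (R : nmodType) (l : seq R) : seq R :=
  if l is x :: l' then subsums l' ++ [seq x + y | y <- subsums l'] else [:: 0].

Lemma mem_subsums (R : nmodType) (T : Type) (l : seq T) (P : pred T) (F : T -> R) :
  \sum_(x <- l | P x) F x \in subsums (map F l).
Proof.
elim: l => [|x l IH]; first by rewrite big_nil mem_head.
rewrite big_cons /= mem_cat; case: ifP => _; last by rewrite IH.
by rewrite orbC map_f.
Qed.

Lemma wr_prefix_ge (R : realType) (d : nat) (Phi : gdifs R d) (w u : seq (edge Phi)) :
  wr (w ++ u) <= wr w.
Proof. by rewrite wr_cat ger_pMr ?wr_gt0// wr_le1. Qed.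

(** Ratios decrease along prefixes from 1, so some prefix is the first one of size at
    most [delta]. *)
Lemma mesh_prefix (R : realType) (d : nat) (Phi : gdifs R d) (w : seq (edge Phi))
    (delta : R) : wr w <= delta -> delta < 1 ->
  exists w1 e u, w = rcons w1 e ++ u /\ wr (rcons w1 e) <= delta < wr w1.
Proof.
move=> + d1; elim/last_ind: w => [|w e IH]; first by rewrite wr_nil leNgt d1.
have [wd|wd] := leP (wr w) delta.
  move=> _; have [w1 [e' [u [-> H]]]] := IH wd.
  by exists w1, e', (rcons u e); rewrite rcons_cat.
by move=> we; exists w, e, [::]; rewrite cats0 we wd.
Qed.

Definition allwords (R : realType) (d : nat) (Phi : gdifs R d) N : seq (seq (edge Phi)) :=
  flatten [seq words i n | i <- enum (vertex Phi), n <- iota 0 N.+1].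

Lemma mem_allwords (R : realType) (d : nat) (Phi : gdifs R d) N i (w : seq (edge Phi)) :
  walk i w -> (size w <= N)%N -> w \in allwords Phi N.
Proof.
move=> ww wN; apply/flattenP; exists (words i (size w)); last by rewrite mem_words ww eqxx.
by apply: allpairs_f; rewrite ?mem_enum// mem_iota.
Qed.

Section Powers.
Variables (R : realType) (d : nat) (Phi : gdifs R d).
Implicit Types (i : vertex Phi) (w c u v : seq (edge Phi)).

Lemma walk_power i c n : walk i c -> endv i c = i -> walk i (flatten (nseq n c)).
Proof. by move=> wc ce; elim: n => //= n IH; rewrite walk_cat wc ce. Qed.

Lemma size_power c n : size (flatten (nseq n c)) = (n * size c)%N.
Proof. by elim: n => //= n IH; rewrite size_cat IH mulSn. Qed.

Lemma wr_power c n : wr (flatten (nseq n c)) = wr c ^+ n.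
Proof. by elim: n => [|n IH] /=; rewrite ?wr_nil// wr_cat IH exprS. Qed.

Lemma ln_wr_power c n : ln (wr (flatten (nseq n c))) = n%:R * ln (wr c).
Proof. by rewrite wr_power lnXn ?wr_gt0// mulr_natl. Qed.

Lemma homogeneous_wr (theta : R) p k i w : homogeneous Phi theta p k -> walk i w ->
  exists n, wr w * p (endv i w) = theta ^+ n * p i.
Proof.
move=> [_ hk]; elim: w i => [|e w IH] i /=.
  by exists 0%N; rewrite wr_nil expr0.
move=> /andP[/eqP <- ww]; have [n nE] := IH _ ww.
by exists (n + k e)%N; rewrite wr_cons -mulrA nE mulrCA (hk e).2 exprD mulrA.
Qed.

Lemma scale_split (r c0 : R) v u : r <= c0 * wr v -> c0 * wr (v ++ u) < r ->
  exists u1 e u2, [/\ u = u1 ++ e :: u2, r <= c0 * wr (v ++ u1) &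
    c0 * wr (v ++ (u1 ++ [:: e])) < r].
Proof.
move=> rv; elim/last_ind: u => [|u e IH]; first by rewrite cats0 ltNge rv.
have [ur|ur] := ltP (c0 * wr (v ++ u)) r.
  move=> _; have [u1 [e1 [u2 [-> h1 h2]]]] := IH ur.
  by exists u1, e1, (rcons u2 e); rewrite rcons_cat.
by rewrite -cats1 => er; exists u, e, [::].
Qed.

End Powers.

Section LipschitzImage.
Variables (R : realType) (d1 d2 : nat) (Phi : gdifs R d1) (Psi : gdifs R d2).
Variables (K : vertex Phi -> set 'rV[R]_d1) (L : vertex Psi -> set 'rV[R]_d2).
Hypotheses (attrK : attractors K) (attrL : attractors L).
Hypotheses (dustK : dust_like Phi) (dustL : dust_like Psi).
Variables (i0 : vertex Phi) (j0 : vertex Psi).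
Variables (s : R) (h : vertex Phi -> R) (h' : vertex Psi -> R).
Hypothesis s_gt0 : 0 < s.
Hypotheses (h_gt0 : forall i, 0 < h i) (h'_gt0 : forall j, 0 < h' j).
Hypothesis eig : forall i, trans (@src _ _ Phi) (@tgt _ _ Phi)
  (fun e => ratio e `^ s) h i = 1 * h i.
Hypothesis eig' : forall j, trans (@src _ _ Psi) (@tgt _ _ Psi)
  (fun e => ratio e `^ s) h' j = 1 * h' j.
Variable f : 'rV[R]_d1 -> 'rV[R]_d2.
Hypothesis lipf : lipschitz_in (K i0) f.
Hypothesis surjf : f @` K i0 = L j0.

Local Notation cX := (cyl K i0).
Local Notation cY := (cyl L j0).
Local Notation muX := (mu s 1 h i0).
Local Notation nuY := (mu s 1 h' j0).
Local Notation has_mass := (has_mass K s 1 h i0).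
Implicit Types (w : seq (edge Phi)) (v u : seq (edge Psi)) (A B : set 'rV[R]_d1).

Let muE w : muX w = wr w `^ s * h (endv i0 w).
Proof. by rewrite /mu expr1n invr1 mul1r. Qed.

Let nuE v : nuY v = wr v `^ s * h' (endv j0 v).
Proof. by rewrite /mu expr1n invr1 mul1r. Qed.

Let nuY_gt0 v : 0 < nuY v. Proof. exact: mu_gt0. Qed.

(** A cylinder of small enough ratio compared with [cY v] has an image of diameter
    less than the gap around [cY v]. *)
Lemma lip_scale : exists c0, 0 < c0 < 1 /\ forall w v x x', walk i0 w -> walk j0 v ->
  wr w <= c0 * wr v -> cX w x -> cX w x' -> cY v (f x) -> cY v (f x').
Proof.
have [l l0 lP] := lipf; have [D D0 DP] := diam_bound attrK.
have [g g0 gP] := sep_bound attrL dustL.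
have lD : 0 < l * D + 1 by rewrite ltr_wpDl// mulr_ge0// ltW.
exists (Num.min (1/2) (g / 2 / (l * D + 1))); split.
  rewrite lt_min !divr_gt0//= gt_min; apply/orP; left; lra.
move=> w v x x' ww wv wrw wx wx' fx.
have [Kx Kx'] := (cyl_subK attrK ww wx, cyl_subK attrK ww wx').
apply: contrapT => nfx'.
have Lx' : L j0 (f x') by rewrite -surjf; exists x'.
have := gP j0 v _ _ wv fx Lx' nfx'; apply/negP; rewrite -ltNge.
apply: le_lt_trans (lP _ _ Kx Kx') _.
apply: (@le_lt_trans _ _ (l * D * wr w)).
  by rewrite -mulrA ler_wpM2l// (DP i0).
have : wr w <= g / 2 / (l * D + 1) * wr v.
  by apply: le_trans wrw _; rewrite ler_pM2r ?wr_gt0// ge_min lexx orbT.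
move=> wrw'; apply: (@le_lt_trans _ _ (g / 2 * wr v)).
  apply: (@le_trans _ _ ((l * D + 1) * (g / 2 / (l * D + 1) * wr v))).
    apply: ler_pM => //; rewrite ?mulr_ge0 ?(ltW D0) ?(ltW (wr_gt0 _))//.
    by rewrite lerDl.
  by rewrite le_eqVlt; apply/orP; left; apply/eqP; field; rewrite gt_eqF.
by rewrite ltr_pM2r ?wr_gt0// ltr_pdivrMr// mulr_natr mulr2n ltrDl.
Qed.

Variable c0 : R.
Hypothesis c0_itv : 0 < c0 < 1.
Hypothesis c0P : forall w v x x', walk i0 w -> walk j0 v ->
  wr w <= c0 * wr v -> cX w x -> cX w x' -> cY v (f x) -> cY v (f x').

Let c0_gt0 : 0 < c0. Proof. by case/andP: c0_itv. Qed.
Let c0v_gt0 v : 0 < c0 * wr v. Proof. by rewrite mulr_gt0 ?wr_gt0. Qed.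
Let c0v_lt1 v : c0 * wr v < 1.
Proof.
case/andP: c0_itv => _ c01; apply: le_lt_trans c01.
by rewrite ger_pMr// wr_le1.
Qed.

Definition saturated (delta : R) A := forall x w, A x -> walk i0 w -> cX w x ->
  wr w <= delta -> cX w `<=` A.

Definition restr A v := A `&` [set x | cY v (f x)].

(** Surjectivity onto [cY v] is weakened to meeting all cylinders down to relative
    depth [k]. The infimum of the mass ratio over patches of depth [k] increases
    with [k]; near its limit, whatever fails to be a patch of smaller mass already
    fails at a depth which does not depend on the patch. *)
Definition patch k v A := [/\ walk j0 v, A `<=` K i0, (forall x, A x -> cY v (f x)),
  saturated (c0 * wr v) A &
  forall u, walk (endv j0 v) u -> (size u <= k)%N -> restr A (v ++ u) !=set0].

Definition total_mass A : R := xget 0 [set m | has_mass A m].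

Lemma total_massE A m : has_mass A m -> total_mass A = m.
Proof.
move=> Am; apply: xget_unique => [//|m1 Am1]; exact: (has_mass_unique Am1 Am).
Qed.

Lemma saturated_level delta A : 0 < delta -> saturated delta A ->
  exists n0, forall n, (n0 <= n)%N -> sat_level K i0 n A.
Proof.
move=> d0 sA; have [rm [rx [_ rx1 rx0 rP]]] := ratio_bounds Phi.
have [n0 n0P] := expr_small (ltW rx0) rx1 d0; exists n0 => n nn w ww sw.
move=> /asboolP[x Ax wx]; apply: (sA x) => //.
apply: le_trans (n0P n nn); rewrite -sw; apply: wr_le_exp => e.
by have /andP[] := rP e.
Qed.

Lemma saturated_mass delta A : 0 < delta -> saturated delta A -> has_mass A (total_mass A).
Proof.
move=> d0 /(saturated_level d0)[n /(_ n (leqnn n)) sA].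
have H := has_mass_sat attrK ltr01 eig sA.
by rewrite (total_massE H).
Qed.

Lemma saturated_restr v v' A : walk j0 v' -> wr v' <= wr v ->
  saturated (c0 * wr v) A -> saturated (c0 * wr v') (restr A v').
Proof.
move=> wv' vv' sA x w [Ax fx] ww wx wrw y wy; split.
  by apply: (sA x w) => //; apply: le_trans wrw _; rewrite ler_pM2l.
exact: (c0P ww wv' wrw wx wy fx).
Qed.

Lemma restr_restr A v u : walk (endv j0 v) u -> restr (restr A v) (v ++ u) = restr A (v ++ u).
Proof.
move=> wu; apply/seteqP; split => x; first by move=> [[]].
by move=> [Ax fx]; split => //; split => //; exact: (cyl_sub attrL wu fx).
Qed.

Lemma patch_restr k m v u A : patch (k + m) v A -> walk (endv j0 v) u -> (size u <= m)%N ->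
  patch k (v ++ u) (restr A (v ++ u)).
Proof.
move=> [wv AK fA sA dA] wu um; have wvu : walk j0 (v ++ u) by rewrite walk_cat wv.
split => //.
- by move=> x [/AK].
- by move=> x [].
- by apply: saturated_restr sA => //; exact: wr_prefix_ge.
- move=> u' wu' su'; rewrite restr_restr// -catA; apply: dA.
    by rewrite walk_cat wu -endv_cat.
  by rewrite size_cat addnC leq_add.
Qed.

Lemma patch_le k m v A : (k <= m)%N -> patch m v A -> patch k v A.
Proof.
by move=> km [wv AK fA sA dA]; split => // u wu uk; apply: dA => //; exact: leq_trans km.
Qed.

Lemma patch_mass k v A : patch k v A -> has_mass A (total_mass A).
Proof. by case=> _ _ _ sA _; exact: saturated_mass sA. Qed.

Lemma mu_le_mass w A : walk i0 w -> cX w `<=` A -> has_mass A (total_mass A) -> muX w <= total_mass A.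
Proof.
move=> ww wA mA.
exact: (has_mass_mono h_gt0 ltr01 (has_mass_cyl attrK dustK ltr01 eig ww) mA wA).
Qed.

Lemma total_mass_children v A : walk j0 v -> (forall x, A x -> cY v (f x)) ->
  saturated (c0 * wr v) A ->
  total_mass A = \sum_(e | src e == endv j0 v) total_mass (restr A (rcons v e)).
Proof.
move=> wv fA sA.
have wve e : src e == endv j0 v -> walk j0 (rcons v e) by rewrite walk_rcons wv.
have sAe e : src e == endv j0 v ->
    saturated (c0 * wr (rcons v e)) (restr A (rcons v e)).
  move=> se; apply: saturated_restr sA; first exact: wve.
  by rewrite -cats1; exact: wr_prefix_ge.
have /choice[n nP] : forall e, exists n0, src e == endv j0 v -> forall n, (n0 <= n)%N ->
    sat_level K i0 n (restr A (rcons v e)) /\ mass K s 1 h i0 n (restr A (rcons v e)) = total_mass (restr A (rcons v e)).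
  move=> e; have [se|nse] := boolP (src e == endv j0 v); last by exists 0%N.
  have [n1 n1P] := saturated_level (c0v_gt0 _) (sAe e se).
  have [n2 n2P] := saturated_mass (c0v_gt0 _) (sAe e se).
  exists (maxn n1 n2) => _ n; rewrite geq_max => /andP[h1 h2].
  by split; [exact: n1P|exact: n2P].
have [n1 n1P] := saturated_mass (c0v_gt0 _) sA.
pose N := maxn n1 (\max_e n e).
have nN e : (n e <= N)%N by rewrite (leq_trans (leq_bigmax e))// leq_maxr.
rewrite -(n1P N) ?leq_maxl//.
rewrite (@mass_partition _ _ _ _ s 1 h _ (fun e => src e == endv j0 v) _ _ _
  (fun e => restr A (rcons v e))).
- by apply: eq_bigr => e se; have [] := nP e se N (nN e).
- move=> x; split; last by move=> [e _ []].
  by move=> Ax; have [e /eqP se ex] := cyl_child attrL (fA x Ax); exists e.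
- move=> e e' x se se' [_ ex] [_ ex'].
  have sz : (size (rcons v e) <= size (rcons v e'))%N by rewrite !size_rcons.
  have [u uE _] := cyl_comparable attrL dustL (wve _ se) (wve _ se') ex ex' sz.
  have u0 : u = [::].
    apply/nilP; move/(congr1 size)/eqP: uE.
    by rewrite size_cat !size_rcons -[eqbLHS]addn0 eqn_add2l eq_sym.
  by move: uE; rewrite u0 cats0 => /rcons_inj[].
- by move=> e se; have [] := nP e se N (nN e).
Qed.

(** Masses and [nuY] are both additive over children, so the excess of mass over its
    lower bound, being nonnegative, only decreases along [u]. *)
Lemma excess (t : R) v A G : patch 0 v A ->
  (forall u, walk (endv j0 v) u -> (size u <= G)%N -> t * nuY (v ++ u) <= total_mass (restr A (v ++ u))) ->
  forall u, walk (endv j0 v) u -> (size u <= G)%N ->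
    total_mass (restr A (v ++ u)) - t * nuY (v ++ u) <= total_mass A - t * nuY v.
Proof.
move=> [wv AK fA sA _] lower; elim/last_ind => [|u e IH].
  move=> _ _; rewrite cats0 (_ : restr A v = A)//.
  by apply/seteqP; split => x; [case|move=> Ax; split => //; exact: fA].
rewrite walk_rcons size_rcons => /andP[wu se] uG.
apply: le_trans (IH wu (ltnW uG)).
have wvu : walk j0 (v ++ u) by rewrite walk_cat wv.
have sAu : saturated (c0 * wr (v ++ u)) (restr A (v ++ u)).
  by apply: saturated_restr sA => //; exact: wr_prefix_ge.
rewrite [total_mass (restr A (v ++ u))](@total_mass_children (v ++ u))//; last by move=> x [].
rewrite -[nuY (v ++ u)](mu_rcons ltr01 eig') mulr_sumr -sumrB.
have se' : src e == endv j0 (v ++ u) by rewrite endv_cat.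
rewrite (bigD1 e)//= -rcons_cat.
rewrite (_ : restr (restr A (v ++ u)) (rcons (v ++ u) e) = restr A (rcons (v ++ u) e)); last first.
  by rewrite -cats1 restr_restr//= se'.
rewrite lerDl; apply: sumr_ge0 => e' /andP[se'' _].
rewrite (_ : restr (restr A (v ++ u)) (rcons (v ++ u) e') = restr A (rcons (v ++ u) e')); last first.
  by rewrite -cats1 restr_restr//= se''.
rewrite subr_ge0 rcons_cat; apply: lower.
  by rewrite walk_rcons wu -endv_cat.
by rewrite size_rcons.
Qed.

Lemma patch_root k : patch k [::] (K i0).
Proof.
split => //.
- by move=> x Kx; rewrite cyl_nil -surjf; exists x.
- by move=> x w _ ww _ _; exact: cyl_subK.
- move=> u wu _; have [y uy] := cyl_neq0 attrL j0 u.
  have : L j0 y by apply: (cyl_subK attrL wu uy).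
  by rewrite -surjf => -[x Kx fx]; exists x; split => //=; rewrite fx.
Qed.

Lemma total_mass_root : total_mass (K i0) = h i0.
Proof.
apply: total_massE; rewrite -(cyl_nil K) -(mu_nil s 1).
exact: (has_mass_cyl attrK dustK ltr01 eig).
Qed.

(** The bound [c0 * wr v < wr w] on the parent makes [rcons w e] as large as the
    saturation scale permits. *)
Lemma mesh_point v A x : saturated (c0 * wr v) A -> A `<=` K i0 -> A x ->
  exists w e, [/\ walk i0 (rcons w e), cX (rcons w e) x, cX (rcons w e) `<=` A &
    wr (rcons w e) <= c0 * wr v < wr w].
Proof.
move=> sA AK Ax; have [rm [rx [_ rx1 rx0 rP]]] := ratio_bounds Phi.
have [n nP] := expr_small (ltW rx0) rx1 (c0v_gt0 v).
have [u [wu su ux]] := @cyl_ext _ _ _ _ attrK i0 [::] x n ltac:(by rewrite cyl_nil; exact: AK).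
have uv : wr u <= c0 * wr v.
  apply: le_trans (nP n (leqnn n)); rewrite -su; apply: wr_le_exp => e.
  by have /andP[] := rP e.
have [w1 [e [u' [uE H]]]] := mesh_prefix uv (c0v_lt1 v).
move: wu ux; rewrite /= uE walk_cat => /andP[ww wu'] ux.
have wx : cX (rcons w1 e) x by exact: (cyl_sub attrK wu' ux).
exists w1, e; split => //.
by apply: (sA x) => //; case/andP: H.
Qed.

(** The cylinder removed is as large as saturation permits, so a smaller
    cylinder that meets it lies in it, and what is left is still saturated. *)
Lemma patch_remove k v A w e : patch k v A -> walk i0 (rcons w e) ->
  wr (rcons w e) <= c0 * wr v < wr w ->
  (forall u, walk (endv j0 v) u -> (size u <= k)%N ->
     ~ restr A (v ++ u) `<=` cX (rcons w e)) ->
  patch k v (A `&` ~` cX (rcons w e)).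
Proof.
move=> [wv AK fA sA dA] ww /andP[wr1 wr2] H; split => //.
- by move=> x [/AK].
- by move=> x [/fA].
- move=> x w' [Ax nx] ww' w'x wrw' z w'z; split; first exact: (sA x w').
  move=> wz; have [sz|sz] := leqP (size (rcons w e)) (size w').
    have [u uE wu] := cyl_comparable attrK dustK ww ww' wz w'z sz.
    by apply: nx; move: w'x; rewrite uE; exact: cyl_sub.
  have [u uE wu] := cyl_comparable attrK dustK ww' ww w'z wz (ltnW sz).
  case/lastP: u uE wu sz => [|u e'] uE wu.
    by rewrite uE cats0 ltnn.
  move=> _; move: uE; rewrite -rcons_cat => /rcons_inj[wE _].
  by move: wr2; rewrite ltNge (le_trans _ wrw')// wE; exact: wr_prefix_ge.
- move=> u wu uk; have /existsNP[x /not_implyP[[Ax fx] nx]] := H u wu uk.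
  by exists x.
Qed.

Lemma total_mass_remove v A w e : saturated (c0 * wr v) A ->
  saturated (c0 * wr v) (A `&` ~` cX (rcons w e)) ->
  walk i0 (rcons w e) -> cX (rcons w e) `<=` A ->
  total_mass A = total_mass (A `&` ~` cX (rcons w e)) + muX (rcons w e).
Proof.
move=> sA sB ww wA.
have [n1 n1P] := saturated_level (c0v_gt0 _) sB.
have [n2 n2P] := saturated_mass (c0v_gt0 _) sB.
have [n3 n3P] := saturated_mass (c0v_gt0 _) sA.
have n4P : sat_level K i0 _ _ := sat_level_cyl attrK dustK ww.
have [n5 n5P] := has_mass_cyl attrK dustK ltr01 eig ww.
pose N := (n1 + n2 + n3 + size (rcons w e) + n5)%N.
rewrite -(n3P N); last by rewrite /N; lia.
rewrite -(n2P N); last by rewrite /N; lia.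
rewrite -(n5P N); last by rewrite /N; lia.
pose B (b : bool) := if b then A `&` ~` cX (rcons w e) else cX (rcons w e).
rewrite (@mass_partition _ _ _ _ s 1 h _ xpredT i0 N A B).
- by rewrite big_bool.
- move=> x; split => [Ax|[[] _ []//]].
    by have [wx|wx] := pselect (cX (rcons w e) x); [exists false|exists true].
  by move=> y Ky <-; apply: wA; exists y.
- by case=> -[] x _ _ //= => [[_ h1] h2|h1 [_ h2]].
- case=> _; first by apply: n1P; rewrite /N; lia.
  by apply: (sat_level_le attrK n4P); rewrite /N; lia.
Qed.

Lemma mu_lower (c1 : R) : 0 < c1 -> exists2 c, 0 < c & forall w v,
  c1 * wr v <= wr w -> c * nuY v <= muX w.
Proof.
move=> c10; have [m m0 mP] := fin_pos_lower h_gt0.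
have [m' m'0 m'P] := fin_pos_upper h'.
exists (c1 `^ s * m / m'); first by rewrite divr_gt0 ?mulr_gt0 ?powR_gt0.
move=> w v wv; rewrite nuE muE.
apply: (@le_trans _ _ ((c1 * wr v) `^ s * m)).
  rewrite powRM ?(ltW c10) ?(ltW (wr_gt0 _))//.
  rewrite [leLHS](_ : _ = c1 `^ s * wr v `^ s * m * (h' (endv j0 v) / m')); last first.
    by field; rewrite gt_eqF.
  rewrite ger_pMr ?mulr_gt0 ?powR_gt0 ?wr_gt0//.
  by rewrite ler_pdivrMr// mul1r.
apply: ler_pM; rewrite ?powR_ge0 ?(ltW m0)//.
by apply: powR_mono; rewrite ?(ltW s_gt0) ?mulr_ge0 ?(ltW c10) ?(ltW (wr_gt0 _)).
Qed.

Lemma patch_mass_lower : exists2 c, 0 < c & forall k v A, patch k v A ->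
  c * nuY v <= total_mass A.
Proof.
have [rm [rx [rm0 rx1 rx0 rP]]] := ratio_bounds Phi.
have [c cg cP] := mu_lower (mulr_gt0 c0_gt0 rm0).
exists c => // k v A pA; have mA := patch_mass pA; case: pA => wv AK fA sA dA.
have [x [Ax _]] := dA [::] isT isT.
have [w [e [ww wx wA /andP[_ wr2]]]] := mesh_point sA AK Ax.
apply: le_trans (mu_le_mass ww wA mA); apply: cP.
rewrite mulrAC wr_rcons ler_pM ?(ltW (c0v_gt0 _)) ?(ltW rm0) ?(ltW wr2)//.
by have /andP[] := rP e.
Qed.

(** [q] is the limit over [k] of the infimum of the mass ratio over patches of
    depth [k]. *)
Lemma mass_threshold : exists2 q, 0 < q &
  (forall t, t < q -> exists k, forall v A, patch k v A -> t * nuY v <= total_mass A) /\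
  (forall t k, q < t -> exists v A, patch k v A /\ total_mass A < t * nuY v).
Proof.
have [c cg cP] := patch_mass_lower.
pose T := [set t : R | exists k, forall v A, patch k v A -> t * nuY v <= total_mass A].
have Tc : T c by exists 0%N; exact: cP.
have ubT : ubound T (h i0 / h' j0).
  move=> t [k tP]; have := tP _ _ (patch_root k).
  by rewrite total_mass_root mu_nil -ler_pdivlMr.
have hT : has_sup T by split; [exists c|exists (h i0 / h' j0)].
exists (sup T); first by apply: lt_le_trans cg _; exact: (ub_le_sup hT.2).
split => [t tq|t k qt].
  have tq' : 0 < sup T - t by rewrite subr_gt0.
  have [t' [k kP] tt'] := sup_adherent tq' hT.
  exists k => v A /kP; apply: le_trans; rewrite ler_pM2r//.
  by move: tt'; rewrite subKr => /ltW.
have nT : ~ T t by move=> /(ub_le_sup hT.2); rewrite leNgt qt.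
have /forallNP/(_ k)/existsNP[v /existsNP[A /not_implyP[pA nA]]] := nT.
by exists v, A; split => //; rewrite ltNge; apply/negP.
Qed.

(** In a patch of mass ratio almost [q] and large depth, all restrictions are patches of
    large depth, so their mass ratios are almost at least [q]; by [excess] none of
    them can be much larger. *)
Lemma nearly_constant q k0 G (eta : R) : 0 < q -> 0 < eta ->
  (forall t, t < q -> exists k, forall v A, patch k v A -> t * nuY v <= total_mass A) ->
  (forall t k, q < t -> exists v A, patch k v A /\ total_mass A < t * nuY v) ->
  exists v A, patch (k0 + G) v A /\
    forall u, walk (endv j0 v) u -> (size u <= G)%N ->
      (q - eta) * nuY (v ++ u) <= total_mass (restr A (v ++ u)) <= (q + eta) * nuY (v ++ u).
Proof.
move=> q0 eta0 low high.
have [rm [rx [rm0 rx1 rx0 rP]]] := ratio_bounds Psi.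
have rm1 : rm <= 1.
  have [y /(K_unfold attrL)[e _ _]] := K_neq0 attrL j0.
  by have /andP[h1 _] := rP e; exact: le_trans h1 (ltW (ratio_lt1 e)).
have [m m0 mP] := fin_pos_lower h'_gt0.
have [m' m'0 m'P] := fin_pos_upper h'.
pose C := m' / m / (rm ^+ G) `^ s.
have rG : 0 < (rm ^+ G) `^ s by rewrite powR_gt0// exprn_gt0.
have C0 : 0 < C by rewrite !divr_gt0.
have nuC v u : (size u <= G)%N -> nuY v <= C * nuY (v ++ u).
  move=> uG; rewrite !nuE wr_cat powRM ?(ltW (wr_gt0 _))//.
  have wu : (rm ^+ G) `^ s <= wr u `^ s.
    apply: powR_mono; rewrite ?(ltW s_gt0) ?exprn_ge0 ?(ltW rm0)//.
    apply: (@le_trans _ _ (rm ^+ size u)).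
      by rewrite ler_wiXn2l// ltW.
    by apply: wr_ge_exp => // e; have /andP[] := rP e.
  rewrite [leRHS](_ : _ = wr v `^ s * (m' * (h' (endv j0 (v ++ u)) / m) * (wr u `^ s / (rm ^+ G) `^ s))).
    rewrite ler_pM2l ?powR_gt0 ?wr_gt0//.
    apply: le_trans (m'P _) _; rewrite -mulrA ler_peMr ?(ltW m'0)//.
    apply: mulr_ege1; by rewrite ler_pdivlMr// mul1r.
  by rewrite /C; field; rewrite !gt_eqF.
clearbody C.
pose e' := Num.min eta (eta / (2 * C)) / 2.
have e'0 : 0 < e' by rewrite divr_gt0// lt_min eta0 divr_gt0// mulr_gt0.
have e'eta : e' <= eta.
  by rewrite ler_pdivrMr// ge_min mulr_natr mulr2n lerDl ltW.
have e'C : (e' + e') * C <= eta.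
  rewrite -splitr -ler_pdivlMr// (@le_trans _ _ (eta / (2 * C)))//.
    by rewrite ge_min lexx orbT.
  by rewrite ler_pM2l// lef_pV2 ?posrE ?mulr_gt0// mulr_natl mulr2n lerDl ltW.
have [k1 k1P] := low (q - e') ltac:(by rewrite gtrBl).
have [v [A [pA MA]]] := high (q + e') (maxn k0 k1 + G)%N ltac:(by rewrite ltrDl).
exists v, A; split.
  by apply: patch_le pA; rewrite leq_add2r leq_maxl.
have lower u : walk (endv j0 v) u -> (size u <= G)%N -> (q - e') * nuY (v ++ u) <= total_mass (restr A (v ++ u)).
  move=> wu uG; apply: k1P; apply: patch_restr wu uG.
  by apply: patch_le pA; rewrite leq_add2r leq_maxr.
move=> u wu uG; apply/andP; split.
  by apply: le_trans (lower u wu uG); rewrite ler_pM2r// lerB.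
have := excess (patch_le (leq0n _) pA) lower wu uG.
rewrite lerBlDr => /le_trans; apply.
have : total_mass A - (q - e') * nuY v <= eta * nuY (v ++ u).
  apply: (@le_trans _ _ ((e' + e') * nuY v)).
    by rewrite lerBlDr -mulrDl; apply: ltW; apply: lt_le_trans MA _; rewrite ler_pM2r//; lra.
  apply: (@le_trans _ _ ((e' + e') * C * nuY (v ++ u))).
    by rewrite -mulrA ler_pM2l ?nuC// addr_gt0.
  by rewrite ler_pM2r.
have : (q - e') * nuY (v ++ u) <= q * nuY (v ++ u) by rewrite ler_pM2r// gerBl ltW.
by rewrite mulrDl; lra.
Qed.

(** A cylinder [w] meeting the preimage of [cY v] at a comparable scale cannot be spared:
    removing the mesh cylinder [ws] above it would lower the mass ratio below [q].
    By [patch_remove] the whole preimage of some [v ++ u2] with bounded [u2] then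
    lies in [ws]. Its mass is [wr ws `^ s] times one of finitely many numbers, and
    by [nearly_constant] it is about [q] times the mass of [v ++ u2], which is
    [wr v `^ s] times one of finitely many numbers. *)
Lemma balanced (c1 : R) : 0 < c1 -> exists ks : seq R, forall G (eps : R), 0 < eps ->
  exists v A, patch G v A /\
    forall u w x, walk (endv j0 v) u -> (size u <= G)%N -> walk i0 w -> cX w x ->
      restr A (v ++ u) x -> c1 * wr (v ++ u) <= wr w <= c0 * wr (v ++ u) ->
      exists2 k, k \in ks & `|s * ln (wr w) - s * ln (wr (v ++ u)) + k| <= eps.
Proof.
move=> c10; have [q q0 [low high]] := mass_threshold.
have [c cg cP] := mu_lower c10.
(* Removing a cylinder lowers the mass ratio by at least [c], more than enough
   to contradict this bound. *)
have [k0 k0P] := low (q - c / 2) ltac:(by rewrite gtrBl divr_gt0).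
have [rm [rx [rm0 rx1 rx0 rP]]] := ratio_bounds Phi.
have [rm' [rx' [rm'0 rx'1 rx'0 rP']]] := ratio_bounds Psi.
have [N2 N2P] := expr_small (ltW rx0) rx1 (divr_gt0 (divr_gt0 c10 c0_gt0) (ltr0n R 2)).
(* Relative level at which the preimage found below is a union of cylinders. *)
have [N1 N1P] := expr_small (ltW rx0) rx1 (exprn_gt0 k0 rm'0).
pose A1 := [seq - (s * ln (wr w)) | w <- allwords Phi N2].
pose A2 := flatten [seq [seq ln y | y <- subsums [seq wr w `^ s * h (endv i w) | w <- words i N1]]
   | i <- enum (vertex Phi)].
pose A3 := [seq - (s * ln (wr u)) | u <- allwords Psi k0].
pose A4 := [seq - ln (h' j) | j <- enum (vertex Psi)].
exists [seq a + b - ln q | a <- [seq a + b | a <- A1, b <- A2], b <- [seq a + b | a <- A3, b <- A4]].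
move=> G eps eps0.
(* The first two bounds turn into [eps] after taking logarithms, the last one
   keeps the mass ratio below [q + c / 2]. *)
pose eta := Num.min (Num.min (q * (1 - expR (- eps))) (q * (expR eps - 1))) (c / 4).
have eta0 : 0 < eta.
  rewrite !lt_min !mulr_gt0 ?subr_gt0 ?invr_gt0//.
    by rewrite -expR0 ltr_expR.
  by rewrite -expR0 ltr_expR oppr_lt0.
have eta1 : q * expR (- eps) <= q - eta.
  have : eta <= q * (1 - expR (- eps)) by rewrite !ge_min lexx.
  by rewrite mulrBr mulr1; lra.
have eta2 : q + eta <= q * expR eps.
  have : eta <= q * (expR eps - 1) by rewrite !ge_min lexx orbT.
  by rewrite mulrBr mulr1; lra.
have eta3 : eta <= c / 4 by rewrite !ge_min lexx !orbT.
have [v [A [pA near_q]]] := nearly_constant k0 (G + k0) q0 eta0 low high.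
exists v, A; split; first by apply: patch_le pA; rewrite addnC -addnA leq_addr.
move=> u w x wu uG ww wx Ax /andP[wr1 wr2].
set v1 := v ++ u in Ax wr1 wr2 *.
have pA1 : patch k0 v1 (restr A v1).
  by apply: (@patch_restr _ G) => //; apply: patch_le pA; rewrite leq_add2l leq_addr.
have [w1 [e [u' [wE /andP[wr3 wr4]]]]] := mesh_prefix wr2 (c0v_lt1 v1).
set ws := rcons w1 e in wE wr3.
have [wws wu'] : walk i0 ws /\ walk (endv i0 ws) u'.
  by move: ww; rewrite wE walk_cat => /andP.
have wsx : cX ws x by move: wx; rewrite wE; exact: cyl_sub.
have wswr : wr w <= wr ws by rewrite wE; exact: wr_prefix_ge.
have [wv1 AK1 fA1 sA1 _] := pA1.
have wsA : cX ws `<=` restr A v1 by exact: (sA1 x).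
have [u2 [wu2 u2k H2]] : exists u2, [/\ walk (endv j0 v1) u2, (size u2 <= k0)%N &
    restr (restr A v1) (v1 ++ u2) `<=` cX ws].
  apply: contrapT => /forallNP nH.
  have wr34 : wr ws <= c0 * wr v1 < wr w1 by rewrite wr3 wr4.
  have pB := patch_remove pA1 wws wr34 (fun u2 h1 h2 h3 => nH u2 (And3 h1 h2 h3)).
  have := k0P _ _ pB; have [_ _ _ sB _] := pB.
  have := total_mass_remove sA1 sB wws wsA; rewrite -/ws.
  have := cP _ _ (le_trans wr1 wswr).
  have /andP[_] := near_q u wu (leq_trans uG (leq_addr _ _)); rewrite -/v1.
  have : eta * nuY v1 <= c / 4 * nuY v1 by rewrite ler_pM2r.
  have : 0 < c * nuY v1 by rewrite mulr_gt0.
  by rewrite mulrBl mulrDl; lra.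
rewrite restr_restr// in H2; set v2 := v1 ++ u2 in H2.
have v2E : v2 = v ++ (u ++ u2) by rewrite /v2 /v1 catA.
have wuu2 : walk (endv j0 v) (u ++ u2) by rewrite walk_cat wu -endv_cat.
have /andP[M1 M2] : (q - eta) * nuY v2 <= total_mass (restr A v2) <= (q + eta) * nuY v2.
  by rewrite v2E; apply: near_q => //; rewrite size_cat leq_add.
have sB2 : saturated (c0 * wr v2) (restr A v2).
  rewrite /v2 -restr_restr//; apply: saturated_restr sA1; last exact: wr_prefix_ge.
  by rewrite walk_cat wv1.
have lB2 : sat_level K i0 (size ws + N1) (restr A v2).
  move=> w' ww' sw' /asboolP[y Ay w'y].
  have sz : (size ws <= size w')%N by rewrite sw' leq_addr.
  have [u'' u''E wu''] := cyl_comparable attrK dustK wws ww' (H2 y Ay) w'y sz.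
  apply: (sB2 y) => //; rewrite u''E /v2 [wr (ws ++ _)]wr_cat [wr (v1 ++ _)]wr_cat mulrA.
  apply: ler_pM; rewrite ?(ltW (wr_gt0 _))//.
  apply: (@le_trans _ _ (rx ^+ size u'')).
    by apply: wr_le_exp => e'; have /andP[] := rP e'.
  apply: (@le_trans _ _ (rm' ^+ k0)).
    apply: N1P; move/eqP: sw'; rewrite u''E size_cat eqn_add2l => /eqP ->.
    exact: leqnn.
  apply: (@le_trans _ _ (rm' ^+ size u2)).
    rewrite ler_wiXn2l ?(ltW rm'0)//.
    have [y' /(K_unfold attrL)[e' _ _]] := K_neq0 attrL j0.
    by have /andP[h1 _] := rP' e'; exact: le_trans h1 (ltW (ratio_lt1 e')).
  by apply: wr_ge_exp => // e'; have /andP[] := rP' e'.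
have := sub_cyl_mass attrK dustK ltr01 eig wws H2 lB2.
set S := (X in has_mass _ X) => /total_massE MS.
pose sg := \sum_(w <- words (endv i0 ws) N1 | meets K i0 (ws ++ w) (restr A v2))
   (wr w `^ s * h (endv (endv i0 ws) w)).
have SE : S = wr ws `^ s * sg.
  rewrite /S /sg mulr_sumr; apply: eq_bigr => u'' _.
  by rewrite muE wr_cat powRM ?(ltW (wr_gt0 _))// endv_cat mulrA.
have q_eta : 0 < q - eta by apply: lt_le_trans eta1; rewrite mulr_gt0 ?expR_gt0.
have S0 : 0 < S by rewrite -MS; apply: lt_le_trans M1; rewrite mulr_gt0.
have sg0 : 0 < sg by move: S0; rewrite SE pmulr_rgt0// powR_gt0// wr_gt0.
have lnS : ln S = s * ln (wr ws) + ln sg.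
  by rewrite SE lnM ?posrE ?powR_gt0 ?wr_gt0// ln_powR.
have lnnu : ln (nuY v2) = s * ln (wr v1) + s * ln (wr u2) + ln (h' (endv j0 v2)).
  by rewrite nuE /v2 [wr (v1 ++ _)]wr_cat lnM ?posrE ?powR_gt0 ?mulr_gt0 ?wr_gt0// ln_powR lnM ?posrE ?wr_gt0// mulrDr.
have lnw : ln (wr w) = ln (wr ws) + ln (wr u') by rewrite wE wr_cat lnM ?posrE ?wr_gt0.
exists ((- (s * ln (wr u')) + ln sg) + (- (s * ln (wr u2)) + - ln (h' (endv j0 v2))) - ln q).
  apply: allpairs_f; apply: allpairs_f.
  - apply: map_f; apply: (mem_allwords wu').
    rewrite leqNgt; apply/negP => N2u.
    have := N2P _ (ltnW N2u); rewrite leNgt => /negP; apply.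
    apply: (@lt_le_trans _ _ (c1 / c0)); first by rewrite ltr_pdivrMr// mulr_natr mulr2n ltrDl divr_gt0.
    apply: (@le_trans _ _ (wr u')); last first.
      by apply: wr_le_exp => e'; have /andP[] := rP e'.
    rewrite ler_pdivrMr// -(ler_pM2r (wr_gt0 v1)); apply: le_trans wr1 _.
    by rewrite wE wr_cat mulrC -mulrA ler_pM2l ?wr_gt0.
  - apply/flattenP; exists [seq ln y | y <- subsums [seq wr w `^ s * h (endv (endv i0 ws) w) | w <- words (endv i0 ws) N1]].
      by apply/mapP; exists (endv i0 ws); rewrite ?mem_enum.
    by apply: map_f; exact: mem_subsums.
  - by apply: map_f; exact: (mem_allwords wu2).
  - by apply/mapP; exists (endv j0 v2); rewrite ?mem_enum.
have nu0 := nuY_gt0 v2; have qn0 : 0 < q * nuY v2 by exact: mulr_gt0.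
have Sq0 : 0 < S / (q * nuY v2) by exact: divr_gt0.
rewrite [X in `|X|](_ : _ = ln (S / (q * nuY v2))); last first.
  rewrite ln_div ?posrE// lnM ?posrE// lnS lnnu lnw; ring.
rewrite ler_norml; apply/andP; split.
  rewrite -ler_expR lnK ?posrE// ler_pdivlMr//.
  by rewrite mulrA [_ * q]mulrC -MS; apply: le_trans M1; rewrite ler_pM2r.
rewrite -ler_expR lnK ?posrE// ler_pdivrMr//.
by rewrite mulrA [_ * q]mulrC -MS; apply: le_trans M2 _; rewrite ler_pM2r.
Qed.

Hypotheses (connPhi : strongly_connected Phi) (connPsi : strongly_connected Psi).

(** Going around [c] in the target [n] times, the preimages contain mesh cylinders whose
    ratios are powers of [theta] up to finitely many constants: [balanced] and
    [approx_rational] apply to the powers of [c]. *)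
Lemma rational_target_cycle (theta : R) p k : 0 < theta < 1 -> homogeneous Phi theta p k ->
  forall j (c : seq (edge Psi)), walk j c -> endv j c = j -> exists q : rat, ln (wr c) / ln theta = ratr q.
Proof.
move=> /andP[th0 th1] hom j c wc ce.
have [rm [rx [rm0 rx1 rx0 rP]]] := ratio_bounds Phi.
have [ks ksP] := balanced (mulr_gt0 c0_gt0 rm0).
have lnth : ln theta != 0 by rewrite lt_eqF// ln_lt0// th0.
have sn0 : s != 0 by rewrite gt_eqF.
have /choice[t tP] := fun j' => strongly_connected_walk connPsi j' j.
have [||q qE] := @approx_rational R (s * ln theta) (- (s * ln (wr c)))
    [seq s * (ln (p i0) - ln (p i)) + k | k <- ks, i <- enum (vertex Phi)].
- by rewrite mulf_neq0.
- move=> N eps eps0.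
  pose U := (\max_j' size (t j'))%N.
  have [v [A [pA AP]]] := ksP (U + N * size c)%N eps eps0.
  set tt := t (endv j0 v); have [wtt tte] := tP (endv j0 v).
  exists (- (s * ln (wr (v ++ tt)))) => n nN.
  have wu : walk (endv j0 v) (tt ++ flatten (nseq n c)).
    by rewrite walk_cat wtt tte walk_power.
  have su : (size (tt ++ flatten (nseq n c)) <= U + N * size c)%N.
    rewrite size_cat size_power leq_add// ?leq_mul2r ?nN ?orbT//.
    exact: (leq_bigmax (F := fun j' => size (t j'))).
  have [wv AK fA sA dA] := pA.
  have [x Ax] := dA _ wu su.
  set u := tt ++ _ in wu su Ax.
  have [w [e [ww wx _ /andP[wr1 wr2]]]] := mesh_point
    (saturated_restr (v' := v ++ u) ltac:(by rewrite walk_cat wv) (wr_prefix_ge v u) sA)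
    ltac:(by move=> z [/AK]) Ax.
  have [|k' k'ks kP] := AP u _ x wu su ww wx Ax.
    rewrite wr1 andbT mulrAC wr_rcons ler_pM ?(ltW (c0v_gt0 _)) ?(ltW rm0) ?(ltW wr2)//.
    by have /andP[] := rP e.
  have [n' n'E] := homogeneous_wr hom ww.
  have pe : 0 < p (endv i0 (rcons w e)) by exact: hom.1.
  have lnw : ln (wr (rcons w e)) = n'%:R * ln theta + (ln (p i0) - ln (p (endv i0 (rcons w e)))).
    apply: (@addIr _ (ln (p (endv i0 (rcons w e))))).
    rewrite -lnM ?posrE ?wr_gt0// n'E lnM ?posrE ?exprn_gt0//; last exact: hom.1.
    by rewrite lnXn// mulr_natl; ring.
  have lnv : ln (wr (v ++ u)) = ln (wr (v ++ tt)) + n%:R * ln (wr c).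
    by rewrite /u catA wr_cat lnM ?posrE ?wr_gt0// ln_wr_power.
  exists (s * (ln (p i0) - ln (p (endv i0 (rcons w e)))) + k'), n'%:Z; split.
    by apply: allpairs_f; rewrite ?mem_enum.
  rewrite [X in `|X|](_ : _ = s * ln (wr (rcons w e)) - s * ln (wr (v ++ u)) + k')//.
  have -> : (n'%:Z)%:~R = n'%:R :> R by []. rewrite lnw lnv. ring.
exists (- q); have -> : ratr (- q) = - ratr q :> R by rewrite rmorphN.
by rewrite -qE; field; rewrite lnth sn0.
Qed.

(** Going around [c] in the source [n] times, [balanced] compares the cylinder reached
    with one of the target of the same scale, whose ratio is a power of [theta] up
    to finitely many constants. *)
Lemma rational_source_cycle (theta : R) p k : 0 < theta < 1 -> homogeneous Psi theta p k ->
  forall i (c : seq (edge Phi)), walk i c -> endv i c = i -> exists q : rat, ln (wr c) / ln theta = ratr q.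
Proof.
move=> /andP[th0 th1] hom i c wc ce.
have [rm [rx [rm0 rx1 rx0 rP]]] := ratio_bounds Psi.
have [rm' [rx' [rm'0 rx'1 rx'0 rP']]] := ratio_bounds Phi.
have [ks ksP] := balanced (mulr_gt0 c0_gt0 rm0).
have lnth : ln theta != 0 by rewrite lt_eqF// ln_lt0// th0.
have sn0 : s != 0 by rewrite gt_eqF.
have /choice[t tP] := fun i' => strongly_connected_walk connPhi i' i.
have [tm tm0 tmP] := fin_pos_lower (fun i' => wr_gt0 (t i')).
have [||q qE] := @approx_rational R (s * ln theta) (s * ln (wr c))
    [seq - (s * (ln (p j0) - ln (p j))) + k | k <- ks, j <- enum (vertex Psi)].
- by rewrite mulf_neq0.
- move=> N eps eps0.
  have lowN : 0 < rm' * tm * wr c ^+ N / 2 by rewrite divr_gt0 ?mulr_gt0 ?exprn_gt0 ?wr_gt0.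
  have [G GP] := expr_small (ltW rx0) rx1 lowN.
  have [v [A [pA AP]]] := ksP G eps eps0.
  have [wv AK fA sA dA] := pA.
  have [x0 [Ax0 _]] := dA [::] isT isT.
  have [w0 [e [ww0 wx0 w0A /andP[wr1 wr2]]]] := mesh_point sA AK Ax0.
  set w1 := rcons w0 e in ww0 wx0 w0A wr1.
  set tt := t (endv i0 w1); have [wtt tte] := tP (endv i0 w1).
  exists (s * ln (wr (w1 ++ tt))) => n nN.
  set w := (w1 ++ tt) ++ flatten (nseq n c).
  have ww : walk i0 w by rewrite /w walk_cat walk_cat ww0 wtt endv_cat tte walk_power.
  have [x wx] := cyl_neq0 attrK i0 w.
  have w1x : cX w1 x.
    move: wx ww; rewrite /w -catA => wx; rewrite walk_cat => /andP[_ wu].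
    exact: (cyl_sub attrK wu).
  have Ax : A x by exact: w0A.
  have [u [wu su ux]] := cyl_ext attrL G (fA x Ax).
  have wrw1 : wr w <= c0 * wr v.
    by apply: le_trans wr1; rewrite /w -catA; exact: wr_prefix_ge.
  have wrw2 : c0 * wr (v ++ u) < wr w.
    rewrite /w [wr ((w1 ++ tt) ++ _)]wr_cat wr_power [wr (w1 ++ tt)]wr_cat.
    apply: (@lt_le_trans _ _ (c0 * wr v * rm' * tm * wr c ^+ N)); last first.
      apply: ler_pM; rewrite ?mulr_ge0 ?exprn_ge0 ?(ltW c0_gt0) ?(ltW (wr_gt0 _)) ?(ltW rm'0) ?(ltW tm0)//.
        apply: ler_pM; rewrite ?mulr_ge0 ?(ltW c0_gt0) ?(ltW (wr_gt0 _)) ?(ltW rm'0) ?(ltW tm0)//.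
          rewrite /w1 wr_rcons ler_pM ?(ltW (c0v_gt0 _)) ?(ltW rm'0) ?(ltW wr2)//.
          by have /andP[] := rP' e.
        exact: tmP.
      by rewrite ler_wiXn2l ?wr_le1 ?(ltW (wr_gt0 _)).
    rewrite wr_cat !mulrA -!mulrA ltr_pM2l// ltr_pM2l ?wr_gt0//.
    apply: (@le_lt_trans _ _ (rx ^+ G)).
      by rewrite -su; apply: wr_le_exp => e'; have /andP[] := rP e'.
    apply: le_lt_trans (GP G (leqnn G)) _.
    by rewrite ltr_pdivrMr// mulr_natr mulr2n !mulrA ltrDl !mulr_gt0 ?exprn_gt0 ?wr_gt0.
  have [u1 [e1 [u2 [uE wru1 wru2]]]] := scale_split wrw1 wrw2.
  have wu1 : walk (endv j0 v) u1 by move: wu; rewrite uE walk_cat => /andP[].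
  have su1 : (size u1 <= G)%N by rewrite -su uE size_cat leq_addr.
  have Ax1 : restr A (v ++ u1) x.
    split => //=; move: ux wu; rewrite uE catA walk_cat => ux /andP[_ wu2].
    by apply: (cyl_sub attrL _ ux); rewrite endv_cat.
  have [|k' k'ks kP] := AP u1 w x wu1 su1 ww wx Ax1.
    rewrite wru1 andbT; apply: le_trans (ltW wru2).
    rewrite catA [wr ((v ++ u1) ++ _)]wr_cat wr_cons wr_nil mulr1 -!mulrA ler_pM2l// mulrC ler_pM2l ?wr_gt0//.
    by have /andP[] := rP e1.
  have wvu : walk j0 (v ++ u1) by rewrite walk_cat wv.
  have [n' n'E] := homogeneous_wr hom wvu.
  have pe : 0 < p (endv j0 (v ++ u1)) by exact: hom.1.
  have lnv : ln (wr (v ++ u1)) = n'%:R * ln theta + (ln (p j0) - ln (p (endv j0 (v ++ u1)))).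
    apply: (@addIr _ (ln (p (endv j0 (v ++ u1))))).
    rewrite -lnM ?posrE ?wr_gt0// n'E lnM ?posrE ?exprn_gt0//; last exact: hom.1.
    by rewrite lnXn// mulr_natl; ring.
  have lnw : ln (wr w) = ln (wr (w1 ++ tt)) + n%:R * ln (wr c).
    by rewrite /w wr_cat lnM ?posrE ?wr_gt0// ln_wr_power.
  exists (- (s * (ln (p j0) - ln (p (endv j0 (v ++ u1))))) + k'), (- n'%:Z); split.
    by apply: (allpairs_f (fun k j => - (s * (ln (p j0) - ln (p j))) + k)); rewrite ?mem_enum.
  rewrite [X in `|X|](_ : _ = s * ln (wr w) - s * ln (wr (v ++ u1)) + k')//.
  by rewrite lnw lnv rmorphN /= (_ : (n'%:Z)%:~R = n'%:R :> R)//; ring.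
by exists q; rewrite -qE; field; rewrite lnth sn0.
Qed.

End LipschitzImage.

(** * Lipschitz maps from matched partitions *)

Lemma edistC (R : realType) (d : nat) (x y : 'rV[R]_d) : edist x y = edist y x.
Proof. by congr Num.sqrt; apply: eq_bigr => i _; rewrite -sqrrN opprB. Qed.

Section TreeMap.
Variables (R : realType) (d1 d2 : nat).
Variables (X : set 'rV[R]_d1) (Y : set 'rV[R]_d2).
Variable node : nat -> set 'rV[R]_d1 -> set 'rV[R]_d2 -> Prop.
Variables (theta c C : R).
Hypotheses (theta_itv : 0 < theta < 1) (c_gt0 : 0 < c) (C_gt0 : 0 < C).
Hypothesis node0 : node 0 X Y.
Hypothesis nodedisj : forall n U J U' J' x, node n U J -> node n U' J' -> U x -> U' x ->
  U = U' /\ J = J'.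
Hypothesis nodesep : forall n U J x x', node n U J -> U x -> X x' -> ~ U x' ->
  c * theta ^+ n <= edist x x'.
Hypothesis nodediam : forall n U J y y', node n U J -> J y -> J y' ->
  edist y y' <= C * theta ^+ n.
Hypothesis noderefX : forall n U J x, node n U J -> U x ->
  exists U' J', [/\ node n.+1 U' J', U' x, U' `<=` U & J' `<=` J].
Hypothesis noderefY : forall n U J y, node n U J -> J y ->
  exists U' J', [/\ node n.+1 U' J', J' y, U' `<=` U & J' `<=` J].
Hypothesis nodecompact : forall n U J, node n U J ->
  [/\ compact U, compact J, U !=set0 & J !=set0].

Let theta_gt0 : 0 < theta. Proof. by case/andP: theta_itv. Qed.

Lemma branch (Q : set 'rV[R]_d1 -> set 'rV[R]_d2 -> Prop) : Q X Y ->
  (forall n U J, node n U J -> Q U J ->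
     exists U' J', [/\ node n.+1 U' J', Q U' J', U' `<=` U & J' `<=` J]) ->
  exists F : nat -> set 'rV[R]_d1 * set 'rV[R]_d2, F 0%N = (X, Y) /\ forall n,
    [/\ node n (F n).1 (F n).2, Q (F n).1 (F n).2,
      (F n.+1).1 `<=` (F n).1 & (F n.+1).2 `<=` (F n).2].
Proof.
move=> Q0 Qstep.
have /choice[next nextP] : forall a : nat * (set 'rV[R]_d1 * set 'rV[R]_d2),
    exists b : set 'rV[R]_d1 * set 'rV[R]_d2, node a.1 a.2.1 a.2.2 -> Q a.2.1 a.2.2 ->
      [/\ node a.1.+1 b.1 b.2, Q b.1 b.2, b.1 `<=` a.2.1 & b.2 `<=` a.2.2].
  move=> [n [U J]] /=; case: (pselect (node n U J /\ Q U J)) => [[h1 h2]|h].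
    by have [U' [J' H]] := Qstep n U J h1 h2; exists (U', J').
  by exists (U, J) => h1 h2; exfalso; apply: h.
pose F := fix F n := if n is m.+1 then next (m, F m) else (X, Y).
have FP n : node n (F n).1 (F n).2 /\ Q (F n).1 (F n).2.
  by elim: n => [//|n [h1 h2]]; have [] := nextP (n, F n) h1 h2.
exists F; split => // n; have [h1 h2] := FP n.
by have [] := nextP (n, F n) h1 h2.
Qed.

Lemma small_eq d (x y : 'rV[R]_d) (B : R) : 0 < B ->
  (forall n, edist x y <= B * theta ^+ n) -> x = y.
Proof.
move=> B0 xy; apply: edist_eq0; apply/eqP; rewrite eq_le edist_ge0 andbT.
apply/ler_addgt0Pr => e e0; rewrite add0r.
have [_ th1] := andP theta_itv.
have [n nP] := expr_small (ltW theta_gt0) th1 (divr_gt0 e0 B0).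
apply: le_trans (xy n) _; rewrite mulrC -ler_pdivlMr//; exact: nP.
Qed.

(** A point [x] determines the decreasing sequence of nodes [(U, J)] with [x] in [U], and
    [f x] is the common point of the sets [J]. Points separated at level [n + 1] are
    at distance of order [theta ^+ n] while their images share a [J] of that size. *)
Lemma tree_map : exists f : 'rV[R]_d1 -> 'rV[R]_d2, lipschitz_in X f /\ f @` X = Y.
Proof.
have /choice[f fP] : forall x, exists y, X x -> forall n, exists U J, [/\ node n U J, U x & J y].
  move=> x; case: (pselect (X x)) => [Xx|nXx]; last by exists 0.
  have [|F [_ FP]] := @branch (fun U _ => U x) Xx.
    by move=> n U J PUJ Ux; exact: noderefX PUJ Ux.
  have [|||y yP] := @nested_compact _ (fun n => (F n).2) (@norm_hausdorff _ _).
  - by move=> n; have [/nodecompact[]] := FP n.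
  - by move=> n; have [/nodecompact[]] := FP n.
  - by move=> n; have [] := FP n.
  by exists y => _ n; have [h1 h2 _ _] := FP n; exists (F n).1, (F n).2.
have spec x n U J : X x -> node n U J -> U x -> J (f x).
  move=> Xx PUJ Ux; have [U' [J' [PUJ' Ux' Jf]]] := fP x Xx n.
  by have [_ ->] := nodedisj PUJ PUJ' Ux Ux'.
exists f; split.
  exists (C / (c * theta)); first by rewrite divr_ge0 ?mulr_ge0 ?ltW.
  move=> x x' Xx Xx'.
  case: (pselect (forall n U J, node n U J -> U x -> U x')) => [same|].
    have -> : f x = f x'.
      apply: (small_eq C_gt0) => n; have [U [J [PUJ Ux Jf]]] := fP x Xx n.
      by apply: (nodediam PUJ) => //; apply: (spec _ _ _ _ Xx' PUJ); exact: (same n _ _ PUJ).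
    by rewrite edistxx mulr_ge0 ?divr_ge0 ?mulr_ge0 ?edist_ge0 ?ltW.
  move=> /existsNP[n nP].
  have [m [mP mmin]] : exists m, (~ forall U J, node m U J -> U x -> U x') /\
      forall k, (k < m)%N -> forall U J, node k U J -> U x -> U x'.
    have ex : exists n, `[< ~ forall U J, node n U J -> U x -> U x' >] by exists n; apply/asboolP.
    case: (ex_minnP ex) => m /asboolP mP mmin; exists m; split => // k km.
    apply: contrapT => nk; have := mmin k (introT (asboolP _) nk).
    by rewrite leqNgt km.
  have [U [J [PUJ Ux nUx']]] : exists U J, [/\ node m U J, U x & ~ U x'].
    move/existsNP: mP => [U /existsNP[J /not_implyP[PUJ /not_implyP[Ux Ux']]]].
    by exists U, J.
  have sep := nodesep PUJ Ux Xx' nUx'.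
  case: m {mP} mmin PUJ sep => [|m] mmin PUJ sep.
    exfalso; apply: nUx'; have [<- _] := nodedisj node0 PUJ Xx Ux; exact: Xx'.
  have [U0 [J0 [PUJ0 U0x J0f]]] := fP x Xx m.
  have U0x' := mmin m (leqnn _) _ _ PUJ0 U0x.
  apply: le_trans (nodediam PUJ0 J0f (spec _ _ _ _ Xx' PUJ0 U0x')) _.
  rewrite mulrAC ler_pdivlMr ?mulr_gt0// -mulrA ler_pM2l//.
  by rewrite mulrCA -exprSr.
apply/seteqP; split => [_ [x Xx <-]|y Yy]; first exact: (spec _ _ _ _ Xx node0 Xx).
have [|F [F0 FP]] := @branch (fun _ J => J y) Yy.
  by move=> n U J PUJ Jy; exact: noderefY PUJ Jy.
have [|||x xP] := @nested_compact _ (fun n => (F n).1) (@norm_hausdorff _ _).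
- by move=> n; have [/nodecompact[]] := FP n.
- by move=> n; have [/nodecompact[]] := FP n.
- by move=> n; have [] := FP n.
have Xx : X x by have := xP 0%N; rewrite F0.
exists x => //; apply: (small_eq C_gt0) => n; have [PF Fy _ _] := FP n.
exact: (nodediam PF (spec _ _ _ _ Xx PF (xP n)) Fy).
Qed.

End TreeMap.

(** * Types with delays and integer intertwiners *)

Section Delays.
Variables (R : realType) (d : nat) (Phi : gdifs R d) (k : edge Phi -> nat) (K : nat).
Hypothesis k_gt0 : forall e, (0 < k e)%N.
Hypothesis k_le : forall e, (k e <= K)%N.
Local Notation T := (vertex Phi * 'I_K.+1)%type.

(** The delay [l] of a type [(i, l)] counts the generations before the piece is cut at
    its end vertex [i]. With delays each generation scales by the same factor, so
    that the types of both systems evolve by integer matrices with the same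
    Perron-Frobenius eigenvalue [b^-1]. *)
Definition children (t : T) : seq T :=
  if t.2 == ord0 then [seq (tgt e, inord (k e).-1) | e <- enum (edge Phi) & src e == t.1]
  else [:: (t.1, inord t.2.-1)].

Variables (b : R).
Hypothesis b_gt0 : 0 < b.

Definition right_weight (h : vertex Phi -> R) (t : T) : R := b ^+ t.2 * h t.1.

Lemma right_weightP h :
  (forall i, \sum_(e | src e == i) b ^+ k e * h (tgt e) = h i) ->
  forall t, \sum_(t' <- children t) right_weight h t' = b^-1 * right_weight h t.
Proof.
move=> hP [i l]; rewrite /children /right_weight /=; case: eqP => [->|/eqP l0] /=.
  rewrite big_map big_filter big_enum_cond /= expr0 mul1r -hP mulr_sumr.
  apply: eq_bigr => e _; rewrite inordK; last by have := k_le e; lia.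
  by rewrite -[in RHS](prednK (k_gt0 e)) exprS !mulrA mulVf ?mul1r// gt_eqF.
rewrite big_seq1 inordK; last by have := ltn_ord l; lia.
have l1 : (0 < l)%N by rewrite lt0n.
by rewrite -[in RHS](prednK l1) exprS !mulrA mulVf ?mul1r// gt_eqF.
Qed.

(** The mass of the walks that have entered the edge [e] towards [i] and have [l]
    generations left to spend on it. *)
Definition left_weight (g : vertex Phi -> R) (t : T) : R :=
  \sum_(e | (tgt e == t.1) && (t.2 < k e)%N) b ^+ (k e - t.2) * g (src e).

Lemma left_weight_ge0 g t : (forall i, 0 <= g i) -> 0 <= left_weight g t.
Proof. by move=> g0; apply: sumr_ge0 => e _; rewrite mulr_ge0// exprn_ge0// ltW. Qed.

Lemma left_weight0 g i :
  (forall i, \sum_(e | tgt e == i) b ^+ k e * g (src e) = g i) ->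
  left_weight g (i, ord0) = g i.
Proof.
move=> gP; rewrite -[RHS]gP; apply: eq_big => [e|e _] /=; first by rewrite k_gt0 andbT.
by rewrite subn0.
Qed.

Lemma left_weightP g :
  (forall i, \sum_(e | tgt e == i) b ^+ k e * g (src e) = g i) ->
  forall t', \sum_t left_weight g t * (count_mem t' (children t))%:R = b^-1 * left_weight g t'.
Proof.
move=> gP [i' l'].
rewrite -(pair_bigA _ (fun i l => left_weight g (i, l) * (count_mem (i', l') (children (i, l)))%:R)) /=.
under eq_bigr do rewrite big_ord_recl.
rewrite big_split /=.
have -> : \sum_i left_weight g (i, ord0) * (count_mem (i', l') (children (i, ord0)))%:R =
    \sum_(e | (tgt e == i') && (k e == l'.+1)) g (src e).
  under eq_bigr => i _.
    rewrite left_weight0// /children eqxx /= count_map count_filter -sum1_count.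
    rewrite big_enum_cond /= natr_sum mulr_sumr.
    over.
  rewrite (exchange_big_dep (fun e => (tgt e == i') && (k e == l'.+1)))/=.
    apply: eq_bigr => e /andP[/eqP e1 /eqP e2].
    rewrite (big_pred1 (src e)) ?mulr1// => i /=.
    rewrite e2 /= -e1 inord_val eqxx /=; exact: eq_sym.
  move=> i e _ /andP[/eqP[-> e2] _]; rewrite eqxx /=.
  rewrite -e2 inordK ?prednK//; by have := k_le e; lia.
have -> : \sum_i \sum_(l < K) left_weight g (i, lift ord0 l) *
     (count_mem (i', l') (children (i, lift ord0 l)))%:R =
   \sum_(e | (tgt e == i') && (l'.+1 < k e)%N) b ^+ (k e - l'.+1) * g (src e).
  rewrite (bigD1 i')//= [X in _ + X]big1 ?addr0; last first.
    move=> i ii'; apply: big1 => l _; rewrite /children /= xpair_eqE (negPf ii') /=.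
    by rewrite mulr0.
  have [lK|lK] := ltnP l' K.
    rewrite (bigD1 (Ordinal lK))//= [X in _ + X]big1 ?addr0; last first.
      move=> l ll'; rewrite /children /= xpair_eqE eqxx /=.
      rewrite (_ : (inord _ == l') = false) ?mulr0//.
      apply/negP => /eqP lE; move/eqP: ll'; apply; apply: val_inj => /=.
      rewrite -lE inordK//; rewrite /bump /=; have := ltn_ord l; lia.
    rewrite /children /= xpair_eqE eqxx /= (_ : inord _ == l' = true) ?mulr1.
      by rewrite /left_weight /= /bump /=.
    by apply/eqP; apply: val_inj; rewrite /= inordK /bump //=; lia.
  rewrite big1 ?big_pred0 // => [e|l _].
    by apply/negP => /andP[_]; have := k_le e; lia.
  rewrite /children /= xpair_eqE eqxx /=.
  rewrite (_ : (inord _ == l') = false) ?mulr0//.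
  apply/negP => /eqP lE; move: lK; rewrite -lE inordK /bump //=; have := ltn_ord l; lia.
rewrite /left_weight /= mulr_sumr.
rewrite [RHS](bigID (fun e => k e == l'.+1)) /=; congr (_ + _).
  apply: eq_big => [e|e /andP[_ /eqP ->]].
    by case: (k e =P l'.+1) => [->|_]; rewrite ?andbF// ltnSn !andbT.
  by rewrite subSnn expr1 mulrA mulVf ?mul1r// gt_eqF.
apply: eq_big => [e|e /andP[_ le]].
  by rewrite -andbA; congr (_ && _); rewrite ltn_neqAle andbC eq_sym.
rewrite (_ : (k e - l' = (k e - l'.+1).+1)%N); last by lia.
by rewrite exprS !mulrA mulVf ?mul1r// gt_eqF.
Qed.

End Delays.

Arguments children {R d Phi} k {K} t.

Section Bags.
Variables (R : realType) (d1 d2 : nat) (Phi : gdifs R d1) (Psi : gdifs R d2).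
Variables (k : edge Phi -> nat) (k' : edge Psi -> nat) (K K' : nat).
Hypotheses (k_gt0 : forall e, (0 < k e)%N) (k'_gt0 : forall e, (0 < k' e)%N).
Hypotheses (k_le : forall e, (k e <= K)%N) (k'_le : forall e, (k' e <= K')%N).
Variables (b : R) (g : vertex Phi -> R) (h : vertex Psi -> R).
Hypotheses (b_gt0 : 0 < b) (g_gt0 : forall i, 0 < g i) (h_gt0 : forall j, 0 < h j).
Hypothesis gP : forall i, \sum_(e | tgt e == i) b ^+ k e * g (src e) = g i.
Hypothesis hP : forall j, \sum_(e | src e == j) b ^+ k' e * h (tgt e) = h j.
Local Notation TX := (vertex Phi * 'I_K.+1)%type.
Local Notation TY := (vertex Psi * 'I_K'.+1)%type.
Local Notation chX := (@children R d1 Phi k K).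
Local Notation chY := (@children R d2 Psi k' K').

Lemma count_flatten (A B : eqType) (F : A -> seq B) (l : seq A) (y : B) :
  count_mem y (flatten (map F l)) = (\sum_(x <- l) count_mem y (F x))%N.
Proof. by elim: l => [|x l IH]; rewrite ?big_nil// big_cons /= count_cat IH. Qed.

Lemma sum_count (A : finType) (l : seq A) (F : A -> nat) :
  (\sum_(x <- l) F x = \sum_x count_mem x l * F x)%N.
Proof.
elim: l => [|y l IH]; first by rewrite big_nil big1.
rewrite big_cons IH /= [RHS](eq_bigr (fun x => (y == x) * F x + count_mem x l * F x)%N); last first.
  by move=> x _; rewrite mulnDl.
rewrite big_split /= [in RHS](bigD1 y)//= eqxx mul1n [X in (_ + X + _)%N]big1 ?addn0// => x /negPf xy.
by rewrite eq_sym xy.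
Qed.

Lemma perm_count (A : eqType) (l1 l2 : seq A) :
  (forall x, count_mem x l1 = count_mem x l2) -> perm_eq l1 l2.
Proof. by move=> H; apply/allP => x _; apply/eqP/H. Qed.

(** For the matrices [A] and [B] of [chX] and [chY], the product of a right eigenvector
    of [B] with a left eigenvector of [A] for the same eigenvalue solves
    [N A = B N]. This is a rational linear system, so it has a solution in natural
    numbers with the same support; the bag of [y] contains [N (y, t)] copies
    of [t]. *)
Lemma bags (i : vertex Phi) : exists bag : TY -> seq TX, (forall y, bag y != [::]) /\
  forall y, perm_eq (flatten (map chX (bag y))) (flatten (map bag (chY y))).
Proof.
pose A (t t' : TX) := count_mem t' (chX t); pose B (y y' : TY) := count_mem y' (chY y).
pose G (p q : TY * TX) : rat :=
  (p.1 == q.1)%:R * (A p.2 q.2)%:R - (p.2 == q.2)%:R * (B q.1 p.1)%:R.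
pose x (p : TY * TX) := right_weight b h p.1 * left_weight k b g p.2.
have rw0 (y : TY) : 0 < right_weight b h y by rewrite mulr_gt0// exprn_gt0.
have [||N [Npos NG]] := @nat_solution R _ _ G x.
- move=> p; apply: mulr_ge0; first exact: ltW (rw0 _).
  by apply: left_weight_ge0 => // i'; exact: ltW.
- move=> [y t] /=.
  under eq_bigr do rewrite /G rmorphB !rmorphM /= !ratr_nat mulrBr.
  rewrite sumrB.
  rewrite -(pair_bigA _ (fun y' t' => x (y', t') * ((y' == y)%:R * (A t' t)%:R))) /=.
  rewrite -(pair_bigA _ (fun y' t' => x (y', t') * ((t' == t)%:R * (B y y')%:R))) /=.
  rewrite (bigD1 y)//= [X in _ + X - _]big1 ?addr0; last first.
    by move=> y' /negPf yy'; apply: big1 => t' _; rewrite yy' mul0r mulr0.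
  rewrite [X in _ - X](exchange_big_dep xpredT)//= [X in _ - X](bigD1 t)//=.
  rewrite [X in _ - (_ + X)]big1 ?addr0; last first.
    by move=> t' /negPf tt'; apply: big1 => y' _; rewrite tt' mul0r mulr0.
  under eq_bigr do rewrite eqxx mul1r /x /= -mulrA.
  rewrite -mulr_sumr (left_weightP k_gt0 k_le b_gt0 gP).
  under [X in _ - X]eq_bigr do rewrite eqxx mul1r /x /= mulrAC.
  rewrite -mulr_suml.
  have -> : \sum_y' right_weight b h y' * (B y y')%:R = b^-1 * right_weight b h y.
    rewrite -(right_weightP k'_gt0 k'_le b_gt0 hP) /B.
    elim: (chY y) => [|z l IH]; first by rewrite big_nil big1// => y' _; rewrite mulr0.
    rewrite big_cons -IH /= (eq_bigr (fun y' => right_weight b h y' * (z == y')%:R +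
      right_weight b h y' * (count_mem y' l)%:R)); last by move=> y' _; rewrite natrD mulrDr.
    rewrite big_split /= [in LHS](bigD1 z)//= eqxx mulr1 [X in _ + X + _]big1 ?addr0// => y' /negPf yz.
    by rewrite eq_sym yz mulr0.
  by rewrite mulrCA mulrA subrr.
have Neq y t : (\sum_t' N (y, t') * A t' t = \sum_y' B y y' * N (y', t))%N.
  apply/eqP; rewrite -(eqr_nat rat) !natr_sum -subr_eq0.
  apply/eqP; rewrite -[RHS](NG (y, t)).
  have Npair p : N p = N (p.1, p.2) by case: p.
  under [RHS]eq_bigr => p _ do rewrite Npair /G mulrBr.
  rewrite sumrB.
  rewrite -(pair_bigA _ (fun y' t' => (N (y', t'))%:R * ((y' == y)%:R * (A t' t)%:R))) /=.
  rewrite -(pair_bigA _ (fun y' t' => (N (y', t'))%:R * ((t' == t)%:R * (B y y')%:R))) /=.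
  congr (_ - _).
    rewrite [RHS](bigD1 y)//= [X in _ = _ + X]big1 ?addr0; last first.
      by move=> y' /negPf yy'; apply: big1 => t' _; rewrite yy' mul0r mulr0.
    by apply: eq_bigr => t' _; rewrite eqxx mul1r natrM.
  rewrite [RHS](exchange_big_dep xpredT)//= [RHS](bigD1 t)//= [X in _ = _ + X]big1 ?addr0; last first.
    by move=> t' /negPf tt'; apply: big1 => y' _; rewrite tt' mul0r mulr0.
  by apply: eq_bigr => y' _; rewrite eqxx mul1r natrM mulrC.
pose bag (y : TY) := flatten [seq nseq (N (y, t)) t | t <- enum {: TX}].
have bagE y t : count_mem t (bag y) = N (y, t).
  rewrite count_flatten big_enum_cond /= (bigD1 t)//= count_nseq /= eqxx mul1n big1 ?addn0//.
  by move=> t' /negPf tt'; rewrite count_nseq /= tt'.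
exists bag; split => y.
  have : (0 < N (y, (i, ord0)))%N.
    by rewrite Npos /x /= mulr_gt0// left_weight0.
  by rewrite -bagE; apply: contraTneq => ->.
apply: perm_count => t; rewrite !count_flatten [LHS]sum_count [RHS]sum_count.
rewrite (eq_bigr _ (fun t' _ => congr1 (fun n => n * A t' t)%N (bagE y t'))) Neq.
by apply: eq_bigr => y' _; rewrite bagE.
Qed.

End Bags.

Section Eigenvectors.
Variables (R : realType) (d : nat) (Phi : gdifs R d).
Variables (s : R) (h : vertex Phi -> R).
Hypothesis s_gt0 : 0 < s.
Hypothesis conn : strongly_connected Phi.
Hypothesis h_gt0 : forall i, 0 < h i.
Hypothesis hP : forall i, \sum_(e | src e == i) ratio e `^ s * h (tgt e) = h i.

(** The reversed graph has a positive eigenvector [g]; pairing it with [h] shows that its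
    eigenvalue is 1 as well. *)
Lemma left_eigenvector : exists2 g : vertex Phi -> R, (forall i, 0 < g i) &
  forall i, \sum_(e | tgt e == i) ratio e `^ s * g (src e) = g i.
Proof.
have [[e0 _] cn] := conn.
have a0 (e : edge Phi) : 0 < ratio e `^ s by rewrite powR_gt0 ?ratio_gt0.
have [||g [lam [g0 lam0 gP]]] := @perron_frobenius R _ _ (@tgt _ _ Phi) (@src _ _ Phi) _ a0.
- move=> i j; rewrite (@eq_connect _ _ [rel i j | adjacent (Phi := Phi) j i]) => [|i' j'].
    by rewrite connect_rev; exact: cn.
  by rewrite /= /adjacent; apply: eq_existsb => e; rewrite andbC.
- exact: inhabits e0.
suff lam1 : lam = 1.
  by exists g => // i; have := gP i; rewrite lam1 mul1r.
have S0 : 0 < \sum_i g i * h i.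
  rewrite (bigD1 (src e0))//= ltr_pwDl ?mulr_gt0//.
  by apply: sumr_ge0 => i _; rewrite mulr_ge0 ?ltW.
apply: (mulIf (lt0r_neq0 S0)); rewrite mul1r mulr_sumr.
rewrite [LHS](eq_bigr (fun i => \sum_(e | tgt e == i) ratio e `^ s * g (src e) * h (tgt e))); last first.
  move=> i _; rewrite mulrA -gP /trans mulr_suml; apply: eq_bigr => e /eqP <-.
  by [].
rewrite [RHS](eq_bigr (fun i => \sum_(e | src e == i) ratio e `^ s * g (src e) * h (tgt e))); last first.
  move=> i _; rewrite -[in LHS]hP mulr_sumr; apply: eq_bigr => e /eqP <-.
  by rewrite mulrCA mulrA.
rewrite (exchange_big_dep xpredT)//= [RHS](exchange_big_dep xpredT)//=.
apply: eq_bigr => e _.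
rewrite (big_pred1 (tgt e)) => [|i]; last by rewrite eq_sym.
by rewrite (big_pred1 (src e)) => [//|i]; rewrite eq_sym.
Qed.

(** At a vertex where [h] is largest, a single outgoing edge would make [h]
    even larger at its target. *)
Lemma branching_vertex : exists e1 e2 : edge Phi, src e1 = src e2 /\ e1 <> e2.
Proof.
have [[e0 _] _] := conn.
pose i := [arg max_(i > src e0) h i]%O.
have imax j : h j <= h i by rewrite /i; case: arg_maxP => // m _; apply.
have [e1 ei] : exists e, src e == i.
  apply: contrapT => /forallNP ne; have := h_gt0 i; rewrite -hP big_pred0 ?ltxx// => e.
  by apply/negP/ne.
apply: contrapT => nb; have := hP i; rewrite (big_pred1 e1) => [he|e]; last first.
  apply/idP/eqP => [se|->//]; apply: contrapT => ee; apply: nb; exists e, e1.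
  by rewrite (eqP se) (eqP ei).
have : ratio e1 `^ s * h (tgt e1) < h (tgt e1).
  rewrite gtr_pMl// powR_expE ?ratio_gt0// -[ltRHS]expR0 ltr_expR pmulr_rlt0//.
  by rewrite ln_lt0// ratio_itv.
by rewrite he ltNge imax.
Qed.

End Eigenvectors.

(** * Pieces of the source and of the target *)

Lemma uniq_flatten_map (A B : eqType) (F : A -> seq B) (l : seq A) :
  uniq l -> (forall x, x \in l -> uniq (F x)) ->
  (forall x x' y, x \in l -> x' \in l -> y \in F x -> y \in F x' -> x = x') ->
  uniq (flatten (map F l)).
Proof.
elim: l => //= x l IH /andP[xl ul] uF disj; rewrite cat_uniq uF ?mem_head//=.
rewrite IH// => [|z zl|z z' y zl z'l]; first last.
- by apply: disj; rewrite inE ?zl ?z'l orbT.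
- by apply: uF; rewrite inE zl orbT.
rewrite andbT; apply/hasPn => y /flattenP[_ /mapP[x' x'l ->] yx'].
apply/negP => yx; move: xl; rewrite (disj x x' y) ?mem_head ?inE ?x'l ?orbT//.
Qed.

Section Pieces.
Variables (R : realType) (d : nat) (Phi : gdifs R d).
Local Notation V := (vertex Phi).
Local Notation E := (edge Phi).
Variable K : V -> set 'rV[R]_d.
Hypotheses (attr : attractors K) (dust : dust_like Phi).
Variables (theta : R) (p : V -> R) (k : E -> nat) (N : nat).
Hypotheses (hom : homogeneous Phi theta p k) (k_le : forall e, (k e <= N)%N).

Local Notation piece := (seq E * 'I_N.+1)%type.
Implicit Types (i : V) (a b c : piece).

Definition ptype i b : V * 'I_N.+1 := (endv i b.1, b.2).

Definition kids i b : seq piece :=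
  if b.2 == ord0 then [seq (rcons b.1 e, inord (k e).-1) | e <- enum E & src e == endv i b.1]
  else [:: (b.1, inord b.2.-1)].

(** [r] is the scale of the generation of [b]: passing to [kids] multiplies it by
    [theta], both when a delay is used up and when an edge is appended. *)
Definition scale i b (r : R) := wr b.1 * p (endv i b.1) = r * theta ^+ b.2.

Local Notation cyl := (cyl K).

Lemma ptype_kids i b : map (ptype i) (kids i b) = children k (ptype i b).
Proof.
rewrite /kids /children /=; case: eqP => // _.
rewrite -map_comp; apply: eq_map => e /=.
by rewrite /ptype /= endv_rcons.
Qed.

Lemma kidsP i b c : walk i b.1 -> c \in kids i b ->
  [/\ walk i c.1, cyl i c.1 `<=` cyl i b.1 & forall r, scale i b r -> scale i c (r * theta)].
Proof.
move=> wb; rewrite /kids; case: eqP => [b0|/eqP b0].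
  move=> /mapP[e]; rewrite mem_filter => /andP[/eqP se _] ->.
  split => [||r] /=.
  - by rewrite walk_rcons wb se eqxx.
  - exact: cyl_rcons_sub.
  - rewrite /scale /= b0 expr0 mulr1 wr_rcons endv_rcons -mulrA (hom.2 e).2 se.
    have k0 := (hom.2 e).1; have kN := k_le e.
    rewrite inordK; last by rewrite (leq_ltn_trans (leq_pred _)).
    by rewrite mulrCA => ->; rewrite -{1}(prednK k0) exprS; ring.
rewrite inE => /eqP ->; split => //= r; rewrite /scale /= => ->.
rewrite inordK; last by rewrite (leq_ltn_trans (leq_pred _)).
by rewrite -mulrA -exprS prednK// lt0n.
Qed.

Lemma kids_cover i b x : cyl i b.1 x -> exists2 c, c \in kids i b & cyl i c.1 x.
Proof.
move=> bx; rewrite /kids; case: eqP => _.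
  have [e se ex] := cyl_child attr bx.
  exists (rcons b.1 e, inord (k e).-1) => //.
  by apply/mapP; exists e => //; rewrite mem_filter se eqxx mem_enum.
by exists (b.1, inord b.2.-1) => //; rewrite mem_head.
Qed.

Lemma uniq_kids i b : uniq (kids i b).
Proof.
rewrite /kids; case: ifP => // _.
rewrite map_inj_uniq; first exact/filter_uniq/enum_uniq.
by move=> e e' [/rcons_inj[]].
Qed.

Definition disjoint_pieces i (B : seq piece) := [/\ all (fun b => walk i b.1) B, uniq B &
  forall b b' x, b \in B -> b' \in B -> cyl i b.1 x -> cyl i b'.1 x -> b = b'].

Lemma kids_disjoint i b c c' x : walk i b.1 -> c \in kids i b -> c' \in kids i b ->
  cyl i c.1 x -> cyl i c'.1 x -> c = c'.
Proof.
move=> wb; rewrite /kids; case: ifP => _; last by rewrite !inE => /eqP -> /eqP ->.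
move=> /mapP[e]; rewrite mem_filter => /andP[se _] ->.
move=> /mapP[e']; rewrite mem_filter => /andP[se' _] -> /= ex e'x.
have w1 : walk i (rcons b.1 e) by rewrite walk_rcons wb.
have w2 : walk i (rcons b.1 e') by rewrite walk_rcons wb.
have [|u] := cyl_comparable attr dust w1 w2 ex e'x; first by rewrite !size_rcons.
move=> /[dup] /(congr1 size)/eqP; rewrite size_cat !size_rcons -[eqbLHS]addn0 eqn_add2l.
by rewrite eq_sym => /nilP -> /[!cats0] /rcons_inj[->].
Qed.

Lemma disjoint_kids i B : disjoint_pieces i B ->
  disjoint_pieces i (flatten (map (kids i) B)).
Proof.
move=> [/allP wB uB dB].
have inj b b' c : b \in B -> b' \in B -> c \in kids i b -> c \in kids i b' -> b = b'.
  move=> bB b'B cb cb'; have [y cy] := cyl_neq0 attr i c.1.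
  have [_ s1 _] := kidsP (wB b bB) cb; have [_ s2 _] := kidsP (wB b' b'B) cb'.
  by apply: (dB b b' y) => //; [exact: s1|exact: s2].
split.
- apply/allP => c /flattenP[_ /mapP[b bB ->] cb].
  by have [] := kidsP (wB b bB) cb.
- by apply: uniq_flatten_map => // b _; exact: uniq_kids.
- move=> c c' x /flattenP[_ /mapP[b bB ->] cb] /flattenP[_ /mapP[b' b'B ->] cb'] cx c'x.
  have [_ s1 _] := kidsP (wB b bB) cb; have [_ s2 _] := kidsP (wB b' b'B) cb'.
  have bb' : b = b' by apply: (dB b b' x) => //; [exact: s1|exact: s2].
  rewrite -bb' in cb'.
  exact: (kids_disjoint (wB b bB) cb cb' cx c'x).
Qed.

Lemma disjoint_perm i B B' : perm_eq B B' -> disjoint_pieces i B -> disjoint_pieces i B'.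
Proof.
move=> pB [wB uB dB]; split.
- by rewrite -(perm_all _ pB).
- by rewrite -(perm_uniq pB).
- by move=> b b' x; rewrite -!(perm_mem pB); exact: dB.
Qed.

Hypothesis conn : strongly_connected Phi.

(** The pieces branch off one after the other at a vertex with two outgoing edges: one
    edge leads to the next piece, the other one to all later pieces. *)
Lemma exist_disjoint_pieces (e1 e2 : E) : src e1 = src e2 -> e1 <> e2 ->
  forall (ts : seq (V * 'I_N.+1)) i, exists2 B, map (ptype i) B = ts & disjoint_pieces i B.
Proof.
move=> se ee; elim=> [|t ts IH] i; first by exists [::].
have [u [wu eu]] := strongly_connected_walk conn i (src e1).
have [u1 [wu1 eu1]] := strongly_connected_walk conn (tgt e1) t.1.
have [B tB [wB uB dB]] := IH (tgt e2).
pose ext (b : piece) : piece := (rcons u e2 ++ b.1, b.2).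
have eue2 : endv i (rcons u e2) = tgt e2 by rewrite endv_rcons.
have wue2 : walk i (rcons u e2) by rewrite walk_rcons wu eu se eqxx.
have wue1 : walk i (rcons u e1) by rewrite walk_rcons wu eu eqxx.
have apart b x : b \in B -> cyl i (rcons u e1 ++ u1) x -> ~ cyl i (ext b).1 x.
  move=> bB x1 x2.
  have {}x1 : cyl i (rcons u e1) x by apply: cyl_sub x1; rewrite ?endv_rcons.
  have {}x2 : cyl i (rcons u e2) x.
    by apply: cyl_sub x2; rewrite ?endv_rcons//; exact: (allP wB).
  have [|u' ] := cyl_comparable attr dust wue1 wue2 x1 x2; first by rewrite !size_rcons.
  move=> /[dup] /(congr1 size)/eqP; rewrite size_cat !size_rcons -[eqbLHS]addn0 eqn_add2l.
  by rewrite eq_sym => /nilP -> /[!cats0] /rcons_inj[] /esym.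
exists ((rcons u e1 ++ u1, t.2) :: map ext B).
  rewrite /= /ptype /= endv_cat endv_rcons eu1 -surjective_pairing; congr (_ :: _).
  rewrite -tB -map_comp; apply: eq_map => b /=.
  by rewrite /ptype /= endv_cat eue2.
split.
- rewrite /= walk_cat wue1 endv_rcons wu1 /=; apply/allP => _ /mapP[b bB ->] /=.
  by rewrite walk_cat wue2 eue2; exact: (allP wB).
- rewrite /= map_inj_uniq ?uB ?andbT; last first.
    move=> [w l] [w' l'] [/eqP]; rewrite eqseq_cat// eqxx /= => /eqP -> -> //.
  apply/negP => /mapP[b bB] [uE _].
  have [x bx] := cyl_neq0 attr i (ext b).1.
  by apply: (apart b x bB) => //; rewrite uE.
- move=> b b' x; rewrite !inE => /orP[/eqP ->|/mapP[c cB ->]] /orP[/eqP ->|/mapP[c' c'B ->]] //=.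
  + by move=> x1 x2; exfalso; exact: (apart c' x).
  + by move=> x1 x2; exfalso; exact: (apart c x).
  + rewrite !cyl_cat eue2 => -[y cy <-] [y' cy' /wmap_inj yy'].
    by rewrite (dB c c' y) // -yy'.
Qed.

End Pieces.

Arguments ptype {R d Phi N} i b.
Arguments kids {R d Phi} k {N} i b.
Arguments scale {R d Phi} theta p {N} i b r.

(** * Commensurability is sufficient *)

Lemma perm_flatten_map (A B : eqType) (F : A -> seq B) (l l' : seq A) :
  perm_eq l l' -> perm_eq (flatten (map F l)) (flatten (map F l')).
Proof.
by move=> pl; apply: perm_count => y; rewrite !count_flatten; exact: perm_big.
Qed.

Lemma perm_flatten_eq (A B : eqType) (F G : A -> seq B) (l : seq A) :
  (forall x, x \in l -> perm_eq (F x) (G x)) ->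
  perm_eq (flatten (map F l)) (flatten (map G l)).
Proof.
elim: l => //= x l IH FG; apply: perm_cat; first exact/FG/mem_head.
by apply: IH => y yl; apply: FG; rewrite inE yl orbT.
Qed.

Lemma flatten_map_flatten (A B C : Type) (F : A -> seq B) (G : B -> seq C) (l : seq A) :
  flatten (map G (flatten (map F l))) = flatten (map (fun x => flatten (map G (F x))) l).
Proof. by elim: l => //= x l IH; rewrite map_cat flatten_cat IH. Qed.

Lemma zip_map_eq (A B C : eqType) (F : A -> C) (G : B -> C) (l : seq A) (l' : seq B) :
  map F l = map G l' -> forall x, x \in zip l' l -> F x.2 = G x.1.
Proof.
elim: l l' => [|a l IH] [|b l'] //= [ab ll'] x.
by rewrite inE => /orP[/eqP -> //|]; exact: IH.
Qed.

Lemma snd_zip (A B : Type) (l : seq A) (l' : seq B) : size l = size l' ->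
  map snd (zip l' l) = l.
Proof. by move=> sl; exact: (unzip2_zip (eq_leq sl)). Qed.

Section Construction.
Variables (R : realType) (d1 d2 : nat) (Phi : gdifs R d1) (Psi : gdifs R d2).
Variables (K : vertex Phi -> set 'rV[R]_d1) (L : vertex Psi -> set 'rV[R]_d2).
Hypotheses (attrK : attractors K) (attrL : attractors L).
Hypotheses (dustK : dust_like Phi) (dustL : dust_like Psi).
Variables (i0 : vertex Phi) (j0 : vertex Psi).
Variables (theta : R) (p : vertex Phi -> R) (k : edge Phi -> nat)
  (p' : vertex Psi -> R) (k' : edge Psi -> nat) (N N' : nat).
Hypothesis theta_itv : 0 < theta < 1.
Hypotheses (hom : homogeneous Phi theta p k) (hom' : homogeneous Psi theta p' k').
Hypotheses (k_le : forall e, (k e <= N)%N) (k'_le : forall e, (k' e <= N')%N).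
Variable bag : vertex Psi * 'I_N'.+1 -> seq (vertex Phi * 'I_N.+1).
Hypothesis bag_neq0 : forall y, bag y != [::].
Hypothesis bagP : forall y,
  perm_eq (flatten (map (children k) (bag y))) (flatten (map bag (children k' y))).

Local Notation pieceX := (seq (edge Phi) * 'I_N.+1)%type.
Local Notation pieceY := (seq (edge Psi) * 'I_N'.+1)%type.
Local Notation state := (pieceY * seq pieceX)%type.
Local Notation cX := (cyl K i0).
Local Notation cY := (cyl L j0).
Implicit Types (sg : state).

Let theta_gt0 : 0 < theta. Proof. by case/andP: theta_itv. Qed.

Variables (a0 a1 : R).
Hypotheses (a0_gt0 : 0 < a0) (a1_gt0 : 0 < a1).

(** The invariant of the simultaneous subdivision of source and target; [r] is only
    bounded below because the initial pieces of the source may have different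
    sizes. *)
Definition matched n sg := [/\ walk j0 sg.1.1, scale theta p' j0 sg.1 (a1 * theta ^+ n),
  perm_eq (map (ptype i0) sg.2) (bag (ptype j0 sg.1)) &
  forall b, b \in sg.2 -> walk i0 b.1 /\
    exists2 r, a0 * theta ^+ n <= r & scale theta p i0 b r].

(** By [bagP] the children of the bag of a piece have the types of all the bags of its
    children together, so they can be distributed among these. *)
Lemma matched_step n sg : matched n sg -> exists l : seq state,
  [/\ map fst l = kids k' j0 sg.1,
   perm_eq (flatten (map snd l)) (flatten (map (kids k i0) sg.2)) &
   forall sg', sg' \in l -> matched n.+1 sg'].
Proof.
case: sg => y B [/= wy sy pB BP].
have pC : perm_eq (map (ptype i0) (flatten (map (kids k i0) B)))
    (flatten (map (fun z => bag (ptype j0 z)) (kids k' j0 y))).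
  rewrite map_flatten -map_comp.
  rewrite (eq_map (g := fun b => children k (ptype i0 b))); last first.
    by move=> b /=; rewrite (ptype_kids k).
  rewrite (map_comp (children k) (ptype i0)) (perm_trans (perm_flatten_map _ pB))//.
  rewrite (perm_trans (bagP _))// -(ptype_kids k') -map_comp perm_refl//.
have [Cs pCs mCs] := split_perm pC.
have sCs : size Cs = size (kids k' j0 y) by have := congr1 size mCs; rewrite !size_map.
exists (zip (kids k' j0 y) Cs); split.
- by rewrite [map _ _]unzip1_zip// sCs.
- by rewrite snd_zip.
move=> sg' sg'l; have /= tE := zip_map_eq mCs sg'l.
have y'k : sg'.1 \in kids k' j0 y.
  have : sg'.1 \in unzip1 (zip (kids k' j0 y) Cs) by exact: map_f.
  by rewrite unzip1_zip// sCs.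
have B'k : sg'.2 \in Cs.
  have : sg'.2 \in unzip2 (zip (kids k' j0 y) Cs) by exact: map_f.
  by rewrite unzip2_zip// sCs.
have [wy' _ sy'] := kidsP attrL hom' k'_le wy y'k.
split => //.
- by rewrite exprSr mulrA; exact: sy'.
- by rewrite tE perm_refl.
move=> c cB'; have : c \in flatten (map (kids k i0) B).
  by rewrite -(perm_mem pCs); apply/flattenP; exists sg'.2.
move=> /flattenP[_ /mapP[b bB ->] cb]; have [wb [r rn sb]] := BP b bB.
have [wc _ sc] := kidsP attrK hom k_le wb cb.
split => //; exists (r * theta); last exact: sc.
by rewrite exprSr mulrA ler_pM2r.
Qed.

Variables (B0 : seq pieceX).
Hypothesis B0_disj : disjoint_pieces K i0 B0.
Hypothesis B0_matched : matched 0 (([::], ord0), B0).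

Definition bag_union (B : seq pieceX) : set 'rV[R]_d1 := [set x | exists2 b, b \in B & cX b.1 x].

Lemma bag_union_compact B : compact (bag_union B).
Proof.
rewrite (_ : bag_union B = \big[setU/set0]_(b <- B) cX b.1).
  by apply: bigsetU_compact => b _; exact: cyl_compact.
elim: B => [|b B IH].
  by rewrite big_nil; apply/seteqP; split => x //= -[].
rewrite big_cons -IH; apply/seteqP; split => x /=.
  by move=> [c]; rewrite inE => /orP[/eqP ->|cB] cx; [left|right; exists c].
by move=> [bx|[c cB cx]]; [exists b => //; exact: mem_head|exists c; rewrite ?inE ?cB ?orbT].
Qed.

(** [P n] lists the matched pairs of generation [n], which are the nodes for
    [tree_map]. *)
Lemma map_of_bag_union : exists f : 'rV[R]_d1 -> 'rV[R]_d2,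
  lipschitz_in (bag_union B0) f /\ f @` bag_union B0 = L j0.
Proof.
have /choice[st stP] : forall a : nat * state, exists l : seq state, matched a.1 a.2 ->
  [/\ map fst l = kids k' j0 a.2.1,
   perm_eq (flatten (map snd l)) (flatten (map (kids k i0) a.2.2)) &
   forall sg', sg' \in l -> matched a.1.+1 sg'].
  move=> [n sg]; case: (pselect (matched n sg)) => [/matched_step[l lP]|]; first by exists l.
  by exists [::].
pose P := fix P n := if n is m.+1 then flatten (map (fun sg => st (m, sg)) (P m))
  else [:: (([::], ord0), B0) : state].
have PM n sg : sg \in P n -> matched n sg.
  elim: n sg => [|n IH] sg; first by rewrite inE => /eqP ->.
  move=> /flattenP[_ /mapP[sg0 sg0P ->] sgst].
  by have [_ _] := stP (n, sg0) (IH _ sg0P); apply.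
pose allX n := flatten (map snd (P n)).
have allXd n : disjoint_pieces K i0 (allX n).
  elim: n => [|n IH]; first by rewrite /allX /= cats0.
  have := disjoint_kids attrK dustK hom k_le IH; apply: disjoint_perm.
  rewrite perm_sym /allX /= !flatten_map_flatten; apply: perm_flatten_eq => sg sgP.
  by have [] := stP (n, sg) (PM _ _ sgP).
have allX_in n sg b : sg \in P n -> b \in sg.2 -> b \in allX n.
  by move=> sgP bsg; apply/flattenP; exists sg.2 => //; exact: map_f.
have same n sg sg' x : sg \in P n -> sg' \in P n -> bag_union sg.2 x -> bag_union sg'.2 x -> sg = sg'.
  move=> sgP sg'P [b bsg bx] [b' b'sg b'x].
  have [_ uX dX] := allXd n.
  have bb' : b = b' by apply: (dX b b' x) => //; [exact: allX_in bsg|exact: allX_in b'sg].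
  rewrite -bb' in b'sg; move: uX sgP sg'P; rewrite /allX.
  elim: (P n) => //= a l IH; rewrite cat_uniq => /and3P[_ /hasPn nal ul].
  have notl s1 : s1 \in l -> b \in s1.2 -> b \in a.2 -> False.
    move=> s1l bs1 ba; have /nal : b \in flatten (map snd l).
      by apply/flattenP; exists s1.2 => //; exact: map_f.
    by rewrite ba.
  rewrite !inE => /orP[/eqP e1|sl] /orP[/eqP e2|s'l]; first by rewrite e1 e2.
  - by exfalso; apply: (notl sg') => //; rewrite -e1.
  - by exfalso; apply: (notl sg) => //; rewrite -e2.
  - exact: IH.
have [D D0 DP] := diam_bound attrL.
have [g g0 gP] := sep_bound attrK dustK.
have [pm pm0 pmP] := fin_pos_upper p.
have [pl pl0 plP] := fin_pos_lower hom'.1.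
pose node n U J := exists2 sg, sg \in P n & U = bag_union sg.2 /\ J = cY sg.1.1.
have thN : 0 < theta ^+ N by rewrite exprn_gt0.
have th1 : theta <= 1 by case/andP: theta_itv => _ /ltW.
have child_sub n sg sg' : sg \in P n -> sg' \in st (n, sg) ->
    [/\ sg' \in P n.+1, bag_union sg'.2 `<=` bag_union sg.2 & cY sg'.1.1 `<=` cY sg.1.1].
  move=> sgP sgst; have Msg := PM _ _ sgP.
  have [e1 e2 e3] := stP (n, sg) Msg; have [/= wy _ _ BP] := Msg.
  split.
  - by apply/flattenP; exists (st (n, sg)) => //; exact: map_f.
  - move=> x [c csg cx]; have : c \in flatten (map (kids k i0) sg.2).
      by rewrite -(perm_mem e2); apply/flattenP; exists sg'.2 => //; exact: map_f.
    move=> /flattenP[_ /mapP[b bB ->] cb]; exists b => //.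
    by have [_ + _] := kidsP attrK hom k_le (BP b bB).1 cb; apply.
  - have : sg'.1 \in kids k' j0 sg.1 by rewrite -e1; exact: map_f.
    by move=> /(kidsP attrL hom' k'_le wy)[].
apply: (@tree_map _ _ _ (bag_union B0) (L j0) node theta (g * (a0 * theta ^+ N / pm)) (D * (a1 / pl))) => //.
- by rewrite mulr_gt0// divr_gt0// mulr_gt0.
- by rewrite mulr_gt0// divr_gt0.
- by exists (([::], ord0), B0); rewrite ?mem_head// cyl_nil.
- move=> n _ _ _ _ x [sg sgP [-> ->]] [sg' sg'P [-> ->]] sx s'x.
  by rewrite (same n sg sg' x).
- move=> n _ _ x x' [sg sgP [-> _]] [b bsg bx] [b0 b0B b0x'] nx'.
  have [_ _ _ /(_ b bsg)[wb [r rn sb]]] := PM _ _ sgP.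
  have [/allP w0 _ _] := B0_disj.
  apply: (@le_trans _ _ (g * wr b.1)); last first.
    apply: (gP i0) => //; first exact: (cyl_subK attrK (w0 _ b0B) b0x').
    by move=> bx'; apply: nx'; exists b.
  rewrite -[leLHS]mulrA ler_pM2l// mulrAC ler_pdivrMr//.
  apply: (@le_trans _ _ (wr b.1 * p (endv i0 b.1))); last first.
    by rewrite ler_pM2l ?wr_gt0.
  rewrite sb mulrAC; apply: ler_pM => //; rewrite ?mulr_ge0 ?exprn_ge0 ?(ltW a0_gt0) ?(ltW theta_gt0)//.
  by rewrite ler_wiXn2l ?(ltW theta_gt0)// -ltnS.
- move=> n _ _ y y' [sg sgP [_ ->]] cy cy'.
  have [_ sy _ _] := PM _ _ sgP.
  apply: le_trans (DP _ _ _ _ cy cy') _.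
  rewrite -[leRHS]mulrA ler_pM2l// mulrAC ler_pdivlMr//.
  apply: (@le_trans _ _ (wr sg.1.1 * p' (endv j0 sg.1.1))).
    by rewrite ler_pM2l ?wr_gt0.
  rewrite sy ger_pMr ?mulr_gt0 ?exprn_gt0//.
  by rewrite exprn_ile1// ltW.
- move=> n _ _ x [sg sgP [-> ->]] [b bsg bx].
  have [e1 e2 e3] := stP (n, sg) (PM _ _ sgP).
  have [c cb cx] := kids_cover attrK k bx.
  have : c \in flatten (map snd (st (n, sg))).
    by rewrite (perm_mem e2); apply/flattenP; exists (kids k i0 b) => //; exact: map_f.
  move=> /flattenP[_ /mapP[sg' sgst ->] csg'].
  have [h1 h2 h3] := child_sub n sg sg' sgP sgst.
  exists (bag_union sg'.2), (cY sg'.1.1); split => //; first by exists sg'.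
  by exists c.
- move=> n _ _ y [sg sgP [-> ->]] cy.
  have [e1 e2 e3] := stP (n, sg) (PM _ _ sgP).
  have [z zk zy] := kids_cover attrL k' cy.
  have : z \in map fst (st (n, sg)) by rewrite e1.
  move=> /mapP[sg' sgst zE].
  have [h1 h2 h3] := child_sub n sg sg' sgP sgst.
  exists (bag_union sg'.2), (cY sg'.1.1); split => //; first by exists sg'.
  by rewrite -zE.
- move=> n _ _ [sg sgP [-> ->]]; split.
  + exact: bag_union_compact.
  + exact: cyl_compact.
  + have [_ _ pB _] := PM _ _ sgP; case B2: (sg.2) pB => [|b B].
      by move=> /perm_size/esym/eqP; rewrite size_eq0 (negPf (bag_neq0 _)).
    by move=> _; have [x bx] := cyl_neq0 attrK i0 b.1; exists x, b => //; exact: mem_head.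
  + exact: cyl_neq0.
Qed.

(** The bags cover a relatively open and compact part of [K i0]; sending the rest to one
    point keeps the map Lipschitz. *)
Lemma lipschitz_extension : exists f : 'rV[R]_d1 -> 'rV[R]_d2,
  lipschitz_in (K i0) f /\ f @` K i0 = L j0.
Proof.
have [f [[l l0 lP] fU]] := map_of_bag_union.
have [/allP wB _ _] := B0_disj.
have UK : bag_union B0 `<=` K i0.
  by move=> x [b bB bx]; exact: (cyl_subK attrK (wB b bB) bx).
have [D D0 DP] := diam_bound attrL.
have [g g0 gP] := sep_bound attrK dustK.
have [y0 Ly0] := K_neq0 attrL j0.
have [m m0 mP] : exists2 m : R, 0 < m & forall b, b \in B0 -> m <= wr b.1.
  elim: (B0) => [|b B [m m0 mP]]; first by exists 1.
  exists (Num.min m (wr b.1)); first by rewrite lt_min m0 wr_gt0.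
  move=> c; rewrite inE => /orP[/eqP ->|/mP cm]; rewrite ge_min ?lexx ?orbT//.
  by rewrite cm.
pose f' x := if `[< bag_union B0 x >] then f x else y0.
have f'in x : bag_union B0 x -> f' x = f x by move=> Ux; rewrite /f' asboolT.
have f'out x : ~ bag_union B0 x -> f' x = y0 by move=> Ux; rewrite /f' asboolF.
have fL x : bag_union B0 x -> L j0 (f x) by move=> Ux; rewrite -fU; exists x.
have mixed x x' : bag_union B0 x -> K i0 x' -> ~ bag_union B0 x' ->
    edist (f x) y0 <= D / (g * m) * edist x x'.
  move=> Ux Kx' nUx'; have [b bB bx] := Ux.
  apply: (@le_trans _ _ D).
    have := DP j0 [::] (f x) y0; rewrite cyl_nil wr_nil mulr1; apply => //.
    exact: fL.
  rewrite mulrAC ler_pdivlMr ?mulr_gt0// ler_pM2l//.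
  apply: le_trans (gP i0 b.1 x x' (wB b bB) bx Kx' _).
    by rewrite ler_pM2l//; exact: mP.
  by move=> bx'; apply: nUx'; exists b.
have C0 : 0 <= D / (g * m) by rewrite divr_ge0 ?mulr_ge0 ?ltW.
exists f'; split.
  exists (l + D / (g * m)); first by rewrite addr_ge0.
  move=> x x' Kx Kx'; rewrite mulrDl.
  case: (pselect (bag_union B0 x)) => Ux; case: (pselect (bag_union B0 x')) => Ux'.
  - by rewrite !f'in// (le_trans (lP _ _ Ux Ux'))// lerDl mulr_ge0 ?edist_ge0.
  - rewrite f'in// f'out// (le_trans (mixed _ _ Ux Kx' Ux'))// lerDr.
    by rewrite mulr_ge0 ?edist_ge0.
  - rewrite f'out// f'in// edistC (edistC x) (le_trans (mixed _ _ Ux' Kx Ux))// lerDr.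
    by rewrite mulr_ge0 ?edist_ge0.
  - by rewrite !f'out// edistxx; apply: addr_ge0; apply: mulr_ge0 => //; exact: edist_ge0.
apply/seteqP; split => [_ [x Kx <-]|y].
  case: (pselect (bag_union B0 x)) => Ux; first by rewrite f'in//; exact: fL.
  by rewrite f'out.
by rewrite -fU => -[x Ux <-]; exists x; [exact: UK|rewrite f'in].
Qed.

End Construction.

(** * The two implications *)

Lemma dimension_eigenvector (R : realType) (d : nat) (Phi : gdifs R d)
    (K : vertex Phi -> set 'rV[R]_d) (i : vertex Phi) (s : R) :
  attractors K -> dust_like Phi -> strongly_connected Phi -> 0 < s ->
  hausdorff_dim (K i) = s%:E ->
  exists2 h : vertex Phi -> R, (forall j, 0 < h j) &
    forall j, \sum_(e | src e == j) ratio e `^ s * h (tgt e) = h j.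
Proof.
move=> attr dust [[e0 _] conn] s0 dimK.
have a0 (e : edge Phi) : 0 < ratio e `^ s by rewrite powR_gt0 ?ratio_gt0.
have [h [lam [h0 lam0 eig]]] := perron_frobenius a0 conn (inhabits e0).
have lam1 := eigenvalue_eq1 attr dust h0 lam0 eig s0 dimK.
by exists h => // j; have := eig j; rewrite lam1 mul1r.
Qed.

(** Were there no cycle, [closed_walk_log] would give ratio 1 to all closed walks. *)
Lemma exists_cycle (R : realType) (d : nat) (Phi : gdifs R d) :
  strongly_connected Phi -> exists2 c, is_cycle c & 0 < wr (Phi := Phi) c < 1.
Proof.
move=> sc; have [[e0 _] _] := sc.
have wr_lt1 e (w : seq (edge Phi)) : wr (e :: w) < 1.
  rewrite wr_cons; apply: le_lt_trans (ratio_lt1 e).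
  by rewrite ger_pMr ?ratio_gt0// wr_le1.
suff [c cc] : exists c : seq (edge Phi), is_cycle c.
  exists c => //; rewrite wr_gt0 /=.
  by case: c cc => // e w _; exact: wr_lt1.
apply: contrapT => /forallNP nc.
have [w [ww we]] := strongly_connected_walk sc (tgt e0) (src e0).
have H (c : seq (edge Phi)) : is_cycle c -> exists m : int, ln (wr c) = m%:~R * 0.
  by move=> cc; exfalso; exact: (nc c).
have [||m] := closed_walk_log H (i := src e0) (w := e0 :: w) => //.
  by rewrite /= eqxx.
by rewrite mulr0 => /eqP; rewrite lt_eqF// ln_lt0// wr_gt0 wr_lt1.
Qed.

Lemma commensurable_to (R : realType) (A : set R) (theta : R) : ln theta != 0 ->
  (forall r, A r -> exists q : rat, ln r / ln theta = ratr q) -> commensurable A.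
Proof.
move=> th0 H r1 r2 /H[q1 q1E] /H[q2 q2E]; exists (q1 / q2).
by rewrite fmorph_div /= -q1E -q2E invf_div mulrA divfK.
Qed.

Lemma rational_div (R : realType) (x y z : R) (D : nat) : (0 < D)%N -> y != 0 ->
  (exists q : rat, x / y = ratr q) -> exists q : rat, x / (y / D%:R) = ratr q.
Proof.
move=> D0 y0 [q qE]; exists (q * D%:R); rewrite rmorphM /= ratr_nat -qE.
by field; rewrite y0 pnatr_eq0 -lt0n.
Qed.

Section Directions.
Variables (R : realType) (d1 d2 : nat) (Phi : gdifs R d1) (Psi : gdifs R d2).
Variables (K : vertex Phi -> set 'rV[R]_d1) (L : vertex Psi -> set 'rV[R]_d2).
Hypotheses (attrK : attractors K) (attrL : attractors L).
Hypotheses (dustK : dust_like Phi) (dustL : dust_like Psi).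
Hypotheses (connPhi : strongly_connected Phi) (connPsi : strongly_connected Psi).
Variables (i0 : vertex Phi) (j0 : vertex Psi) (s : R).
Hypothesis s_gt0 : 0 < s.
Hypotheses (dimK : hausdorff_dim (K i0) = s%:E) (dimL : hausdorff_dim (L j0) = s%:E).

(** All ratios are compared with the base [theta] of the system assumed to be
    commensurable. *)
Lemma image_commensurable (f : 'rV[R]_d1 -> 'rV[R]_d2) :
  lipschitz_in (K i0) f -> f @` K i0 = L j0 ->
  commensurable (cycle_ratios Phi) \/ commensurable (cycle_ratios Psi) ->
  commensurable (cycle_ratios Phi `|` cycle_ratios Psi).
Proof.
move=> lipf surjf comm.
have [h h0 hP] := dimension_eigenvector attrK dustK connPhi s_gt0 dimK.
have [h' h'0 h'P] := dimension_eigenvector attrL dustL connPsi s_gt0 dimL.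
have eig i : trans (@src _ _ Phi) (@tgt _ _ Phi) (fun e => ratio e `^ s) h i = 1 * h i.
  by rewrite mul1r; exact: hP.
have eig' j : trans (@src _ _ Psi) (@tgt _ _ Psi) (fun e => ratio e `^ s) h' j = 1 * h' j.
  by rewrite mul1r; exact: h'P.
have [c0 [c0i c0P]] := lip_scale attrK attrL dustL lipf surjf.
have ltheta (rho : R) (D : nat) : 0 < rho < 1 -> (0 < D)%N ->
    ln (expR (ln rho / D%:R)) = ln rho / D%:R /\ 0 < expR (ln rho / D%:R) < 1.
  move=> rho01 D0; rewrite expRK expR_gt0; split=> //=.
  by rewrite -[ltRHS]expR0 ltr_expR pmulr_llt0 ?invr_gt0 ?ltr0n// ln_lt0.
case: comm => comm.
  have [c cc c01] := exists_cycle connPhi.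
  have [D D0 DP] := homogeneous_form connPhi c01
    (fun r rP => comm r (wr c) rP (ex_intro2 _ _ c cc erefl)).
  have [p [k hom]] := DP D D0 (dvdnn D).
  have [lth th01] := ltheta _ _ c01 D0.
  have lc0 : ln (wr c) != 0 by rewrite lt_eqF// ln_lt0.
  apply: (@commensurable_to _ _ (expR (ln (wr c) / D%:R))).
    by rewrite lth mulf_neq0// invr_eq0 pnatr_eq0 -lt0n.
  move=> r [rPhi|[c' cc' <-]].
    rewrite lth; apply: rational_div => //.
    by apply: comm => //; exists c.
  have /is_cycleP[j [_ wc' ec' _]] := cc'.
  exact: (rational_target_cycle attrK attrL dustK dustL s_gt0 h0 h'0 eig eig' surjf
    c0i c0P connPsi th01 hom wc' ec').
have [c cc c01] := exists_cycle connPsi.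
have [D D0 DP] := homogeneous_form connPsi c01
  (fun r rP => comm r (wr c) rP (ex_intro2 _ _ c cc erefl)).
have [p [k hom]] := DP D D0 (dvdnn D).
have [lth th01] := ltheta _ _ c01 D0.
have lc0 : ln (wr c) != 0 by rewrite lt_eqF// ln_lt0.
apply: (@commensurable_to _ _ (expR (ln (wr c) / D%:R))).
  by rewrite lth mulf_neq0// invr_eq0 pnatr_eq0 -lt0n.
move=> r [[c' cc' <-]|rPsi]; last first.
  rewrite lth; apply: rational_div => //.
  by apply: comm => //; exists c.
have /is_cycleP[i [_ wc' ec' _]] := cc'.
exact: (rational_source_cycle attrK attrL dustK dustL s_gt0 h0 h'0 eig eig' surjf
  c0i c0P connPhi th01 hom wc' ec').
Qed.

(** Both systems are put in homogeneous form over the same [theta]; multiplying or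
    dividing the eigenvectors by the [s]-th power of the potential turns the weights
    [ratio e `^ s] into powers of [theta `^ s]. *)
Lemma commensurable_image : commensurable (cycle_ratios Phi `|` cycle_ratios Psi) ->
  exists f : 'rV[R]_d1 -> 'rV[R]_d2, lipschitz_in (K i0) f /\ f @` K i0 = L j0.
Proof.
move=> comm.
have [h h0 hP] := dimension_eigenvector attrK dustK connPhi s_gt0 dimK.
have [h' h'0 h'P] := dimension_eigenvector attrL dustL connPsi s_gt0 dimL.
have [g g0 gP] := left_eigenvector connPhi h0 hP.
have [e1 [e2 [se ee]]] := branching_vertex s_gt0 connPhi h0 hP.
have [c cc c01] := exists_cycle connPhi.
have cR : cycle_ratios Phi (wr c) by exists c.
have [D D0 DP] := homogeneous_form connPhi c01
  (fun r rP => comm r (wr c) (or_introl rP) (or_introl cR)).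
have [D' D'0 D'P] := homogeneous_form connPsi c01
  (fun r rP => comm r (wr c) (or_intror rP) (or_introl cR)).
have DD0 : (0 < D * D')%N by rewrite muln_gt0 D0.
have [p [k hom]] := DP _ DD0 (dvdn_mulr _ (dvdnn _)).
have [p' [k' hom']] := D'P _ DD0 (dvdn_mull _ (dvdnn _)).
set theta := expR _ in hom hom'.
have th0 : 0 < theta by exact: expR_gt0.
have th01 : 0 < theta < 1.
  by rewrite th0 -[ltRHS]expR0 ltr_expR pmulr_llt0 ?invr_gt0 ?ltr0n// ln_lt0.
pose b := theta `^ s.
have b0 : 0 < b by exact: powR_gt0.
have bX n : b ^+ n = (theta ^+ n) `^ s.
  by rewrite /b -powR_mulrn ?powR_ge0// -powRrM mulrC powRrM powR_mulrn// ltW.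
pose N := (\max_e k e)%N; pose N' := (\max_e k' e)%N.
have kN e : (k e <= N)%N by exact: leq_bigmax.
have k'N e : (k' e <= N')%N by exact: leq_bigmax.
have weight (d : nat) (Xi : gdifs R d) q l (e : edge Xi) : homogeneous Xi theta q l ->
    b ^+ l e * q (src e) `^ s = ratio e `^ s * q (tgt e) `^ s.
  move=> [q0 ql]; rewrite bX -!powRM ?exprn_ge0 ?(ltW th0) ?(ltW (q0 _)) ?(ltW (ratio_gt0 _))//.
  by rewrite (ql e).2.
have [||||||bag [bag0 bagP]] := @bags R d1 d2 Phi Psi k k' N N' _ _ kN k'N b
    (fun i => g i * p i `^ s) (fun j => h' j / p' j `^ s) b0 _ _ _ _ i0.
- by move=> e; exact: (hom.2 e).1.
- by move=> e; exact: (hom'.2 e).1.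
- by move=> i; rewrite mulr_gt0 ?powR_gt0 ?hom.1.
- by move=> j; rewrite divr_gt0 ?powR_gt0 ?hom'.1.
- move=> i; rewrite -[X in _ = X * _]gP mulr_suml; apply: eq_bigr => e /eqP <-.
  by rewrite mulrCA (weight _ _ _ _ _ hom); ring.
- move=> j; rewrite -[X in _ = X / _]h'P mulr_suml; apply: eq_bigr => e /eqP <-.
  have q1 : p' (src e) `^ s != 0 by rewrite gt_eqF// powR_gt0// hom'.1.
  have q2 : p' (tgt e) `^ s != 0 by rewrite gt_eqF// powR_gt0// hom'.1.
  have := weight _ _ _ _ e hom'.
  move=> /(canRL (mulfK q1)) ->.
  by field; rewrite q1 q2.
have [B0 tB0 dB0] := exist_disjoint_pieces attrK dustK connPhi se ee (bag (j0, ord0)) i0.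
have [a0 a00 a0P] : exists2 a0 : R, 0 < a0 & forall b, b \in B0 ->
    exists2 r, a0 <= r & scale theta p i0 b r.
  elim: (B0) => [|x B [a a0 aP]]; first by exists 1.
  pose r := wr x.1 * p (endv i0 x.1) / theta ^+ x.2.
  have r0 : 0 < r by rewrite divr_gt0 ?exprn_gt0// mulr_gt0 ?wr_gt0 ?hom.1.
  exists (Num.min a r); first by rewrite lt_min a0.
  move=> y; rewrite inE => /orP[/eqP ->|/aP[r' ar' sr']].
    exists r; first by rewrite ge_min lexx orbT.
    by rewrite /scale /r divfK// gt_eqF ?exprn_gt0.
  by exists r' => //; rewrite ge_min ar'.
apply: (@lipschitz_extension R d1 d2 Phi Psi K L attrK attrL dustK i0 j0 theta p k p' k' N N'
  th01 hom hom' kN k'N bag bag0 bagP a0 (p' j0) a00 _ B0 dB0).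
- exact: hom'.1.
- split => //=.
  + by rewrite /scale /= wr_nil !expr0 !mulr1 mul1r.
  + by rewrite tB0 perm_refl.
  + move=> x xB; have [/allP wB _ _] := dB0; split; first exact: wB.
    by rewrite expr0 mulr1; exact: a0P.
Qed.

End Directions.

Theorem theorem1p9 (R : realType) (d1 d2 : nat)
  (Phi : gdifs R d1) (Psi : gdifs R d2)
  (X : set 'rV[R]_d1) (Y : set 'rV[R]_d2) (s : R)
  (dustPhi : dust_like Phi) (dustPsi : dust_like Psi)
  (connPhi : strongly_connected Phi) (connPsi : strongly_connected Psi)
  (attrX : attractor_of Phi X) (attrY : attractor_of Psi Y)
  (s_gt0 : 0 < s)
  (dimX : hausdorff_dim X = s%:E) (dimY : hausdorff_dim Y = s%:E)
  (comm : commensurable (cycle_ratios Phi) \/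
          commensurable (cycle_ratios Psi)) :
  (exists f : 'rV[R]_d1 -> 'rV[R]_d2, lipschitz_in X f /\ f @` X = Y)
  <-> commensurable (cycle_ratios Phi `|` cycle_ratios Psi).
Proof.
move: attrX attrY dimX dimY => [K [i [attrK ->]]] [L [j [attrL ->]]] dimK dimL.
split=> [[f [lipf surjf]]|].
  exact: (image_commensurable attrK attrL dustPhi dustPsi connPhi connPsi s_gt0
    dimK dimL lipf surjf comm).
exact: (commensurable_image attrK attrL dustPhi dustPsi connPhi connPsi s_gt0 dimK dimL).
Qed.
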